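(* Let $s\in\mathbb R$ and $1<p<r\le\infty$. Then the following hold. (i) For all $\gamma\in\mathbb R$, $$\dot B^s_{p,r}\setminus\dot{\mathcal B}^s_p(\gamma,\infty)\neq\emptyset.$$ (ii) For all $\beta,\gamma\in\mathbb R$ with $\beta\ne\gamma$, $$\dot{\mathcal B}^s_p(\beta,r)\setminus\dot{\mathcal B}^s_p(\gamma,\infty)\neq\emptyset.$$
   Context: Lorentz spaces: for a measure space $(\Omega,\mu)$ and $1<p<\infty$, $1\le r<\infty$, $L^{p,r}(\Omega,\mu)$ is the space of measurable $g$ with $[g]_{L^{p,r}}=\big(r\int_0^\infty\lambda^r\mu(\{|g|>\lambda\})^{r/p}\frac{d\lambda}{\lambda}\big)^{1/r}<\infty$, and $[g]_{L^{p,\infty}}=\sup_{\lambda>0}\lambda\,\mu(\{|g|>\lambda\})^{1/p}$; $\|\cdot\|_{L^{p,r}}$ denotes a norm equivalent to this quasi-norm. Let $d\ge1$. Fix a radial $\varphi\in C_c^\infty(\mathbb R^d)$ with $\mathrm{supp}\,\varphi\subset\{3/4<|\xi|<7/4\}$, $\varphi=1$ on $\{7/8\le|\xi|\le9/8\}$ and $\sum_{k\in\mathbb Z}\varphi(2^{-k}\xi)=1$ for $\xi\ne0$; put $\widehat{L_kf}(\xi)=\varphi(2^{-k}\xi)\widehat f(\xi)$. $\mathcal S_\infty(\mathbb R^d)$ is the space of Schwartz functions whose Fourier transforms vanish to infinite order at $0$; its dual $\mathcal S_\infty'(\mathbb R^d)$ is identified with tempered distributions modulo polynomials. For $\gamma\in\mathbb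 R$ let $\mu_\gamma(E)=\sum_{k\in\mathbb Z}2^{-k\gamma}\int_{\mathbb R^d}\mathbf 1_E(x,k)\,dx$ on $\mathbb R^d\times\mathbb Z$, and $P^bf(x,k)=2^{kb}L_kf(x)$. $\dot{\mathcal B}^s_p(\gamma,r)$ is the space of $f\in\mathcal S_\infty'(\mathbb R^d)$ with $\|f\|_{\dot{\mathcal B}^s_p(\gamma,r)}=\|P^{s+\gamma/p}f\|_{L^{p,r}(\mathbb R^d\times\mathbb Z,\mu_\gamma)}<\infty$. $\dot B^s_{p,r}$ is the space of $f\in\mathcal S_\infty'(\mathbb R^d)$ with $\big(\sum_{k\in\mathbb Z}2^{ksr}\|L_kf\|_{L^p}^r\big)^{1/r}<\infty$ (supremum over $k$ if $r=\infty$). *)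

(* Defs.v *)
From HB Require Import structures.
From mathcomp Require Import all_boot all_order all_algebra.
From mathcomp Require Import complex.
From mathcomp Require Import all_classical all_reals all_analysis.

Set Implicit Arguments.
Unset Strict Implicit.
Unset Printing Implicit Defensive.

Import Order.TTheory GRing.Theory Num.Theory.
Import numFieldNormedType.Exports.

Local Open Scope classical_set_scope.
Local Open Scope ring_scope.
Local Open Scope complex_scope.

Section measurable_rV.
Context {d0 : measure_display} {T : measurableType d0}.
Variable n : nat.

Let coord : 'I_n -> 'rV[T]_n -> T := fun i v => v ord0 i.

Let rV_set0 : g_sigma_preimage coord set0.
Proof. exact: sigma_algebra0. Qed.

Let rV_setC A : g_sigma_preimage coord A -> g_sigma_preimage coord (~` A).
Proof. exact: sigma_algebraC. Qed.

Let rV_bigcup (F : (set _)^nat) : (forall i, g_sigma_preimage coord (F i)) ->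
  g_sigma_preimage coord (\bigcup_i (F i)).
Proof. exact: sigma_algebra_bigcup. Qed.

HB.instance Definition _ := @isMeasurable.Build (measure_tuple_display d0)
  'rV[T]_n (g_sigma_preimage coord) rV_set0 rV_setC rV_bigcup.

End measurable_rV.

HB.instance Definition _ := isPointed.Build int 0.

HB.instance Definition _ := @isMeasurable.Build default_measure_display
  int discrete_measurable discrete_measurable0
  discrete_measurableC discrete_measurableU.

Section lebesgue_rV.
Variable R : realType.

Definition consr n (z : measurableTypeR R * 'rV[R]_n) : 'rV[R]_n.+1 :=
  row_mx (const_mx z.1 : 'rV_1) z.2.

Lemma measurable_coord n (i : 'I_n) :
  measurable_fun [set: 'rV[R]_n] (fun v => v ord0 i).
Proof.
move=> _ Y mY; rewrite setTI; apply: sub_sigma_algebra => /=.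
rewrite -bigcup_seq/=; exists i => /=; first by rewrite mem_index_enum.
by exists Y => //; rewrite setTI.
Qed.

Lemma measurable_fun_rV d (T : measurableType d) n (f : T -> 'rV[R]_n) :
  (forall i, measurable_fun [set: T] (fun x => f x ord0 i)) ->
  measurable_fun [set: T] f.
Proof.
move=> mf.
suff : g_sigma_preimage (fun i => (fun v : 'rV[R]_n => v ord0 i) \o f)
    `<=` @measurable _ T.
  rewrite g_sigma_preimage_comp => sub _ A mA.
  by apply: sub; exists A.
apply: smallest_sub; first exact: sigma_algebra_measurable.
case: n => [|n] in f mf *; first by rewrite big_ord0.
rewrite -bigcup_mkord_ord; apply: bigcup_sub => i Ii.
by move=> A [B mB <-]; exact: mf.
Qed.

Lemma measurable_consr n : measurable_fun [set: measurableTypeR R * 'rV[R]_n] (@consr n).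
Proof.
apply: measurable_fun_rV; rewrite /consr => i.
case: (@split_ordP 1 n i) => j ->.
  rewrite (_ : (fun _ => _) = fst); first exact: measurable_fst.
  by apply/funext => x; rewrite (@row_mxEl _ 1 1 n) mxE.
rewrite (_ : (fun _ => _) = (fun v : 'rV[R]_n => v ord0 j) \o snd).
  exact: (measurableT_comp (measurable_coord j) measurable_snd).
by apply/funext => x; rewrite (@row_mxEr _ 1 1 n).
Qed.

(* Lebesgue measure on R^n, as the iterated product of the one on R. *)
Fixpoint leb (n : nat) : set 'rV[R]_n -> \bar R :=
  match n with
  | 0 => dirac (0 : 'rV[R]_0)
  | n.+1 => pushforward (lebesgue_measure \x @leb n)%E (@consr n)
  end.

Section leb_succ.
Variables (n : nat) (m : {sigma_finite_measure set 'rV[R]_n -> \bar R}).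

Let mu : set 'rV[R]_n.+1 -> \bar R :=
  pushforward (@lebesgue_measure R \x m)%E (@consr n).

Let M : {measure set 'rV[R]_n.+1 -> \bar R} :=
  measure_function_pushforward__canonical__measure_function_Measure
    (@lebesgue_measure R \x m)%E (@measurable_consr n).

Let mu0 : mu set0 = 0%E. Proof. exact: (measure0 M). Qed.

Let mu_ge0 A : (0 <= mu A)%E. Proof. exact: (measure_ge0 M). Qed.

Let mu_sigma_additive : semi_sigma_additive mu.
Proof. exact: (@measure_semi_sigma_additive _ _ _ M). Qed.

HB.instance Definition _ := isMeasure.Build _ _ _ mu
  mu0 mu_ge0 mu_sigma_additive.

Let mu_sigma_finite : sigma_finite setT mu.
Proof.
have /sigma_finiteP[F [FT ndF Foo]] := sigma_finiteT (@lebesgue_measure R).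
have /sigma_finiteP[G [GT ndG Goo]] := sigma_finiteT m.
pose H k := [set v : 'rV[R]_n.+1 | F k (v ord0 ord0) /\
  G k (\row_i v ord0 (lift ord0 i))].
have HE k : @consr n @^-1` (H k) = F k `*` G k.
  apply/funext => -[x v]; rewrite /H /preimage /mkset /setX /=.
  have -> : consr (x, v) ord0 ord0 = x.
    rewrite (_ : ord0 = @lshift 1 n ord0); last exact/val_inj.
    by rewrite /consr (@row_mxEl _ 1 1 n) mxE.
  congr (_ /\ G k _); apply/rowP => i; rewrite mxE.
  rewrite (_ : @lift n.+1 ord0 i = @rshift 1 n i); last exact/val_inj.
  by rewrite /consr (@row_mxEr _ 1 1 n).
exists H => [|k].
  apply/seteqP; split => // v _.
  have [i _ Fi] : (\bigcup_i F i) (v ord0 ord0) by rewrite -FT.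
  have [j _ Gj] : (\bigcup_i G i) (\row_i v ord0 (lift ord0 i)).
    by rewrite -GT.
  exists (maxn i j) => //; split.
  - by move: Fi; exact/subsetPset/ndF/leq_maxl.
  - by move: Gj; exact/subsetPset/ndG/leq_maxr.
have [mF Foo'] := Foo k; have [mG Goo'] := Goo k.
split.
  apply: measurableI; rewrite -[X in measurable X]setTI.
    exact: (measurable_coord ord0).
  apply: (@measurable_fun_rV _ _ _ (fun v : 'rV[R]_n.+1 =>
    \row_i v ord0 (lift ord0 i))) => // i.
  by under eq_fun do rewrite mxE; exact: measurable_coord.
rewrite /mu /pushforward HE.
by rewrite product_measure1E// lte_mul_pinfty// ge0_fin_numE.
Qed.

HB.instance Definition _ := Measure_isSigmaFinite.Build _ _ _ mu
  mu_sigma_finite.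

Definition leb_succ : {sigma_finite_measure set 'rV[R]_n.+1 -> \bar R} := mu.

End leb_succ.

Let leb_sigma_finite_measure n :
  {m : {sigma_finite_measure set 'rV[R]_n -> \bar R} |
    m = @leb n :> (set _ -> _)}.
Proof.
elim: n => [|n [m mE]]; last by exists (leb_succ m); rewrite /= -mE.
by exists (dirac (0 : 'rV[R]_0)).
Qed.

Section leb_measure.
Variable n : nat.
Let leb0 : leb (set0 : set 'rV[R]_n) = 0%E.
Proof. by rewrite -(svalP (leb_sigma_finite_measure n)) measure0. Qed.

Let leb_ge0 (A : set 'rV[R]_n) : (0 <= leb A)%E.
Proof. by rewrite -(svalP (leb_sigma_finite_measure n)) measure_ge0. Qed.

Let leb_sigma_additive : semi_sigma_additive (@leb n).
Proof.
rewrite -(svalP (leb_sigma_finite_measure n)).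
exact: measure_semi_sigma_additive.
Qed.

HB.instance Definition _ := isMeasure.Build _ _ _ (@leb n)
  leb0 leb_ge0 leb_sigma_additive.

Let leb_sigma_finite : sigma_finite setT (@leb n).
Proof.
by rewrite -(svalP (leb_sigma_finite_measure n)); exact: sigma_finiteT.
Qed.

HB.instance Definition _ := Measure_isSigmaFinite.Build _ _ _ (@leb n)
  leb_sigma_finite.

End leb_measure.
End lebesgue_rV.

Section weighted_measure.
Variables (R : realType) (d : nat) (gamma : R).
Local Open Scope ereal_scope.

Definition mu_gamma (E : set ('rV[R]_d * int)) : \bar R :=
  \esum_(k in [set: int])
    (2 `^ (- (k%:~R * gamma)))%:E * \int[@leb R d]_x (\1_E (x, k))%:E.

Let slice (E : set ('rV[R]_d * int)) k : measurable E ->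
  \int[@leb R d]_x (\1_E (x, k))%:E = leb (ysection E k).
Proof.
move=> mE; rewrite (_ : (fun _ => _) = (EFin \o \1_(ysection E k))).
  by rewrite integral_indic// ?setIT//; exact: measurable_ysection.
by apply/funext => x /=; rewrite !indicE mem_ysection.
Qed.

Let mu_gamma0 : mu_gamma set0 = 0.
Proof.
rewrite /mu_gamma esum1// => k _.
by rewrite slice// ysection0 measure0 mule0.
Qed.

Let mu_gamma_ge0 E : 0 <= mu_gamma E.
Proof.
apply: esum_ge0 => k _; rewrite mule_ge0 ?lee_fin ?powR_ge0//.
by apply: integral_ge0 => x _; rewrite lee_fin.
Qed.

Let mu_gamma_sigma_additive : semi_sigma_additive mu_gamma.
Proof.
move=> F mF tF mUF.
rewrite [X in _ --> X](_ : _ = \sum_(n <oo) mu_gamma (F n)).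
  by apply/cvg_closeP; split; [exact: is_cvg_nneseries|rewrite closeE].
have w0 (i : int) (E : set ('rV[R]_d * int)) : 0 <=
    (2 `^ (- (i%:~R * gamma)))%:E * \int[@leb R d]_x (\1_E (x, i))%:E.
  rewrite mule_ge0 ?lee_fin ?powR_ge0//.
  by apply: integral_ge0 => x _; rewrite lee_fin.
rewrite nneseries_esumT// /mu_gamma esum_esum//.
rewrite (reindex_esum ([set: int] `*` [set: nat]) _ (fun x => (x.2, x.1)));
    last first.
  split=> //=; first by move=> [i1 i2] [j1 j2] /= _ _ [] -> ->.
  by move=> [i1 i2] _; exists (i2, i1).
rewrite -(esum_esum (J := fun=> setT)
  (a := fun k n => (2 `^ (- (k%:~R * gamma)))%:E *
    \int[@leb R d]_x (\1_(F n) (x, k))%:E))//.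
apply: eq_esum => k _; rewrite slice// ysection_bigcup.
rewrite (measure_semi_bigcup (@leb R d))//; last 3 first.
- by move=> n; exact: measurable_ysection.
- exact: trivIset_ysection.
- by rewrite -ysection_bigcup; exact: measurable_ysection.
rewrite -nneseriesZl//.
rewrite nneseries_esumT => [|n]; last by rewrite mule_ge0 ?lee_fin ?powR_ge0.
by apply: eq_esum => n _; rewrite slice.
Qed.

HB.instance Definition _ := isMeasure.Build _ _ _ mu_gamma
  mu_gamma0 mu_gamma_ge0 mu_gamma_sigma_additive.

End weighted_measure.

Local Notation Re := (@complex.Re _).
Local Notation Im := (@complex.Im _).
Local Notation normc := ComplexField.Normc.normc.

Section complex_valued.
Context {d0 : measure_display} {T : measurableType d0} {R : realType}.
Variable mu : {measure set T -> \bar R}.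
Implicit Types g : T -> R[i].

Definition cmeasurable g :=
  measurable_fun setT (Re \o g) /\
  measurable_fun setT (Im \o g).

Definition cintegral g : R[i] :=
  (\int[mu]_x Re (g x))%R +i* (\int[mu]_x Im (g x))%R.

Local Open Scope ereal_scope.

(* The quasi-norm [g]_{L^{p,r}}; the value at r = -oo is irrelevant. *)
Definition lorentz_qnorm (p : R) (r : \bar R) g : \bar R :=
  match r with
  | r%:E => (r%:E * \int[lebesgue_measure]_(l in `]0%R, +oo[)
      ((l `^ r)%:E * mu [set x | (l < normc (g x))%R] `^ (r / p)
        * (l^-1)%:E)) `^ r^-1
  | +oo => ereal_sup [set l%:E * mu [set x | (l < normc (g x))%R] `^ p^-1 |
      l in [set l : R | (0 < l)%R]]
  | -oo => 0
  end.

Definition lorentz (p : R) (r : \bar R) : set (T -> R[i]) :=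
  [set g | cmeasurable g /\ lorentz_qnorm p r g < +oo].

End complex_valued.

Section schwartz.
Context {R : realType} {d : nat}.
Implicit Types (x xi : 'rV[R]_d) (h : 'rV[R]_d -> R[i]).

Definition dotv x xi : R := \sum_i x ord0 i * xi ord0 i.

(* The library norm on 'rV[R]_d is the sup norm. *)
Definition enorm x : R := Num.sqrt (dotv x x).

Definition ccontinuous h :=
  continuous (Re \o h) /\ continuous (Im \o h).

Definition partial (i : 'I_d) h : 'rV[R]_d -> R[i] := fun x =>
  'D_(delta_mx ord0 i) (Re \o h) x +i*
  'D_(delta_mx ord0 i) (Im \o h) x.

Definition partials (w : seq 'I_d) h : 'rV[R]_d -> R[i] :=
  foldr partial h w.

Definition smooth h := forall w : seq 'I_d,
  ccontinuous (partials w h) /\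
  forall (i : 'I_d) x,
    derivable (Re \o partials w h) x (delta_mx ord0 i) /\
    derivable (Im \o partials w h) x (delta_mx ord0 i).

Definition schwartz_seminorm (N : nat) h : \bar R :=
  ereal_sup [set y | exists (w : seq 'I_d) x, (size w <= N)%N /\
    y = ((1 + enorm x) ^+ N * normc (partials w h x))%:E].

Definition schwartz : set ('rV[R]_d -> R[i]) :=
  [set h | smooth h /\ forall N, (schwartz_seminorm N h < +oo)%E].

(* hat h(xi) = int h(x) e^{-i x.xi} dx *)
Definition fourier h : 'rV[R]_d -> R[i] := fun xi =>
  cintegral (@leb R d)
    (fun x => h x * (cos (dotv x xi) -i* sin (dotv x xi))).

Definition schwartz_inf : set ('rV[R]_d -> R[i]) :=
  [set h | schwartz h /\ forall w, partials w (fourier h) 0 = 0].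

(* An element of the dual of schwartz_inf is represented by a function on all
   of 'rV[R]_d -> R[i]; its values outside schwartz_inf are irrelevant. *)
Definition schwartz_inf_dual : set (('rV[R]_d -> R[i]) -> R[i]) :=
  [set f |
    (forall (a : R[i]) h1 h2, schwartz_inf h1 -> schwartz_inf h2 ->
      f (fun x => a * h1 x + h2 x) = a * f h1 + f h2) /\
    exists (M : R) (N : nat), 0 <= M /\ forall h, schwartz_inf h ->
      ((normc (f h))%:E <= M%:E * schwartz_seminorm N h)%E].

Definition poly_growth h := exists (M : R) (N : nat),
  forall x, normc (h x) <= M * (1 + enorm x) ^+ N.

Definition dist_of h : ('rV[R]_d -> R[i]) -> R[i] := fun eta =>
  cintegral (@leb R d) (fun x => h x * eta x).

Definition fourier_dist (f : ('rV[R]_d -> R[i]) -> R[i]) :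
  ('rV[R]_d -> R[i]) -> R[i] := fun eta => f (fourier eta).

End schwartz.

Section littlewood_paley.
Context {R : realType} {d : nat}.
Variable phi : 'rV[R]_d -> R[i].
Implicit Types (f : ('rV[R]_d -> R[i]) -> R[i]) (u : int -> 'rV[R]_d -> R[i]).

Definition csupp : set 'rV[R]_d := closure [set xi | phi xi != 0].

Definition LP_cutoff :=
  [/\ smooth phi /\ compact csupp,
      forall xi eta, enorm xi = enorm eta -> phi xi = phi eta,
      csupp `<=` [set xi | 3 / 4 < enorm xi < 7 / 4],
      forall xi, 7 / 8 <= enorm xi <= 9 / 8 -> phi xi = 1 &
      forall xi, xi != 0 ->
        \sum_(k \in [set: int]) phi ((2 : R) ^ (- k) *: xi) = 1].

(* L_k f is a smooth function of polynomial growth, as phi is supported away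
   from 0; it is the only continuous g such that, as tempered distributions,
   the Fourier transform of g is phi(2^{-k} .) times that of f. For eta
   Schwartz, the Fourier transform of phi(2^{-k} .) eta is in schwartz_inf. *)
Definition is_LP_piece f (k : int) (g : 'rV[R]_d -> R[i]) :=
  [/\ ccontinuous g, poly_growth g &
    forall eta, schwartz eta ->
      fourier_dist (dist_of g) eta =
      fourier_dist f (fun xi => phi ((2 : R) ^ (- k) *: xi) * eta xi)].

Definition is_LP f u := forall k, is_LP_piece f k (u k).

Definition Pop (b : R) u : 'rV[R]_d * int -> R[i] := fun z =>
  (2 `^ (z.2%:~R * b))%:C * u z.2 z.1.

Definition lorentz_besov (s p gamma : R) (r : \bar R) :
    set (('rV[R]_d -> R[i]) -> R[i]) :=
  [set f | schwartz_inf_dual f /\ exists u, is_LP f u /\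
    lorentz (@mu_gamma R d gamma) p r (Pop (s + gamma / p) u)].

Local Open Scope ereal_scope.

(* The value at r = -oo is irrelevant. *)
Definition besov_norm (s p : R) (r : \bar R) u : \bar R :=
  let N k := 'N[@leb R d]_p%:E[EFin \o (fun x => normc (u k x))] in
  match r with
  | r%:E => (\esum_(k in [set: int])
      ((2 `^ (k%:~R * s * r))%:E * N k `^ r)) `^ r^-1
  | +oo => ereal_sup [set (2 `^ (k%:~R * s))%:E * N k | k in [set: int]]
  | -oo => 0
  end.

Definition besov (s p : R) (r : \bar R) : set (('rV[R]_d -> R[i]) -> R[i]) :=
  [set f | schwartz_inf_dual f /\ exists u, is_LP f u /\
    besov_norm s p r u < +oo].

End littlewood_paley.

(* Main.v *)
(** Lacunary sums of modulated Fejer-type bumps. Let [b_n] be the product over the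
    coordinates of [sinc^2 (w_n x_i)], modulated by the frequency [2^n] along the
    first axis. When [w_n] is small, the Fourier transform of [b_n] lives where
    [phi (2^-n .) = 1] and all other cutoffs vanish, so [f = sum_n a_n b_n] has
    [L_n f = a_n b_n] for [n >= 0] and [L_k f = 0] for [k < 0].

    Group the frequencies into the blocks [2^j <= n + 1 < 2^(j+1)], and pick [a_n]
    and [w_n] such that [2^(n(s + gamma/p)) a_n] is a constant [h_j] on the block and
    [2^(- n gamma) w_n^-d h_j^p = 2^(- j kappa)]. At height [h_j] the [2^j] bumps of
    a block add up in the distribution function for [mu_gamma], so the weak norm is
    at least of order [2^(j (1 - kappa) / p)], unbounded as [kappa < 1]; the Besov
    norm is [(sum_j 2^j 2^(- j kappa r / p))^(1/r)], finite as [kappa > p / r].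
    For [beta <> gamma] the heights seen by [P^(s + beta/p)] vary geometrically
    within a block instead, so at every level only boundedly many bumps of a block
    matter and the Lorentz norm behaves like the Besov norm. The same [f] therefore
    serves both claims. *)

Require Import Defs.
From mathcomp Require Import all_boot all_order all_algebra.
From mathcomp Require Import complex.
From mathcomp Require Import all_classical all_reals all_analysis.
From mathcomp Require Import measurable_realfun gauss_integral.
From mathcomp Require Import ring lra zify.

Set Implicit Arguments.
Unset Strict Implicit.
Unset Printing Implicit Defensive.

Import Order.TTheory GRing.Theory Num.Theory.
Import numFieldNormedType.Exports.

Local Open Scope classical_set_scope.
Local Open Scope ring_scope.
Local Open Scope complex_scope.

Local Notation Re := (@complex.Re _).
Local Notation Im := (@complex.Im _).
Local Notation normc := (@ComplexField.Normc.normc _).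

(** Membership in the Lorentz scale only asks for some family [u] of Littlewood-Paley pieces, so
    non-membership has to exclude every family: the pieces must be unique. Fourier inversion is
    avoided. The transform of a modulated Gaussian comes in closed form from a differential
    equation, and pairings with such transforms are Gaussian averages, which recover a continuous
    function of polynomial growth.

    The bumps need an explicitly band-limited transform. The square of sinc has one by a
    trigonometric identity, and it is integrable, so pairings move to the frequency side by Fubini.
    Its slow tails are handled by Markov's inequality: the level set at l of a bump of height h has
    measure at most of order (h/l) times its volume, which beats (h/l)^p by the factor (l/h)^(p-1).
    As p > 1 this decays at low levels; half of the decay is summed over the bumps, the other half
    is integrated in l.

    Widening a bump with h^p w^-d kept fixed does not change the order of its L^p norm. This freedom
    makes the sum converge and fits each spectrum into its annulus. *)

(** * Changes of variables, product measures and complex-valued integrals *)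

Section transport.
Context {d0 : measure_display} {T : measurableType d0} {R : realType}.
Variables (mu : {measure set T -> \bar R}) (phi : T -> T) (k : {nonneg R}).
Hypothesis mphi : measurable_fun [set: T] phi.
Hypothesis mu_phi : forall A, measurable A ->
  mu (phi @^-1` A) = (k%:num%:E * mu A)%E.

(** On measurable sets the pushforward of [mu] along [phi] is [mu] scaled by [k], so both sides
    integrate [f] against the same measure. Applied below to affine maps and to the reflection of
    the line. *)
Lemma ge0_integral_transport (f : T -> \bar R) :
  measurable_fun setT f -> (forall x, 0 <= f x)%E ->
  (\int[mu]_x f (phi x) = k%:num%:E * \int[mu]_x f x)%E.
Proof.
move=> mf f0.
have := @ge0_integral_pushforward _ _ T T R phi mphi mu setT f measurableT mf (fun y _ => f0 y).
rewrite preimage_setT => <-.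
rewrite -ge0_integral_mscale//.
by apply: (@eq_measure_integral _ _ _ setT (mscale k mu) (measure_function_pushforward__canonical__measure_function_Measure mu mphi)) => A mA _; exact: mu_phi.
Qed.

Lemma integrable_transport (f : T -> R) :
  mu.-integrable setT (EFin \o f) -> mu.-integrable setT (EFin \o (f \o phi)).
Proof.
move=> /integrableP[mf foo]; apply/integrableP; split.
  by apply: (measurableT_comp mf mphi).
rewrite (@ge0_integral_transport (fun x => `|(f x)%:E|%E))//.
  by rewrite lte_mul_pinfty// lee_fin.
exact: measurableT_comp.
Qed.

Lemma Rintegral_transport (f : T -> R) :
  mu.-integrable setT (EFin \o f) ->
  \int[mu]_x f (phi x) = k%:num * \int[mu]_x f x.
Proof.
move=> fi; have fi' := integrable_transport fi.
have /integrableP[mf _] := fi.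
rewrite /Rintegral -[X in X * _]/(fine k%:num%:E) -fineM//; last exact: integrable_fin_num.
congr fine.
rewrite integralE [X in (_ * X)%E]integralE muleBr; first last.
- apply: fin_num_adde_defr; apply: integrable_fin_num => //.
  by apply: integrable_funepos.
- by [].
congr (_ - _)%E.
  rewrite (_ : (fun x => (f (phi x))%:E) = (EFin \o f) \o phi)// funepos_comp.
  by apply: (ge0_integral_transport (measurable_funepos mf)) => x; exact: funepos_ge0.
rewrite (_ : (fun x => (f (phi x))%:E) = (EFin \o f) \o phi)// funeneg_comp.
by apply: (ge0_integral_transport (measurable_funeneg mf)) => x; exact: funeneg_ge0.
Qed.

End transport.

Section affine.
Variable R : realType.
Local Notation leb1 := (@lebesgue_measure R).

Let aff (c y : R) : measurableTypeR R -> measurableTypeR R := fun x => c * x + y.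

Lemma measurable_aff c y : measurable_fun setT (aff c y).
Proof. by apply: measurable_funD => //; exact: measurable_funM. Qed.

(** Uniqueness of Lebesgue measure: [c] times the pushforward gives half-open intervals their
    length. *)
Lemma lebesgue_affine (c y : R) (A : set R) : 0 < c -> measurable A ->
  leb1 ((fun x => c * x + y) @^-1` A) = ((c^-1)%:E * leb1 A)%E.
Proof.
move=> c0 mA.
pose M : {measure set (measurableTypeR R) -> \bar R} :=
  measure_function_pushforward__canonical__measure_function_Measure leb1 (measurable_aff c y).
pose k : {nonneg R} := NngNum (ltW c0).
have := @lebesgue_measure_unique R (mscale k M) _ A mA.
rewrite /= /mscale/= /pushforward => ->.
  by rewrite muleA -EFinM mulVf ?gt_eqF// mul1e.
move=> _ [[a b] /= _ <-].
have -> : aff c y @^-1` `]a, b]%classic = `](a - y) / c, (b - y) / c]%classic.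
  by apply/seteqP; split => x /=; rewrite !in_itv/= /aff ltr_pdivrMr// ler_pdivlMr// ltrBlDr lerBrDr (mulrC x).
rewrite !lebesgue_measure_itv/= !lte_fin ltr_pM2r ?invr_gt0// ltrD2r.
case: ifPn => ab; last by rewrite mule0.
rewrite -!EFinD -EFinM; congr EFin; field.
by rewrite gt_eqF.
Qed.

End affine.

Section leb_affine.
Variable R : realType.
Local Notation leb1 := (@lebesgue_measure R).

Lemma consr0 n (z : R * 'rV[R]_n) : @consr R n z ord0 ord0 = z.1.
Proof.
rewrite (_ : ord0 = @lshift 1 n ord0); last exact/val_inj.
by rewrite /consr (@row_mxEl _ 1 1 n) mxE.
Qed.

Lemma consrS n (z : R * 'rV[R]_n) (i : 'I_n) :
  @consr R n z ord0 (lift ord0 i) = z.2 ord0 i.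
Proof.
rewrite (_ : @lift n.+1 ord0 i = @rshift 1 n i); last exact/val_inj.
by rewrite /consr (@row_mxEr _ 1 1 n).
Qed.

Lemma ord_lift_ind n (P : 'I_n.+1 -> Prop) : P ord0 ->
  (forall i, P (lift ord0 i)) -> forall i, P i.
Proof.
move=> P0 PS i; case: (unliftP ord0 i) => [j ->|->]; [exact: PS|exact: P0].
Qed.

Lemma lebS n (A : set 'rV[R]_n.+1) :
  leb A = (\int[leb1]_t leb (xsection (@consr R n @^-1` A) t))%E.
Proof. by []. Qed.

Lemma affmxE n (c : R) (x y : 'rV[R]_n) i :
  (c *: x + y) ord0 i = c * x ord0 i + y ord0 i.
Proof. by rewrite !mxE. Qed.

Lemma measurable_affine_rV n (c : R) (y : 'rV[R]_n) :
  measurable_fun setT (fun x : 'rV[R]_n => c *: x + y).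
Proof.
apply: measurable_fun_rV => i.
rewrite (_ : (fun _ => _) = (fun x : 'rV[R]_n => c * x ord0 i + y ord0 i)).
  apply: measurable_funD => //; apply: measurable_funM => //.
  exact: measurable_coord.
by apply/funext => x; rewrite !mxE.
Qed.

(** Induction along the iterated product: the section at [t] of the preimage is the preimage of the
    section at [c * t + y0], and the outer integral is a one-dimensional change of variables. *)
Lemma leb_affine n (c : R) (y : 'rV[R]_n) (A : set 'rV[R]_n) : 0 < c ->
  measurable A ->
  leb ((fun x => c *: x + y) @^-1` A) = ((c^-1 ^+ n)%:E * leb A)%E.
Proof.
move=> c0; elim: n y A => [|n IH] y A mA.
  rewrite expr0 mul1e; congr (leb _); apply/funext => x.
  by rewrite /preimage /= [in RHS](thinmx0 x) (thinmx0 (_ + _)).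
pose y0 := y ord0 ord0; pose y' : 'rV[R]_n := \row_i y ord0 (lift ord0 i).
pose B := @consr R n @^-1` A.
have mB : measurable B.
  by rewrite -[B]setTI; exact: (measurable_consr (n := n)).
have yE t v : c *: @consr R n (t, v) + y = consr (c * t + y0, c *: v + y').
  apply/rowP; apply: ord_lift_ind => [|i].
    by rewrite affmxE !consr0.
  by rewrite affmxE !consrS/= affmxE /y' mxE.
have step t : xsection (@consr R n @^-1` ((fun x => c *: x + y) @^-1` A)) t =
    (fun v => c *: v + y') @^-1` xsection B (c * t + y0).
  apply/seteqP; split => v; rewrite /xsection/= ?inE /B /preimage/=;
  by rewrite ?inE/= yE.
rewrite !lebS.
transitivity (\int[leb1]_t ((c^-1 ^+ n)%:E * leb (xsection B (c * t + y0)%R)))%E.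
  apply: eq_integral.
  by move=> t _; rewrite step IH//; exact: measurable_xsection.
rewrite ge0_integralZl//=; first last.
- by rewrite lee_fin exprn_ge0// invr_ge0 ltW.
- apply: (@measurableT_comp _ _ _ _ _ _ (fun t => leb (xsection B t)) _ (fun t => c * t + y0)).
    exact: measurable_fun_xsection.
  exact: measurable_aff.
rewrite exprS mulrC EFinM -muleA; congr (_ * _)%E.
pose k := NngNum (ltW (eqbRL (invr_gt0 c) c0)).
have H (C : set (measurableTypeR R)) : measurable C -> leb1 ((fun t => c * t + y0) @^-1` C) = (k%:num%:E * leb1 C)%E.
  by move=> mC; rewrite lebesgue_affine.
rewrite (@ge0_integral_transport _ _ R leb1 _ k (measurable_aff c y0) H (fun t => leb (xsection B t)))//.
exact: measurable_fun_xsection.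
Qed.
End leb_affine.

Section tensor.
Context {d1 d2} {T1 : measurableType d1} {T2 : measurableType d2} {R : realType}.
Variables (m1 : {sigma_finite_measure set T1 -> \bar R}).
Variables (m2 : {sigma_finite_measure set T2 -> \bar R}).
Variables (f : T1 -> R) (g : T2 -> R).
Hypothesis fi : m1.-integrable setT (EFin \o f).
Hypothesis gi : m2.-integrable setT (EFin \o g).

Lemma integrable_tensor :
  (m1 \x m2)%E.-integrable setT (EFin \o (fun z => f z.1 * g z.2)).
Proof.
have /integrableP[mf foo] := fi; have /integrableP[mg goo] := gi.
have mf' : measurable_fun setT f by exact/measurable_EFinP.
have mg' : measurable_fun setT g by exact/measurable_EFinP.
apply/integrable12ltyP.
  by apply/measurable_EFinP; apply: measurable_funM => //; exact: measurableT_comp.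
have -> : (\int[m1]_x \int[m2]_y `|(f x * g y)%:E| =
    \int[m1]_x (`|(f x)%:E| * \int[m2]_y `|(g y)%:E|))%E.
  apply: eq_integral => x _.
  rewrite -ge0_integralZl//; last exact: measurableT_comp.
  by apply: eq_integral => y _; rewrite -abseM.
rewrite ge0_integralZr//.
- by rewrite lte_mul_pinfty//; [exact: integral_ge0|rewrite ge0_fin_numE//; exact: integral_ge0].
- exact: measurableT_comp.
- exact: integral_ge0.
Qed.

Lemma Rintegral_tensor :
  \int[(m1 \x m2)%E]_z (f z.1 * g z.2) = \int[m1]_x f x * \int[m2]_y g y.
Proof.
have gf : (\int[m2]_y (g y)%:E)%E \is a fin_num by exact: integrable_fin_num.
rewrite /Rintegral -(integral12_prod_meas1 integrable_tensor) /fubini_F/=.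
have -> : (\int[m1]_x \int[m2]_y (f x * g y)%:E =
    \int[m1]_x ((fine (\int[m2]_y (g y)%:E))%:E * (f x)%:E))%E.
  apply: eq_integral => x _; rewrite fineK// muleC -integralZl//.
rewrite integralZl// fineM//; first by rewrite mulrC.
exact: integrable_fin_num.
Qed.

End tensor.

Section complex_basics.
Variable R : realType.
Implicit Types z w : R[i].

Lemma cReM z w : Re (z * w) = Re z * Re w - Im z * Im w.
Proof. by case: z w => [a b] [c d]. Qed.

Lemma cImM z w : Im (z * w) = Re z * Im w + Im z * Re w.
Proof. by case: z w => [a b] [c d]. Qed.

Lemma cReD z w : Re (z + w) = Re z + Re w.
Proof. by case: z w => [a b] [c d]. Qed.

Lemma cImD z w : Im (z + w) = Im z + Im w.
Proof. by case: z w => [a b] [c d]. Qed.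

Lemma eqReIm z w : Re z = Re w -> Im z = Im w -> z = w.
Proof. by case: z w => [a b] [c d] /= -> ->. Qed.

Lemma normcE2 z : normc z = Num.sqrt (Re z ^+ 2 + Im z ^+ 2).
Proof. by case: z. Qed.

Lemma normc_ge0 z : 0 <= normc z.
Proof. by rewrite normcE2 sqrtr_ge0. Qed.

Lemma Re_le_normc z : `|Re z| <= normc z.
Proof. by rewrite normcE2 -sqrtr_sqr ler_sqrt ?lerDl ?sqr_ge0// addr_ge0 ?sqr_ge0. Qed.

Lemma Im_le_normc z : `|Im z| <= normc z.
Proof. by rewrite normcE2 -sqrtr_sqr ler_sqrt ?lerDr ?sqr_ge0// addr_ge0 ?sqr_ge0. Qed.

Lemma normc_le_ReIm z : normc z <= `|Re z| + `|Im z|.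
Proof.
rewrite normcE2 -[leRHS]ger0_norm ?addr_ge0// -sqrtr_sqr ler_wsqrtr//.
by rewrite sqrrD !real_normK ?num_real// lerD2r lerDl mulrn_wge0// mulr_ge0.
Qed.

Lemma normc_real (a : R) : normc a%:C = `|a|.
Proof. by rewrite /= expr0n/= addr0 sqrtr_sqr. Qed.

Definition Cis (t : R) : R[i] := cos t +i* sin t.

Lemma CisD s t : Cis (s + t) = Cis s * Cis t.
Proof. by rewrite /Cis cosD sinD; apply: eqReIm; rewrite ?cReM ?cImM//= addrC mulrC [X in _ + X]mulrC addrC mulrC. Qed.

Lemma CisN t : Cis (- t) = cos t -i* sin t.
Proof. by rewrite /Cis cosN sinN. Qed.

Lemma Cis0 : Cis 0 = 1.
Proof. by rewrite /Cis cos0 sin0. Qed.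

Lemma normc_Cis t : normc (Cis t) = 1.
Proof. by rewrite /= cos2Dsin2 sqrtr1. Qed.

Lemma Cis_sum n (a : 'I_n -> R) : Cis (\sum_i a i) = \prod_i Cis (a i).
Proof. exact: (big_morph Cis CisD Cis0). Qed.

End complex_basics.

Section cmeasurable.
Context {d0 : measure_display} {T : measurableType d0} {R : realType}.
Implicit Types f g : T -> R[i].

Lemma cmeasurableM f g : cmeasurable f -> cmeasurable g ->
  cmeasurable (fun x => f x * g x).
Proof.
move=> [f1 f2] [g1 g2]; split.
  rewrite (_ : _ \o _ = (fun x => Re (f x) * Re (g x) - Im (f x) * Im (g x))).
    by apply: measurable_funB; apply: measurable_funM.
  by apply/funext => x /=; rewrite cReM.
rewrite (_ : _ \o _ = (fun x => Re (f x) * Im (g x) + Im (f x) * Re (g x))).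
  by apply: measurable_funD; apply: measurable_funM.
by apply/funext => x /=; rewrite cImM.
Qed.

Lemma cmeasurable_cst (c : R[i]) : cmeasurable (fun _ : T => c).
Proof. by split; exact: measurable_cst. Qed.

Lemma cmeasurable_real (f : T -> R) : measurable_fun setT f ->
  cmeasurable (fun x => (f x)%:C).
Proof. by split => //; exact: measurable_cst. Qed.

Lemma cmeasurable_Cis (f : T -> R) : measurable_fun setT f ->
  cmeasurable (fun x => Cis (f x)).
Proof.
move=> mf; split.
  exact: (measurableT_comp (continuous_measurable_fun (@continuous_cos R)) mf).
exact: (measurableT_comp (continuous_measurable_fun (@continuous_sin R)) mf).
Qed.

Lemma cmeasurable_prod n (f : 'I_n -> T -> R[i]) :
  (forall i, cmeasurable (f i)) -> cmeasurable (fun x => \prod_i f i x).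
Proof.
elim: n f => [|n IH] f mf.
  by under eq_fun do rewrite big_ord0; exact: cmeasurable_cst.
under eq_fun do rewrite big_ord_recl; apply: cmeasurableM => //.
exact: IH.
Qed.

Lemma measurable_normc f : cmeasurable f -> measurable_fun setT (normc \o f).
Proof.
move=> [f1 f2]; rewrite (_ : _ \o _ = (fun x => Num.sqrt (Re (f x) ^+ 2 + Im (f x) ^+ 2))).
  apply: (measurableT_comp (continuous_measurable_fun (@sqrt_continuous R))).
  by apply: measurable_funD; apply: measurable_funX.
by apply/funext => x /=; rewrite normcE2.
Qed.

End cmeasurable.

Lemma cmeasurable_comp {d1 d2} {T1 : measurableType d1} {T2 : measurableType d2}
    {R : realType} (g : T2 -> R[i]) (h : T1 -> T2) :
  cmeasurable g -> measurable_fun setT h -> cmeasurable (g \o h).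
Proof.
by move=> [g1 g2] mh; split; [exact: (measurableT_comp g1 mh)|exact: (measurableT_comp g2 mh)].
Qed.

Section cintegral.
Context {d0 : measure_display} {T : measurableType d0} {R : realType}.
Variable mu : {measure set T -> \bar R}.
Implicit Types f g : T -> R[i].

Definition cintegrable g :=
  mu.-integrable setT (EFin \o (Re \o g)) /\
  mu.-integrable setT (EFin \o (Im \o g)).

Lemma cintegrable_measurable g : cintegrable g -> cmeasurable g.
Proof. by move=> [/integrableP[/measurable_EFinP ? _] /integrableP[/measurable_EFinP ? _]]. Qed.

Lemma cintegrable_le g (h : T -> R) : cmeasurable g ->
  mu.-integrable setT (EFin \o h) -> (forall x, normc (g x) <= h x) ->
  cintegrable g.
Proof.
move=> [m1 m2] hi gh; split; apply: (le_integrable _ _ _ hi) => //;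
  try exact/measurable_EFinP.
- move=> x _ /=; rewrite lee_fin (le_trans (Re_le_normc _))// (le_trans (gh x))//.
  exact: ler_norm.
- move=> x _ /=; rewrite lee_fin (le_trans (Im_le_normc _))// (le_trans (gh x))//.
  exact: ler_norm.
Qed.

Lemma cintegrable_normc g : cintegrable g ->
  mu.-integrable setT (EFin \o (normc \o g)).
Proof.
move=> gi; have mg := cintegrable_measurable gi.
have [/integrable_norm g1 /integrable_norm g2] := gi.
apply: (le_integrable _ _ _ (integrableD _ g1 g2)) => //.
  exact/measurable_EFinP/measurable_normc.
move=> x _ /=; rewrite lee_fin [leRHS]ger0_norm ?addr_ge0// ger0_norm ?normc_ge0//.
exact: normc_le_ReIm.
Qed.

Lemma cintegrableZ c g : cintegrable g -> cintegrable (fun x => c * g x).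
Proof.
move=> gi; apply: (@cintegrable_le _ (fun x => normc c * normc (g x))).
- by apply: cmeasurableM; [exact: cmeasurable_cst|exact: cintegrable_measurable].
- have := integrableZl measurableT (normc c) (cintegrable_normc gi).
  exact.
- by move=> x; rewrite ComplexField.Normc.normcM.
Qed.

Lemma cintegralD f g : cintegrable f -> cintegrable g ->
  cintegral mu (fun x => f x + g x) = cintegral mu f + cintegral mu g.
Proof.
move=> [f1 f2] [g1 g2]; apply: eqReIm; rewrite ?cReD ?cImD /=.
  by rewrite -RintegralD//; congr (Rintegral _ _ _); apply/funext => x; rewrite cReD.
by rewrite -RintegralD//; congr (Rintegral _ _ _); apply/funext => x; rewrite cImD.
Qed.

Let Zl (c : R) (f : T -> R) : mu.-integrable setT (EFin \o f) ->
  mu.-integrable setT (EFin \o (fun x => c * f x)).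
Proof. by move=> fi; have := integrableZl measurableT c fi. Qed.

Lemma cintegralZ c g : cintegrable g ->
  cintegral mu (fun x => c * g x) = c * cintegral mu g.
Proof.
move=> [g1 g2]; apply: eqReIm; rewrite ?cReM ?cImM /=.
  rewrite -!RintegralZl// -RintegralB//; try exact: Zl.
  by congr (Rintegral _ _ _); apply/funext => x; rewrite cReM.
rewrite -!RintegralZl// -RintegralD//; try exact: Zl.
by congr (Rintegral _ _ _); apply/funext => x; rewrite cImM.
Qed.

Lemma cintegral_real (f : T -> R) :
  cintegral mu (fun x => (f x)%:C) = (\int[mu]_x f x)%:C.
Proof. by apply: eqReIm => //=; rewrite /Rintegral integral0. Qed.

(** Real and imaginary parts are bounded separately, which costs the factor 2. *)
Lemma normc_cintegral g : cintegrable g ->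
  normc (cintegral mu g) <= 2 * \int[mu]_x normc (g x).
Proof.
move=> gi; have [g1 g2] := gi; have ni := cintegrable_normc gi.
apply: (le_trans (normc_le_ReIm _)); rewrite mulr_natl mulr2n lerD//=.
  apply: (le_trans (le_normr_Rintegral _ g1)) => //.
  by apply: le_Rintegral => //[|x _]; [exact: integrable_norm|exact: Re_le_normc].
apply: (le_trans (le_normr_Rintegral _ g2)) => //.
by apply: le_Rintegral => //[|x _]; [exact: integrable_norm|exact: Im_le_normc].
Qed.

End cintegral.

Section ctensor.
Context {d1 d2} {T1 : measurableType d1} {T2 : measurableType d2} {R : realType}.
Variables (m1 : {sigma_finite_measure set T1 -> \bar R}).
Variables (m2 : {sigma_finite_measure set T2 -> \bar R}).
Variables (f : T1 -> R[i]) (g : T2 -> R[i]).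
Hypothesis fi : cintegrable m1 f.
Hypothesis gi : cintegrable m2 g.

Lemma cintegrable_tensor :
  cintegrable (m1 \x m2)%E (fun z => f z.1 * g z.2).
Proof.
apply: (@cintegrable_le _ _ _ _ _ (fun z => normc (f z.1) * normc (g z.2))).
- apply: cmeasurableM.
    apply: (cmeasurable_comp (cintegrable_measurable fi)); exact: measurable_fst.
  apply: (cmeasurable_comp (cintegrable_measurable gi)); exact: measurable_snd.
- exact: (integrable_tensor (cintegrable_normc fi) (cintegrable_normc gi)).
- by move=> x; rewrite ComplexField.Normc.normcM.
Qed.

Lemma cintegral_tensor :
  cintegral (m1 \x m2)%E (fun z => f z.1 * g z.2) = cintegral m1 f * cintegral m2 g.
Proof.
have [f1 f2] := fi; have [g1 g2] := gi.
apply: eqReIm; rewrite ?cReM ?cImM /=.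
  rewrite -(Rintegral_tensor f1 g1) -(Rintegral_tensor f2 g2) -RintegralB//;
    try exact: integrable_tensor.
  by congr (Rintegral _ _ _); apply/funext => x; rewrite cReM.
rewrite -(Rintegral_tensor f1 g2) -(Rintegral_tensor f2 g1) -RintegralD//;
  try exact: integrable_tensor.
by congr (Rintegral _ _ _); apply/funext => x; rewrite cImM.
Qed.

End ctensor.

Section cfubini.
Context {d1 d2} {T1 : measurableType d1} {T2 : measurableType d2} {R : realType}.
Variables (m1 : {sigma_finite_measure set T1 -> \bar R}).
Variables (m2 : {sigma_finite_measure set T2 -> \bar R}).
Variable K : T1 * T2 -> R[i].
Hypothesis Ki : cintegrable (m1 \x m2)%E K.

Let rfub (k : T1 * T2 -> R) : (m1 \x m2)%E.-integrable setT (EFin \o k) ->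
  \int[m1]_x \int[m2]_y k (x, y) = \int[m2]_y \int[m1]_x k (x, y).
Proof.
move=> ki; rewrite /Rintegral; congr fine.
(* The real inner integral is the [fine] part of the extended one. The two are identified where the
   section is integrable, that is for almost every [x]. *)
transitivity (\int[m1]_x \int[m2]_y (k (x, y))%:E)%E.
  apply: ae_eq_integral => //.
  - apply/measurable_EFinP.
    apply: (measurableT_comp (@fine_measurable _ _ measurableT)).
    exact: (measurable_fubini_F ki).
  - exact: (measurable_fubini_F ki).
  - have := ae_integrable1 ki; apply: filterS => x /= xi _.
    by rewrite fineK//; exact: integrable_fin_num.
transitivity (\int[m2]_y \int[m1]_x (k (x, y))%:E)%E.
  exact: (Fubini ki).
apply: ae_eq_integral => //.
- exact: (measurable_fubini_G ki).
- apply/measurable_EFinP.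
  apply: (measurableT_comp (@fine_measurable _ _ measurableT)).
  exact: (measurable_fubini_G ki).
- have := ae_integrable2 ki; apply: filterS => x /= xi _.
  by rewrite fineK//; exact: integrable_fin_num.
Qed.

Lemma cfubini : cintegral m1 (fun x => cintegral m2 (fun y => K (x, y))) =
  cintegral m2 (fun y => cintegral m1 (fun x => K (x, y))).
Proof.
have [k1 k2] := Ki.
by apply: eqReIm => /=; [exact: (rfub k1)|exact: (rfub k2)].
Qed.

End cfubini.

Section leb_prod.
Variable R : realType.
Local Notation leb1 := (@lebesgue_measure R).

Let integral_leb0 (f : 'rV[R]_0 -> \bar R) : measurable_fun setT f ->
  (\int[@leb R 0]_x f x = f 0%R)%E.
Proof.
move=> mf; have := integral_dirac (0 : 'rV[R]_0) measurableT mf.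
by rewrite diracT mul1e => <-.
Qed.

(** [leb] in dimension [n.+1] is the pushforward under [consr] of a product measure, and the
    integrand pulled back along [consr] is a tensor product. In dimension 0 the measure is a Dirac
    mass and the empty product is 1. *)
Lemma cintegral_leb_prod n (g : 'I_n -> R -> R[i]) :
  (forall i, cintegrable leb1 (g i)) ->
  cintegrable (@leb R n) (fun x => \prod_i g i (x ord0 i)) /\
  cintegral (@leb R n) (fun x => \prod_i g i (x ord0 i)) =
    \prod_i cintegral leb1 (g i).
Proof.
elim: n g => [|n IH] g gi.
  rewrite big_ord0; under [in X in X /\ _]eq_fun do rewrite big_ord0.
  under [X in cintegral _ X]eq_fun do rewrite big_ord0.
  split.
    split; apply/integrableP; split; try exact: (measurable_cst (1:R)%:E);
      try exact: (measurable_cst (0:R)%:E).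
      by rewrite integral_leb0/= ?normr1 ?ltry.
    by rewrite integral_leb0/= ?normr0 ?ltry.
  have E0 (c : R) : \int[@leb R 0]_x c = c.
    exact: (congr1 fine (integral_leb0 (measurable_cst c%:E))).
  by rewrite /cintegral !E0.
have [Hi HE] := IH (fun i => g (lift ord0 i)) (fun i => gi _).
have Ti := cintegrable_tensor (gi ord0) Hi.
have TE := cintegral_tensor (gi ord0) Hi.
pose F (x : 'rV[R]_n.+1) := \prod_i g i (x ord0 i).
pose F' (z : R * 'rV[R]_n) := g ord0 z.1 * \prod_i g (lift ord0 i) (z.2 ord0 i).
have FE : F \o @consr R n = F'.
  apply/funext => -[t v]; rewrite /F /F'/= big_ord_recl consr0; congr (_ * _).
  by apply: eq_bigr => i _; rewrite consrS.
have mF : cmeasurable F.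
  apply: cmeasurable_prod => i.
  exact: (cmeasurable_comp (cintegrable_measurable (gi i)) (measurable_coord i)).
have [mF1 mF2] := mF; have [Ti1 Ti2] := Ti.
(* To be used with [k] the real and the imaginary part. *)
have P (k : R[i] -> R) : measurable_fun setT (k \o F) ->
    (leb1 \x @leb R n)%E.-integrable setT (EFin \o (k \o F')) ->
    (@leb R n.+1).-integrable setT (EFin \o (k \o F)) /\
    (\int[@leb R n.+1]_x k (F x) = \int[(leb1 \x @leb R n)%E]_x k (F' x)).
  move=> mk ki.
  have ki' : (leb1 \x @leb R n)%E.-integrable (@consr R n @^-1` setT) ((EFin \o (k \o F)) \o @consr R n).
    by rewrite preimage_setT (_ : _ \o _ = EFin \o (k \o (F \o @consr R n)))// FE.
  have mk' : measurable_fun setT (EFin \o (k \o F)) by exact/measurable_EFinP.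
  split; first exact: (integrable_pushforward (measurable_consr (n := n)) mk' ki').
  rewrite /Rintegral; congr fine.
  have := integral_pushforward (measurable_consr (n := n)) mk' ki' measurableT.
  rewrite preimage_setT => H; apply: (eq_trans H).
  by apply: eq_integral => x _; rewrite -FE.
have [H1 E1] := P _ mF1 Ti1; have [H2 E2] := P _ mF2 Ti2.
split; first by split.
rewrite big_ord_recl -HE -TE.
by apply: eqReIm => /=; [rewrite E1|rewrite E2].
Qed.

Lemma Rintegral_leb_prod n (g : 'I_n -> R -> R) :
  (forall i, leb1.-integrable setT (EFin \o g i)) ->
  (@leb R n).-integrable setT (EFin \o (fun x : 'rV[R]_n => \prod_i g i (x ord0 i))) /\
  \int[@leb R n]_x (\prod_i g i (x ord0 i)) = \prod_i \int[leb1]_t g i t.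
Proof.
move=> gi; have gi' i : cintegrable leb1 (fun t => (g i t)%:C).
  by split; [exact: (gi i)|exact: (@integrable0 _ _ _ leb1 setT)].
have [[H _] E] := cintegral_leb_prod gi'.
have rc m (a : 'I_m -> R) : \prod_i (a i)%:C = (\prod_i a i)%:C :> R[i].
  by rewrite rmorph_prod.
split.
  rewrite (_ : (fun x => _) = Re \o (fun x : 'rV[R]_n => \prod_i (g i (x ord0 i))%:C))//.
  by apply/funext => x; rewrite /= rc.
apply: (@complexI R); rewrite -rc -cintegral_real.
under eq_bigr do rewrite -cintegral_real.
by rewrite -E; congr (cintegral _ _); apply/funext => x; rewrite rc.
Qed.

End leb_prod.

(** * The Fejer kernel and the Gaussian *)

Section fejer.
Variable R : realType.
Local Notation leb1 := (@lebesgue_measure R).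

Definition sinc (t : R) : R := if t == 0 then 1 else sin t / t.

Lemma sincM t : sinc t * t = sin t.
Proof.
rewrite /sinc; case: eqP => [->|/eqP t0]; first by rewrite sin0 mulr0.
by rewrite divfK.
Qed.

Lemma sinc0 : sinc 0 = 1. Proof. by rewrite /sinc eqxx. Qed.

(** Mean value theorem for [sin] between 0 and [x]. In this form it yields both the bound by 1 and
    the continuity of [sinc] at 0. *)
Lemma sinc_cos (x : R) : exists2 c, `|c| <= `|x| & sinc x = cos c.
Proof.
have pos y : 0 < y -> exists2 c, `|c| <= `|y| & sinc y = cos c.
  move=> y0; have [c cy D] := @MVT R sin cos 0 y y0 (fun z _ => is_derive_sin z)
    (continuous_subspaceT (@continuous_sin R)).
  move: cy; rewrite in_itv/= => /andP[c0 cy].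
  exists c; first by rewrite !ger0_norm ?(ltW c0) ?(ltW y0)// ltW.
  by rewrite /sinc gt_eqF// -[sin y]subr0 -(sin0 R) D subr0 mulfK ?gt_eqF.
have [x0|x0|->] := ltgtP x 0.
- have [|c cx E] := pos (- x); first by rewrite oppr_gt0.
  exists c; first by rewrite -(normrN x).
  by rewrite -E /sinc oppr_eq0 sinN invrN mulrNN.
- exact: pos.
- by exists 0 => //; rewrite /sinc eqxx cos0.
Qed.

Lemma continuous_sinc : continuous sinc.
Proof.
move=> x; have [->|x0] := eqVneq x 0.
  rewrite /continuous_at sinc0; apply/cvgrPdist_le => e e0.
  have := @continuous_cos R 0; rewrite /continuous_at cos0.
  move=> /cvgrPdist_le/(_ e e0)/nbhs_ballP[d /= d0 Hd].
  apply/nbhs_ballP; exists d => // y; rewrite /ball/= sub0r normrN => yd.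
  have [c cy ->] := sinc_cos y; apply: Hd.
  by rewrite /ball/= sub0r normrN (le_lt_trans cy).
rewrite /continuous_at {2}/sinc (negbTE x0).
apply: (@cvg_trans _ ((fun y => sin y / y) @ x)).
  apply: near_eq_cvg; near=> y; rewrite /sinc ifF//; apply/negbTE.
  by near: y; exact: (cvgr_neq0 x (@cvg_id _ _) x0).
by apply: (cvgM (@continuous_sin R x) (cvgV x0 (@cvg_id _ _))).
Unshelve. all: by end_near. Qed.

(** The Fejer kernel up to normalization: its Fourier transform is a triangle function supported in
    [-2, 2]. *)
Definition fej (t : R) : R := sinc t ^+ 2.

Lemma fej_ge0 t : 0 <= fej t. Proof. exact: sqr_ge0. Qed.

Lemma fej0 : fej 0 = 1. Proof. by rewrite /fej /sinc eqxx expr1n. Qed.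

Lemma fejM t : fej t * t ^+ 2 = sin t ^+ 2.
Proof. by rewrite /fej -exprMn sincM. Qed.

Lemma fej_le1 t : fej t <= 1.
Proof.
rewrite /fej; have [c _ ->] := sinc_cos t.
by rewrite -(cos2Dsin2 c) lerDl sqr_ge0.
Qed.

Lemma continuous_fej : continuous fej.
Proof. by move=> x; apply: cvgM; exact: continuous_sinc. Qed.

Lemma measurable_fej : measurable_fun setT fej.
Proof. exact: continuous_measurable_fun continuous_fej. Qed.

Lemma integrable_oneDsqrV :
  leb1.-integrable setT (EFin \o (fun t : R => (1 + t ^+ 2)^-1)).
Proof.
have c : continuous (fun t : R => (1 + t ^+ 2)^-1) by exact: continuous_oneDsqrV.
have p t : 0 <= (1 + t ^+ 2)^-1 :> R by rewrite invr_ge0 addr_ge0// sqr_ge0.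
apply/integrableP; split.
  by apply/measurable_EFinP; exact: continuous_measurable_fun c.
under eq_integral do rewrite /= ger0_norm//.
rewrite ge0_symfun_integralT//; last by move=> x /=; rewrite sqrrN.
rewrite (_ : [set x | _] = `[0, +oo[%classic); last first.
  by apply/seteqP; split => x/=; rewrite in_itv/= andbT.
by rewrite (@integral0y_oneDsqr R) -EFinM ltry.
Qed.

Lemma fej_le t : fej t <= 2 * (1 + t ^+ 2)^-1.
Proof.
rewrite ler_pdivlMr ?ltr_pwDl ?sqr_ge0// mulrDr mulr1 fejM.
have := fej_le1 t; have := cos2Dsin2 t; have := sqr_ge0 (cos t); lra.
Qed.

Lemma integrable_fej : leb1.-integrable setT (EFin \o fej).
Proof.
have := integrableZl measurableT 2 integrable_oneDsqrV.
apply: le_integrable => //; first by apply/measurable_EFinP; exact: measurable_fej.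
move=> t _ /=; rewrite lee_fin ger0_norm ?fej_ge0// (le_trans (fej_le t))//.
exact: ler_norm.
Qed.

Definition fejC : R := \int[leb1]_t fej t.

Let sc (a : R) : 0 < a -> forall A, measurable A ->
  leb1 ((fun t => a * t + 0) @^-1` A) = ((a^-1)%:E * leb1 A)%E.
Proof. by move=> a0 A mA; exact: lebesgue_affine. Qed.

Lemma integrable_scale1 (f : R -> R) a : 0 < a ->
  leb1.-integrable setT (EFin \o f) ->
  leb1.-integrable setT (EFin \o (fun t => f (a * t))).
Proof.
move=> a0 fi.
have := @integrable_transport _ _ R leb1 _ (NngNum (ltW (eqbRL (invr_gt0 a) a0)))
  (measurable_aff a 0) (sc a0) f fi.
by under [X in _.-integrable _ (_ \o X)]eq_fun do rewrite /= addr0.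
Qed.

Lemma Rintegral_scale1 (f : R -> R) a : 0 < a ->
  leb1.-integrable setT (EFin \o f) ->
  \int[leb1]_t f (a * t) = a^-1 * \int[leb1]_t f t.
Proof.
move=> a0 fi.
have := @Rintegral_transport _ _ R leb1 _ (NngNum (ltW (eqbRL (invr_gt0 a) a0)))
  (measurable_aff a 0) (sc a0) f fi.
by under [X in Rintegral _ _ X = _]eq_fun do rewrite addr0.
Qed.

Lemma Rintegral_odd (f : R -> R) : leb1.-integrable setT (EFin \o f) ->
  (forall t, f (- t) = - f t) -> \int[leb1]_t f t = 0.
Proof.
move=> fi fN.
have H A : measurable A -> leb1 ((-%R : measurableTypeR R -> measurableTypeR R) @^-1` A) = ((1%:nng : {nonneg R})%:num%:E * leb1 A)%E.
  by move=> mA; rewrite mul1e -[RHS]lebesgue_measureN.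
have := @Rintegral_transport _ _ R leb1 _ 1%:nng (@oppr_measurable R setT) H f fi.
rewrite (_ : (fun t => f (- t)) = (fun t => -1 * f t)); last first.
  by apply/funext => t; rewrite fN mulN1r.
by rewrite RintegralZl//=; lra.
Qed.

(** This is sin^2(a t) / t^2, with the value a^2 at t = 0. Its integral [|a| * fejC] is the source
    of the absolute values in the cosine transform of [fej]. *)
Let q a t : R := a ^+ 2 * fej (a * t).

Let q_sin a t : q a t * t ^+ 2 = sin (a * t) ^+ 2.
Proof. by rewrite /q -fejM exprMn; ring. Qed.

Let q_even a t : q (- a) t = q a t.
Proof.
rewrite /q sqrrN mulNr; congr (_ * _).
by rewrite /fej /sinc oppr_eq0; case: ifP => // _; rewrite sinN invrN mulrNN.
Qed.

Let q0 t : q 0 t = 0.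
Proof. by rewrite /q expr0n mul0r. Qed.

Let integrable_q a : leb1.-integrable setT (EFin \o q a).
Proof.
wlog a0 : a / 0 < a => [H|].
  have [a0|a0|->] := ltgtP a 0.
  - rewrite (_ : q a = q (- a)); first by apply: H; rewrite oppr_gt0.
    by apply/funext => t; rewrite q_even.
  - exact: H.
  - rewrite (_ : q 0 = cst 0); first exact: (@integrable0 _ _ _ leb1 setT).
    by apply/funext => t; rewrite q0.
exact: (integrableZl measurableT (a ^+ 2) (integrable_scale1 a0 integrable_fej)).
Qed.

Let Rintegral_q a : \int[leb1]_t q a t = `|a| * fejC.
Proof.
wlog a0 : a / 0 < a => [H|].
  have [a0|a0|->] := ltgtP a 0.
  - rewrite -normrN -H ?oppr_gt0//.
    by congr (Rintegral _ _ _); apply/funext => t; rewrite q_even.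
  - exact: H.
  - rewrite normr0 mul0r (_ : q 0 = cst 0) ?Rintegral_cst ?mul0r//.
    by apply/funext => t; rewrite q0.
rewrite RintegralZl//; last exact: integrable_scale1 integrable_fej.
rewrite (Rintegral_scale1 a0 integrable_fej) gtr0_norm// mulrA; congr (_ * _).
by field; rewrite gt_eqF.
Qed.

(** The identity sin^2 A cos 2C = (sin^2 (A + C) + sin^2 (A - C)) / 2 - sin^2 C with A = w t and C =
    z t, divided by t^2. It turns the cosine transform of [fej] into absolutely convergent integrals
    of [q]. *)
Lemma fej_cos_q w z t :
  w ^+ 2 * (fej (w * t) * cos (2 * z * t)) = (q (w + z) t + q (w - z) t) / 2 - q z t.
Proof.
have [->|t0] := eqVneq t 0.
  by rewrite /q !mulr0 fej0 cos0; field.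
have t20 : t ^+ 2 != 0 by rewrite sqrf_eq0.
apply: (mulIf t20).
transitivity (sin (w * t) ^+ 2 * cos (2 * z * t)).
  by rewrite -fejM exprMn; ring.
have -> : ((q (w + z) t + q (w - z) t) / 2 - q z t) * t ^+ 2 =
  (q (w + z) t * t ^+ 2 + q (w - z) t * t ^+ 2) / 2 - q z t * t ^+ 2 by field.
rewrite !q_sin.
have -> : 2 * z * t = z * t + z * t by ring.
have -> : (w + z) * t = w * t + z * t by ring.
have -> : (w - z) * t = w * t - z * t by ring.
rewrite cosD !sinD cosN sinN.
have := cos2Dsin2 (w * t); have := cos2Dsin2 (z * t).
set a := sin (w * t); set b := cos (w * t); set c := cos (z * t); set e := sin (z * t).
move=> H1 H2.
have {}H1 : c ^+ 2 = 1 - e ^+ 2 by lra.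
have {}H2 : b ^+ 2 = 1 - a ^+ 2 by lra.
transitivity (a ^+ 2 * c ^+ 2 + b ^+ 2 * e ^+ 2 - e ^+ 2); last by field.
transitivity (a ^+ 2 * (c ^+ 2 - e ^+ 2)); first by ring.
by rewrite H1 H2; ring.
Qed.

(* [fej (w t)] is band-limited to [|xi| <= 2 w]: by [fej_cos_q] its cosine
   transform at [2 z] is a multiple of |w + z| + |w - z| - 2 |z|. *)
Lemma Rintegral_fej_cos w y : 0 < w -> 2 * w <= `|y| ->
  \int[leb1]_t (fej (w * t) * cos (y * t)) = 0.
Proof.
move=> w0 wy; pose z := y / 2.
have yE : y = 2 * z by rewrite /z mulrCA divff ?mulr1.
have wz : w <= `|z|.
  by rewrite /z normrM [`|2^-1|]gtr0_norm ?invr_gt0// ler_pdivlMr// mulrC.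
have fi : leb1.-integrable setT (EFin \o (fun t => fej (w * t) * cos (y * t))).
  apply: (le_integrable _ _ _ (integrable_scale1 w0 integrable_fej)) => //.
    apply/measurable_EFinP; apply: measurable_funM.
      by apply: (measurableT_comp measurable_fej); exact: measurable_funM.
    apply: (measurableT_comp (continuous_measurable_fun (@continuous_cos R))).
    exact: measurable_funM.
  move=> t _ /=; rewrite lee_fin normrM ler_piMr//.
  by rewrite ler_norml cos_geN1 cos_le1.
apply: (mulfI (x := w ^+ 2)); first by rewrite sqrf_eq0 gt_eqF.
rewrite mulr0 -RintegralZl//.
have qD : leb1.-integrable setT (EFin \o (fun t => q (w + z) t + q (w - z) t)).
  exact: (integrableD measurableT (integrable_q (w + z)) (integrable_q (w - z))).
transitivity (\int[leb1]_t ((q (w + z) t + q (w - z) t) / 2 - q z t)).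
  by apply: eq_Rintegral => t _; rewrite yE fej_cos_q.
rewrite RintegralB//; last exact: (integrableZr measurableT 2^-1 qD).
rewrite RintegralZr// RintegralD// !Rintegral_q.
have [z0|z0] := leP 0 z; move: wz.
  rewrite (ger0_norm z0) => wz.
  have -> : `|w + z| = w + z by rewrite ger0_norm//; lra.
  have -> : `|w - z| = z - w by rewrite ler0_norm ?opprB//; lra.
  by field.
rewrite (ltr0_norm z0) => wz.
have -> : `|w - z| = w - z by rewrite ger0_norm//; lra.
have -> : `|w + z| = - (w + z) by rewrite ler0_norm//; lra.
by field.
Qed.

Lemma cintegrable_fej_Cis w y : 0 < w ->
  cintegrable leb1 (fun t => (fej (w * t))%:C * Cis (y * t)).
Proof.
move=> w0; apply: (cintegrable_le _ (integrable_scale1 w0 integrable_fej)).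
  apply: cmeasurableM.
    apply: cmeasurable_real; apply: (measurableT_comp measurable_fej).
    exact: measurable_funM.
  by apply: cmeasurable_Cis; exact: measurable_funM.
by move=> t; rewrite ComplexField.Normc.normcM normc_Cis mulr1 normc_real ger0_norm ?fej_ge0.
Qed.

Lemma cintegral_fej_Cis w y : 0 < w -> 2 * w <= `|y| ->
  cintegral leb1 (fun t => (fej (w * t))%:C * Cis (y * t)) = 0.
Proof.
move=> w0 wy; have [i1 i2] := cintegrable_fej_Cis y w0.
apply: eqReIm => /=.
  rewrite -[RHS](Rintegral_fej_cos w0 wy); apply: eq_Rintegral => t _.
  by rewrite mul0r subr0.
apply: Rintegral_odd; first exact: i2.
move=> t; rewrite !mul0r !addr0 !mulrN sinN mulrN; congr (- (_ * _)).
by rewrite /fej /sinc oppr_eq0; case: ifP => // _; rewrite sinN invrN mulrNN.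
Qed.

End fejer.

Section gauss_transform.
Variable R : realType.
Local Notation leb1 := (@lebesgue_measure R).
Implicit Types (t x a u : R).

Lemma pow_le_exp N a : 0 < a -> exists2 C, 0 < C &
  forall u, 0 <= u -> (1 + u) ^+ N * expR (- (a * u ^+ 2)) <= C.
Proof.
move=> a0; case: N => [|N].
  exists 1 => // u u0; rewrite mul1r -expR0 ler_expR oppr_le0.
  by rewrite mulr_ge0 ?sqr_ge0 ?ltW.
(* With m the exponent, e^(a (1 + u^2)) is the m-th power of e^(a (1 + u^2) / m), which exceeds a (1
   + u^2) / m. The constant [K] turns the latter into 2 (1 + u^2), a bound for 1 + u. *)
pose K := 2 * N.+1%:R / a.
have K0 : 0 < K by rewrite divr_gt0// mulr_gt0.
exists (K ^+ N.+1 * expR a); first by rewrite mulr_gt0 ?expR_gt0 ?exprn_gt0.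
move=> u u0; rewrite expRN ler_pdivrMr ?expR_gt0// -mulrA -expRD.
have -> : a + a * u ^+ 2 = N.+1%:R * (a * (1 + u ^+ 2) / N.+1%:R) by field.
rewrite expRM_natl -exprMn lerXn2r ?nnegrE ?addr_ge0//.
  by rewrite mulr_ge0 ?expR_ge0 ?ltW.
apply: (@le_trans _ _ (K * (a * (1 + u ^+ 2) / N.+1%:R))).
  have -> : K * (a * (1 + u ^+ 2) / N.+1%:R) = 2 * (1 + u ^+ 2).
    have m0 : N.+1%:R != 0 :> R by rewrite pnatr_eq0.
    by rewrite /K; move: (N.+1%:R) m0 => m m0; field; rewrite m0 gt_eqF.
  nra.
rewrite (ler_wpM2l (ltW K0))//.
by apply: le_trans (expR_ge1Dx _); rewrite lerDr.
Qed.

(** Two spare powers of 1 + |t| in [pow_le_exp] pay for the majorant (1 + t^2)^-1. *)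
Lemma integrable_pow_gauss N a : 0 < a ->
  leb1.-integrable setT
    (EFin \o (fun t : R => (1 + `|t|) ^+ N * expR (- (a * t ^+ 2)))).
Proof.
move=> a0; have [C C0 HC] := pow_le_exp N.+2 a0.
have := integrableZl measurableT C (@integrable_oneDsqrV R).
apply: le_integrable => //.
  apply/measurable_EFinP; apply: measurable_funM.
    by apply: measurable_funX; apply: measurable_funD.
  apply: (measurableT_comp (@measurable_expR R)); apply: measurable_funN.
  by apply: measurable_funM => //; exact: measurable_funX.
move=> t _ /=; rewrite lee_fin ger0_norm; last first.
  by rewrite mulr_ge0 ?expR_ge0// exprn_ge0// addr_ge0.
apply: le_trans (ler_norm _); rewrite ler_pdivlMr ?ltr_pwDl ?sqr_ge0//.
apply: le_trans (HC `|t| (normr_ge0 _)); rewrite real_normK ?num_real//.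
rewrite mulrAC ler_wpM2r ?expR_ge0//.
have -> : (1 + `|t|) ^+ N.+2 = (1 + `|t|) ^+ N * (1 + `|t|) ^+ 2 by rewrite -exprD addn2.
rewrite ler_wpM2l ?exprn_ge0 ?addr_ge0//.
rewrite sqrrD expr1n mul1r real_normK ?num_real//.
by have := normr_ge0 t; lra.
Qed.

(** Fundamental theorem of calculus on [-n, n], with dominated convergence on one side and vanishing
    boundary values on the other. *)
Lemma Rintegral_derive0 (F f : R -> R) :
  (forall x, is_derive x 1 F (f x)) -> continuous f ->
  leb1.-integrable setT (EFin \o f) ->
  F n%:R @[n --> \oo] --> (0 : R) -> F (- n%:R) @[n --> \oo] --> (0 : R) ->
  \int[leb1]_x f x = 0.
Proof.
move=> dF cf fi F1 F2.
have mf : measurable_fun setT f by exact: continuous_measurable_fun cf.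
pose I n : set R := `[- n%:R, n%:R]%classic.
have H := @dominated_convergence _ _ R leb1 setT measurableT
  (fun n => EFin \o (f \_ (I n))) (EFin \o f) (EFin \o (fun x => `|f x|)).
have [] := H.
- move=> n; apply/measurable_EFinP; apply/measurable_restrict => //.
    exact: measurable_itv.
  exact: measurable_funTS.
- exact/measurable_EFinP.
- apply: aeW => x _; apply: cvg_near_cst.
  near=> n; rewrite /= patchE mem_set// /I/= in_itv/=.
  rewrite -ler_norml; near: n; exact: nbhs_infty_ger.
- exact: integrable_norm.
- apply: aeW => x n _ /=; rewrite lee_fin patchE; case: ifP => // _.
  by rewrite normr0.
move=> _ _ Hc.
(* At n = 0 the interval is a point, whereas [continuous_FTC2] asks for a proper one; hence the
   shift by one. *)
have E n : (\int[leb1]_x (EFin \o (f \_ (I n.+1))) x)%E = (F n.+1%:R - F (- n.+1%:R))%:E.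
  rewrite -restrict_EFin -integral_mkcond EFinB.
  apply: continuous_FTC2 => //.
  - by rewrite -subr_gt0 opprK addr_gt0.
  - by apply: continuous_subspaceT => x; exact: cf.
  - have cF : continuous F.
      by move=> x; apply/differentiable_continuous/derivable1_diffP; exact: ex_derive.
    split.
    + by move=> x _; exact: ex_derive.
    + by apply: cvg_at_right_filter; exact: cF.
    + by apply: cvg_at_left_filter; exact: cF.
  - by move=> x _; rewrite derive1E; exact: derive_val.
have L : (F n%:R - F (- n%:R))%:E @[n --> \oo] --> (0 : R)%:E.
  apply: cvg_EFin; first exact: nearW.
  rewrite (_ : fine \o _ = (fun n : nat => F n%:R - F (- n%:R)))//.
  by rewrite -(subrr (0 : R)); exact: cvgB.
move: Hc; rewrite -cvg_shiftS => Hc; move: L; rewrite -cvg_shiftS => L.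
have : (\int[leb1]_x (EFin \o f) x)%E = (0 : R)%:E.
  have {}Hc : (F n.+1%:R - F (- n.+1%:R))%:E @[n --> \oo] --> (\int[leb1]_x (EFin \o f) x)%E.
    rewrite (_ : (fun n => _) = (fun n => (\int[leb1]_x (EFin \o (f \_ (I n.+1))) x)%E)) //.
    by apply/funext => n; rewrite E.
  have {}L : (F n.+1%:R - F (- n.+1%:R))%:E @[n --> \oo] --> (0 : R)%:E by exact: L.
  rewrite -(cvg_lim (@ereal_hausdorff R) Hc) -(cvg_lim (@ereal_hausdorff R) L).
  by [].
by rewrite /Rintegral /comp => ->.
Unshelve. all: by end_near. Qed.

End gauss_transform.

Section gauss_characteristic.
Variable R : realType.
Local Notation leb1 := (@lebesgue_measure R).
Implicit Types (t x a u : R).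
Local Notation G := (@gauss_fun R).

Lemma gaussE x : G x = expR (- (1 * x ^+ 2)).
Proof. by rewrite /gauss_fun mul1r. Qed.

Lemma is_derive_gauss x : is_derive x 1 G (- (2 * x) * G x).
Proof.
rewrite /gauss_fun; apply: is_derive_eq.
rewrite /GRing.scale/=; ring.
Qed.

Lemma measurable_mul_cos (f g : R -> R) t : measurable_fun setT f -> continuous g ->
  measurable_fun setT (fun x => f x * g (t * x)).
Proof.
move=> mf cg; apply: measurable_funM => //.
apply: (measurableT_comp (continuous_measurable_fun cg)).
exact: measurable_funM.
Qed.

Lemma integrable_mul_bounded (f g : R -> R) t :
  leb1.-integrable setT (EFin \o f) -> continuous g -> (forall x, `|g x| <= 1) ->
  leb1.-integrable setT (EFin \o (fun x => f x * g (t * x))).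
Proof.
move=> fi cg g1; apply: (le_integrable _ _ _ fi) => //.
  apply/measurable_EFinP; apply: measurable_mul_cos => //.
  by have /integrableP[/measurable_EFinP] := fi.
by move=> x _ /=; rewrite lee_fin normrM ler_piMr.
Qed.

Lemma integrable_gauss1 :
  leb1.-integrable setT (EFin \o (fun x : R => (1 + `|x|) * G x)).
Proof.
have := @integrable_pow_gauss R 1 1 ltr01.
by under [X in _.-integrable _ (_ \o X) -> _]eq_fun do rewrite -gaussE.
Qed.

Lemma integrable_xgauss : leb1.-integrable setT (EFin \o (fun x : R => x * G x)).
Proof.
apply: (le_integrable _ _ _ integrable_gauss1) => //.
  by apply/measurable_EFinP; apply: measurable_funM => //; exact: measurable_gauss_fun.
move=> x _ /=; rewrite lee_fin !normrM ler_wpM2r//.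
by rewrite (ger0_norm (_ : 0 <= 1 + `|x|)) ?addr_ge0// lerDr.
Qed.

(** The sine part of the transform vanishes by parity, so this is the whole Fourier transform of the
    Gaussian. *)
Definition ghat t : R := \int[leb1]_x (G x * cos (t * x)).

Lemma gauss_squeeze (F : nat -> R) : (forall n, `|F n| <= G n%:R) ->
  F n @[n --> \oo] --> (0 : R).
Proof.
move=> FG.
have cG : (G \o (fun n : nat => n%:R)) n @[n --> \oo] --> (0 : R).
  exact: (cvg_comp _ _ (@cvgr_idn R) (@cvg_gauss_fun R)).
have cNG : (- (G \o (fun n : nat => n%:R)) n) @[n --> \oo] --> (0 : R).
  by rewrite -(oppr0 R); exact: cvgN.
apply: (squeeze_cvgr _ cNG cG).
by apply: nearW => n; rewrite -ler_norml; exact: FG.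
Qed.

(** Integration by parts, in the form that the derivative of [G x * sin (t * x)] has integral 0. *)
Lemma ghat_parts t :
  \int[leb1]_x (x * G x * sin (t * x)) = t / 2 * ghat t.
Proof.
have i1 : leb1.-integrable setT (EFin \o (fun x => x * G x * sin (t * x))).
  exact: (integrable_mul_bounded _ integrable_xgauss (@continuous_sin R) (@sin_max R)).
have i2 : leb1.-integrable setT (EFin \o (fun x => G x * cos (t * x))).
  exact: (integrable_mul_bounded _ (@integrableT_gauss R) (@continuous_cos R) (@cos_max R)).
have : \int[leb1]_x (t * (G x * cos (t * x)) - 2 * (x * G x * sin (t * x))) = 0.
  apply: (@Rintegral_derive0 R (fun x => G x * sin (t * x))).
  - move=> x.
    have D1 : is_derive x 1 (fun x : R => t * x) t.
      apply: is_derive_eq; rewrite /GRing.scale/=; ring.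
    have D2 : is_derive x 1 (sin \o (fun x : R => t * x)) (t * cos (t * x)).
      by apply: (is_derive_eq (is_derive1_comp (is_derive_sin (t * x)) D1)); rewrite mulrC.
    have D3 := is_derive_gauss x.
    apply: (is_derive_eq (is_deriveM D3 D2)).
    rewrite /GRing.scale/=; ring.
  - move=> x; apply: cvgB; apply: cvgM; try exact: cvg_cst.
      apply: cvgM; first exact: continuous_gauss_fun.
      apply: continuous_comp; last exact: continuous_cos.
      by apply: cvgM; [exact: cvg_cst|exact: cvg_id].
    apply: cvgM; first by apply: cvgM; [exact: cvg_id|exact: continuous_gauss_fun].
    apply: continuous_comp; last exact: continuous_sin.
    by apply: cvgM; [exact: cvg_cst|exact: cvg_id].
  - have := integrableB measurableT (integrableZl measurableT t i2) (integrableZl measurableT 2 i1).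
    exact.
  - apply: gauss_squeeze => n.
    by rewrite normrM ger0_norm ?gauss_fun_ge0// ler_piMr ?gauss_fun_ge0 ?sin_max.
  - apply: gauss_squeeze => n.
    rewrite normrM ger0_norm ?gauss_fun_ge0// {1}/gauss_fun sqrrN -/(gauss_fun _).
    by rewrite ler_piMr ?gauss_fun_ge0 ?sin_max.
rewrite RintegralB//; [|exact: (integrableZl measurableT t i2)|exact: (integrableZl measurableT 2 i1)].
rewrite !RintegralZl// -/(ghat t) => H.
by lra.
Qed.

(** Differentiation under the integral sign, dominated by [(1 + |x|) * G x], produces minus the
    integral of [x * G x * sin (t * x)]; [ghat_parts] closes this into a linear differential
    equation. *)
Lemma is_derive_ghat t : is_derive t 1 ghat (- (t / 2) * ghat t).
Proof.
pose f (s x : R) := G x * cos (s * x).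
have df (s x : R) : is_derive s 1 (f^~ x) (- (x * G x * sin (s * x))).
  have D1 : is_derive s 1 (fun s : R => s * x) x.
    apply: is_derive_eq; rewrite /GRing.scale/=; ring.
  have D2 : is_derive s 1 (cos \o (fun s : R => s * x)) (x * - sin (s * x)).
    by apply: (is_derive_eq (@is_derive1_comp _ cos (fun s : R => s * x) s _ _ (is_derive_cos (s * x)) D1)); rewrite mulrC.
  apply: (is_derive_eq (is_deriveZ (G x) D2)).
  rewrite /GRing.scale/=; ring.
have tI : `](t - 1), (t + 1)[%classic t by rewrite /= in_itv/=; lra.
have fi (s : R) : `](t - 1), (t + 1)[%classic s -> leb1.-integrable setT (EFin \o f s).
  by move=> _; exact: (integrable_mul_bounded _ (@integrableT_gauss R) (@continuous_cos R) (@cos_max R)).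
have fd (s x : R) : `](t - 1), (t + 1)[%classic s -> setT x -> derivable (f^~ x) s 1.
  by move=> _ _; exact: (@ex_derive _ _ _ _ _ _ _ (df s x)).
have G0 (x : R) : 0 <= (1 + `|x|) * G x by rewrite mulr_ge0 ?addr_ge0 ?gauss_fun_ge0.
have fb (s x : R) : `](t - 1), (t + 1)[%classic s -> setT x -> `|partial1of2 f s x| <= (1 + `|x|) * G x.
  move=> _ _; rewrite /partial1of2 derive1E (@derive_val _ _ _ _ _ _ _ (df s x)).
  rewrite normrN !normrM (ger0_norm (gauss_fun_ge0 x)).
  apply: (@le_trans _ _ (`|x| * G x)); first by rewrite ler_piMr ?sin_max// mulr_ge0 ?gauss_fun_ge0.
  by rewrite ler_wpM2r ?gauss_fun_ge0// lerDr.
apply: DeriveDef.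
  exact: (derivable_under_integral measurableT tI fi fd G0 integrable_gauss1 fb).
rewrite -derive1E (differentiation_under_integral measurableT tI fi fd G0 integrable_gauss1 fb).
rewrite mulNr -ghat_parts.
have i1 : leb1.-integrable setT (EFin \o (fun x => x * G x * sin (t * x))).
  exact: (integrable_mul_bounded _ integrable_xgauss (@continuous_sin R) (@sin_max R)).
rewrite -mulN1r -RintegralZl//; apply: eq_Rintegral => x _.
by rewrite /partial1of2 derive1E (@derive_val _ _ _ _ _ _ _ (df t x)) mulN1r.
Qed.

Lemma ghatE t : ghat t = ghat 0 * expR (- (t ^+ 2 / 4)).
Proof.
(* The integrating factor of the equation in [is_derive_ghat]. *)
pose h (s : R) := ghat s * expR (s ^+ 2 / 4).
have dh (s : R) : is_derive s 1 h 0.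
  have D0 := is_derive_ghat s.
  have D1 : is_derive s 1 (fun s : R => s ^+ 2 / 4) (s / 2).
    by apply: is_derive_eq; rewrite /GRing.scale/=; field.
  have D2 : is_derive s 1 (expR \o (fun s : R => s ^+ 2 / 4)) (s / 2 * expR (s ^+ 2 / 4)).
    by apply: (is_derive_eq (@is_derive1_comp _ expR (fun s : R => s ^+ 2 / 4) s _ _ (is_derive_expR (s ^+ 2 / 4)) D1)); rewrite mulrC.
  apply: (is_derive_eq (is_deriveM D0 D2)).
  rewrite /GRing.scale/=; ring.
have := is_derive_0_is_cst t 0 dh.
rewrite /h expr0n/= mul0r expR0 mulr1 => <-.
by rewrite expRN mulfK// gt_eqF ?expR_gt0.
Qed.

Lemma ghat0_gt0 : 0 < ghat 0.
Proof.
rewrite /ghat (_ : (fun x => _) = G); last first.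
  by apply/funext => x; rewrite mul0r cos0 mulr1.
by rewrite /Rintegral integralT_gauss/= sqrtr_gt0 pi_gt0.
Qed.

End gauss_characteristic.

Lemma measurable_fun_count {d1 d2} {T1 : measurableType d1}
    {T2 : measurableType d2} (C : countType) (g : T1 -> C) (f : C -> T2) :
  (forall c, measurable (g @^-1` [set c])) -> measurable_fun setT (f \o g).
Proof.
move=> mg _ Y mY; rewrite setTI.
have -> : (f \o g) @^-1` Y = \bigcup_(c : C) (if f c \in Y then g @^-1` [set c] else set0).
  apply/seteqP; split => x /=; first by move=> Yx; exists (g x) => //; rewrite mem_set.
  by move=> [c _]; case: ifPn => // cY ->; exact: set_mem.
apply: countable_bigcupT_measurable => [|c]; last by case: ifP.
exact: countableP.
Qed.

(** * Schwartz functions and uniqueness of Littlewood-Paley pieces *)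

Section rV_topology.
Variables (R : realType) (d : nat).
Implicit Types (x y : 'rV[R]_d).

(** The sigma-algebra on row vectors is generated by the coordinates, while continuity refers to the
    norm topology. Rounding the coordinates down to a grid of mesh 1/(n+1) makes [h] a function of a
    countably valued measurable map, and these functions converge pointwise to [h]. *)
Lemma measurable_continuous_rV (h : 'rV[R]_d -> R) :
  continuous h -> measurable_fun setT h.
Proof.
move=> ch.
pose g n x : 'rV[int]_d := \row_i Num.floor (x ord0 i * n.+1%:R).
pose e n (z : 'rV[int]_d) : 'rV[R]_d := \row_i ((z ord0 i)%:~R / n.+1%:R).
apply: (@measurable_fun_cvg _ _ _ _ (fun n => (h \o e n) \o g n)) => [n|x _].
  apply: measurable_fun_count => z.
  have -> : g n @^-1` [set z] = \bigcap_(i in [set: 'I_d])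
      ((fun x => x ord0 i * n.+1%:R) @^-1` `[(z ord0 i)%:~R, (z ord0 i + 1)%:~R[%classic).
    apply/seteqP; split => x /=.
      move=> <- i _ /=; rewrite in_itv/= mxE.
      exact: floor_itv.
    move=> H; apply/rowP => i; rewrite mxE; have /= := H i I.
    by rewrite in_itv/= => xi; exact: floor_def.
  apply: fin_bigcap_measurable => // i _; rewrite -[_ @^-1` _]setTI.
  have : measurable_fun setT (fun x : 'rV[R]_d => x ord0 i * n.+1%:R).
    by apply: measurable_funM => //; exact: measurable_coord.
  by apply => //; exact: measurable_itv.
suff c : (fun n => e n (g n x)) @ \oo --> x by exact: (cvg_comp _ _ c (ch x)).
apply/cvg_ballP => r r0; near=> n; split=> // i j; rewrite /ball/= !mxE ord1.
have n0 : 0 < n.+1%:R :> R by [].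
have := floor_itv (x ord0 j * n.+1%:R); set F := Num.floor _; rewrite intrD => /andP[F1 F2].
have -> : x ord0 j - F%:~R / n.+1%:R = (x ord0 j * n.+1%:R - F%:~R) / n.+1%:R.
  by rewrite mulrBl mulfK ?gt_eqF.
rewrite ger0_norm ?divr_ge0 ?subr_ge0// ltr_pdivrMr//.
apply: (@lt_trans _ _ 1); first by rewrite ltrBlDl.
rewrite -ltr_pdivrMl// mulr1 -natr1.
have : r^-1 <= n%:R by near: n; exact: nbhs_infty_ger.
by move=> /le_lt_trans; apply; rewrite ltrDl.
Unshelve. all: by end_near. Qed.

Lemma enorm_ge0 x : 0 <= enorm x.
Proof. exact: sqrtr_ge0. Qed.

Lemma dotv_ge0 x : 0 <= dotv x x.
Proof. by apply: sumr_ge0 => i _; rewrite -expr2 sqr_ge0. Qed.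

Lemma enorm_sqr x : enorm x ^+ 2 = \sum_i x ord0 i ^+ 2.
Proof.
by rewrite sqr_sqrtr ?dotv_ge0.
Qed.

Lemma coord_le_enorm x i : `|x ord0 i| <= enorm x.
Proof.
rewrite -ler_sqr ?nnegrE ?enorm_ge0// real_normK ?num_real// enorm_sqr.
by rewrite (bigD1 i)//= lerDl sumr_ge0// => j _; exact: sqr_ge0.
Qed.

Lemma le_1Dprod n (a : 'I_n -> R) : (forall i, 0 <= a i) ->
  1 + \sum_i a i <= \prod_i (1 + a i).
Proof.
elim: n a => [|n IH] a a0; first by rewrite !big_ord0 addr0.
rewrite !big_ord_recl/= addrA; apply: (@le_trans _ _ ((1 + a ord0) * (1 + \sum_(i < n) a (lift ord0 i)))).
  rewrite mulrDr mulr1 lerD2l ler_peMl ?sumr_ge0 ?lerDl//.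
by rewrite ler_wpM2l ?addr_ge0//; exact: IH.
Qed.

Lemma enorm_le_sum x : enorm x <= \sum_i `|x ord0 i|.
Proof.
have S0 : 0 <= \sum_i `|x ord0 i| by exact: sumr_ge0.
rewrite -ler_sqr ?nnegrE ?enorm_ge0// enorm_sqr expr2 mulr_suml.
apply: ler_sum => i _; rewrite -(@real_normK _ (x ord0 i)) ?num_real// expr2 ler_wpM2l//.
by rewrite (bigD1 i)//= lerDl sumr_ge0.
Qed.

(** With [prod_le_enorm], this trades Euclidean weights for products over the coordinates, whose
    integrals factor. *)
Lemma enorm_le_prod x : 1 + enorm x <= \prod_i (1 + `|x ord0 i|).
Proof. by apply: le_trans (le_1Dprod _) => //; rewrite lerD2l enorm_le_sum. Qed.

Lemma prod_le_enorm x : \prod_i (1 + x ord0 i ^+ 2) <= (1 + enorm x) ^+ (d.*2).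
Proof.
have -> : (1 + enorm x) ^+ d.*2 = \prod_(i < d) (1 + enorm x) ^+ 2.
  by rewrite prodr_const card_ord -exprM mul2n.
apply: ler_prod => i _; rewrite addr_ge0 ?sqr_ge0//= sqrrD expr1n mul1r.
rewrite -addrA lerD2l -(@real_normK _ (x ord0 i)) ?num_real//.
have := coord_le_enorm x i; have := normr_ge0 (x ord0 i); nra.
Qed.

Lemma ccontinuous_measurable (h : 'rV[R]_d -> R[i]) : ccontinuous h -> cmeasurable h.
Proof. by move=> [h1 h2]; split; exact: measurable_continuous_rV. Qed.

(** An integrable majorant, up to a seminorm, of every Schwartz function; the product form reduces
    its integrability to dimension one. *)
Definition oneV (x : 'rV[R]_d) : R := \prod_i (1 + x ord0 i ^+ 2)^-1.

Lemma integrable_oneV : (@leb R d).-integrable setT (EFin \o oneV).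
Proof.
exact: (Rintegral_leb_prod (fun i : 'I_d => @integrable_oneDsqrV R)).1.
Qed.

Lemma seminorm_ge0 N (h : 'rV[R]_d -> R[i]) : (0 <= schwartz_seminorm N h)%E.
Proof.
apply: le_ereal_sup_tmp; exists ((1 + enorm (0 : 'rV[R]_d)) ^+ N * normc (h 0))%:E.
  by exists [::], (0 : 'rV[R]_d).
by rewrite lee_fin mulr_ge0 ?normc_ge0// exprn_ge0// addr_ge0 ?enorm_ge0.
Qed.

Lemma schwartz_le (h : 'rV[R]_d -> R[i]) x :
  ((normc (h x))%:E <= (oneV x)%:E * schwartz_seminorm d.*2 h)%E.
Proof.
have p0 : 0 < \prod_i (1 + x ord0 i ^+ 2).
  by apply: prodr_gt0 => i _; rewrite ltr_pwDl ?sqr_ge0.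
have H : (((1 + enorm x) ^+ d.*2 * normc (h x))%:E <= schwartz_seminorm d.*2 h)%E.
  by apply: ereal_sup_ubound; exists [::], x.
rewrite /oneV prodfV muleC lee_pdivlMr//.
apply: le_trans H; rewrite -EFinM lee_fin mulrC ler_wpM2r ?normc_ge0//.
exact: prod_le_enorm.
Qed.

Lemma schwartz_integrable (h : 'rV[R]_d -> R[i]) : schwartz h ->
  cintegrable (@leb R d) h /\
  ((\int[@leb R d]_x normc (h x))%R%:E <=
    (\int[@leb R d]_x oneV x)%R%:E * schwartz_seminorm d.*2 h)%E.
Proof.
move=> [sh fh].
have mh : cmeasurable h by apply: ccontinuous_measurable; have [] := sh [::].
have Sf : schwartz_seminorm d.*2 h \is a fin_num by rewrite ge0_fin_numE ?seminorm_ge0.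
have hb x : normc (h x) <= oneV x * fine (schwartz_seminorm d.*2 h).
  by rewrite -lee_fin EFinM fineK//; exact: schwartz_le.
have bi : (@leb R d).-integrable setT (EFin \o (fun x => oneV x * fine (schwartz_seminorm d.*2 h))).
  exact: (integrableZr measurableT (fine (schwartz_seminorm d.*2 h)) integrable_oneV).
have hi : cintegrable (@leb R d) h by apply: (cintegrable_le mh bi).
split => //; rewrite -(fineK Sf) -EFinM lee_fin -RintegralZr//; last exact: integrable_oneV.
by apply: le_Rintegral => //; exact: cintegrable_normc.
Qed.

End rV_topology.

(** * Modulated Gaussians as test functions *)

Section wave_packets.
Variables (R : realType) (d : nat).
Implicit Types (x y v : 'rV[R]_d) (f g : 'rV[R]_d -> R).

(** Both difference quotients are the same function of [h]; one-variable rules thus carry over to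
    directional derivatives. *)
Lemma is_derive_line x v f df :
  is_derive (0 : R) 1 (fun t : R => f (t *: v + x)) df -> is_derive x v f df.
Proof.
have E : (fun h : R => h^-1 *: (((fun t : R => f (t *: v + x)) \o shift 0) (h *: 1) -
      f (0 *: v + x))) = (fun h : R => h^-1 *: ((f \o shift x) (h *: v) - f x)).
  apply/funext => h /=; rewrite addr0 scale0r add0r.
  by rewrite /GRing.scale/= mulr1.
move=> [dH dE]; split; first by move: dH; rewrite /derivable E.
by rewrite -dE /derive E.
Qed.

Lemma is_derive_line_comp x v f df (g : R -> R) dg :
  is_derive x v f df -> is_derive (f x) 1 g dg -> is_derive x v (g \o f) (dg * df).
Proof.
have E : (fun h : R => h^-1 *: (((fun t : R => f (t *: v + x)) \o shift 0) (h *: 1) -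
      f (0 *: v + x))) = (fun h : R => h^-1 *: ((f \o shift x) (h *: v) - f x)).
  apply/funext => h /=; rewrite addr0 scale0r add0r.
  by rewrite /GRing.scale/= mulr1.
move=> [fH fE] gD; apply: is_derive_line.
have D : is_derive (0 : R) 1 (fun t : R => f (t *: v + x)) df.
  by split; [rewrite /derivable E|rewrite -fE /derive E].
apply: (@is_derive1_comp _ g (fun t : R => f (t *: v + x)) 0 _ _ _ D).
by rewrite scale0r add0r.
Qed.

Lemma is_derive_linear x v f : (forall t, f (t *: v + x) = t * f v + f x) ->
  is_derive x v f (f v).
Proof.
move=> fl; apply: is_derive_line.
rewrite (_ : (fun t : R => _) = (fun t : R => t * f v + f x)); last exact/funext.
by apply: is_derive_eq; rewrite /GRing.scale/= addr0; ring.
Qed.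

Lemma dotvDl x y v : dotv (x + y) v = dotv x v + dotv y v.
Proof. by rewrite /dotv -big_split; apply: eq_bigr => i _; rewrite mxE mulrDl. Qed.

Lemma dotvZl t x v : dotv (t *: x) v = t * dotv x v.
Proof. by rewrite /dotv mulr_sumr; apply: eq_bigr => i _; rewrite mxE mulrA. Qed.

Lemma dotvC x y : dotv x y = dotv y x.
Proof. by apply: eq_bigr => i _; rewrite mulrC. Qed.

Lemma dotv_delta i v : dotv (delta_mx ord0 i) v = v ord0 i.
Proof.
rewrite /dotv (bigD1 i)//= big1 ?addr0 => [|j ji]; rewrite !mxE eqxx/=.
  by rewrite eqxx mul1r.
by rewrite (negbTE ji) mul0r.
Qed.

Lemma continuous_coord i : continuous (fun x : 'rV[R]_d => x ord0 i).
Proof. exact: coord_continuous. Qed.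

Lemma continuous_sum_fin n (F : 'I_n -> 'rV[R]_d -> R) :
  (forall i, continuous (F i)) -> continuous (fun x => \sum_i F i x).
Proof.
elim: n F => [|n IH] F cF x.
  rewrite (_ : (fun x => _) = cst 0); first exact: cst_continuous.
  by apply/funext => z; rewrite big_ord0.
rewrite (_ : (fun x => _) = (fun x => F ord0 x + \sum_(i < n) F (lift ord0 i) x)).
  exact: (cvgD (cF ord0 x) (IH _ (fun i => cF (lift ord0 i)) x)).
by apply/funext => z; rewrite big_ord_recl.
Qed.

Lemma continuous_dotvl v : continuous (fun x => dotv x v).
Proof.
apply: continuous_sum_fin => i x.
exact: (cvgM (@continuous_coord i x) (cvg_cst (v ord0 i))).
Qed.

Lemma continuous_dotv2 : continuous (fun x => dotv x x).
Proof.
apply: continuous_sum_fin => i x.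
exact: (cvgM (@continuous_coord i x) (@continuous_coord i x)).
Qed.

(* The factors multiplying the Gaussian in the partial derivatives of a modulated
   Gaussian; they have polynomial growth by construction. *)
Inductive tame : ('rV[R]_d -> R) -> Prop :=
| tame_cst c : tame (fun=> c)
| tame_coord i : tame (fun x => x ord0 i)
| tame_cos y : tame (fun x => cos (dotv x y))
| tame_sin y : tame (fun x => sin (dotv x y))
| tame_add f g : tame f -> tame g -> tame (fun x => f x + g x)
| tame_mul f g : tame f -> tame g -> tame (fun x => f x * g x).

Lemma tame_continuous f : tame f -> continuous f.
Proof.
elim=> [c|i|y|y|{}f g _ cf _ cg|{}f g _ cf _ cg] x.
- exact: cst_continuous.
- exact: continuous_coord.
- by apply: (continuous_comp (@continuous_dotvl y x)); exact: continuous_cos.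
- by apply: (continuous_comp (@continuous_dotvl y x)); exact: continuous_sin.
- exact: (cvgD (cf x) (cg x)).
- exact: (cvgM (cf x) (cg x)).
Qed.

Lemma is_derive_dotvl x y i :
  is_derive x (delta_mx ord0 i) (fun x => dotv x y) (y ord0 i).
Proof.
rewrite -[X in is_derive _ _ _ X](dotv_delta i y).
apply: (is_derive_linear (f := fun x => dotv x y)) => t.
by rewrite dotvDl dotvZl.
Qed.

Lemma is_derive_coord x i j :
  is_derive x (delta_mx ord0 i) (fun x => x ord0 j) ((i == j)%:R).
Proof.
have -> : (i == j)%:R = (delta_mx ord0 i : 'rV[R]_d) ord0 j.
  by rewrite mxE eqxx eq_sym.
by apply: (is_derive_linear (f := fun x : 'rV[R]_d => x ord0 j)) => t; rewrite !mxE.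
Qed.

Lemma tame_derive f i : tame f -> exists2 f', tame f' &
  forall x, is_derive x (delta_mx ord0 i) f (f' x).
Proof.
elim=> [c|j|y|y|{}f g tf [f' tf' df] tg [g' tg' dg]|{}f g tf [f' tf' df] tg [g' tg' dg]].
- by exists (fun=> 0); [exact: tame_cst|move=> x; exact: is_derive_cst].
- by exists (fun=> (i == j)%:R); [exact: tame_cst|move=> x; exact: is_derive_coord].
- exists (fun x => (- y ord0 i) * sin (dotv x y)).
    by apply: tame_mul; [exact: tame_cst|exact: tame_sin].
  move=> x; rewrite mulNr mulrC -mulNr.
  exact: (is_derive_line_comp (is_derive_dotvl x y i) (is_derive_cos _)).
- exists (fun x => y ord0 i * cos (dotv x y)).
    by apply: tame_mul; [exact: tame_cst|exact: tame_cos].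
  move=> x; rewrite mulrC.
  exact: (is_derive_line_comp (is_derive_dotvl x y i) (is_derive_sin _)).
- exists (fun x => f' x + g' x); first exact: tame_add.
  by move=> x; exact: (is_deriveD (df x) (dg x)).
- exists (fun x => f x * g' x + g x * f' x); first by apply: tame_add; exact: tame_mul.
  by move=> x; exact: (is_deriveM (df x) (dg x)).
Qed.

Lemma tame_growth f : tame f -> exists M N, 0 <= M /\
  forall x, `|f x| <= M * (1 + enorm x) ^+ N.
Proof.
have e1 x : 1 <= 1 + enorm x by rewrite lerDl enorm_ge0.
elim=> [c|j|y|y|{}f g _ [M [N [M0 fM]]] _ [M' [N' [M0' gM]]]|
        {}f g _ [M [N [M0 fM]]] _ [M' [N' [M0' gM]]]].
- by exists `|c|, 0; split => // x; rewrite expr0 mulr1.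
- exists 1, 1; split => // x; rewrite mul1r expr1.
  by apply: (le_trans (coord_le_enorm x j)); rewrite lerDr.
- by exists 1, 0; split => // x; rewrite expr0 mulr1 cos_max.
- by exists 1, 0; split => // x; rewrite expr0 mulr1 sin_max.
- exists (M + M'), (N + N')%N; split; first exact: addr_ge0.
  move=> x; apply: (le_trans (ler_normD _ _)); rewrite mulrDl lerD//.
    apply: (le_trans (fM x)); rewrite ler_wpM2l// ler_weXn2l//.
    exact: leq_addr.
  apply: (le_trans (gM x)); rewrite ler_wpM2l// ler_weXn2l//.
  exact: leq_addl.
- exists (M * M'), (N + N')%N; split; first exact: mulr_ge0.
  move=> x; rewrite normrM exprD mulrACA; apply: ler_pM => //.
Qed.

Variable a : R.
Hypothesis a0 : 0 < a.

Definition dgauss x := expR (- (a * dotv x x)).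

Lemma continuous_dgauss : continuous dgauss.
Proof.
move=> x; have H : {for x, continuous (fun x => - (a * dotv x x))}.
  exact: (cvgN (cvgM (cvg_cst a) (@continuous_dotv2 x))).
by apply: (continuous_comp H); exact: continuous_expR.
Qed.

Lemma is_derive_dgauss x i :
  is_derive x (delta_mx ord0 i) dgauss (dgauss x * (- (2 * a) * x ord0 i)).
Proof.
apply: (@is_derive_line_comp x _ (fun x => - (a * dotv x x)) (- (2 * a) * x ord0 i) expR (dgauss x)).
apply: is_derive_line.
rewrite (_ : (fun t : R => _) = (fun t : R => - (a * (t * (t + 2 * x ord0 i) + dotv x x)))).
  apply: is_derive_eq; rewrite /GRing.scale/= !mul0r !add0r !addr0.
  by ring.
apply/funext => t; congr (- (a * _)).
rewrite dotvDl dotvZl dotv_delta [dotv x _]dotvC dotvDl dotvZl dotv_delta !mxE !eqxx/=.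
ring.
Qed.

Definition packet y x : R[i] := (dgauss x)%:C * Cis (dotv x y).

(** A derivative of [dgauss x * S x] is [dgauss x] times [S' x - 2 a x_i S x], and the last factor
    is again tame. *)
Lemma partials_packet y w : exists P Q, [/\ tame P, tame Q &
  partials w (packet y) = fun x => (dgauss x * P x) +i* (dgauss x * Q x)].
Proof.
elim: w => [|i w [P [Q [tP tQ E]]]].
  exists (fun x => cos (dotv x y)), (fun x => sin (dotv x y)); split.
  - exact: tame_cos.
  - exact: tame_sin.
  - by apply/funext => x /=; apply: eqReIm; rewrite /= ?mul0r ?subr0 ?addr0.
have [P' tP' dP] := tame_derive i tP; have [Q' tQ' dQ] := tame_derive i tQ.
have H S S' : (forall x, is_derive x (delta_mx ord0 i) S (S' x)) -> forall x,
    is_derive x (delta_mx ord0 i) (fun x => dgauss x * S x)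
      (dgauss x * (S' x + (- (2 * a) * x ord0 i) * S x)).
  move=> dS x; apply: (is_derive_eq (is_deriveM (is_derive_dgauss x i) (dS x))).
  rewrite /GRing.scale/=; ring.
have T S S' : tame S -> tame S' -> tame (fun x => S' x + (- (2 * a) * x ord0 i) * S x).
  move=> tS tS'; apply: tame_add => //; apply: tame_mul => //; apply: tame_mul.
    exact: tame_cst.
  exact: tame_coord.
exists (fun x => P' x + (- (2 * a) * x ord0 i) * P x), (fun x => Q' x + (- (2 * a) * x ord0 i) * Q x).
split; [exact: T|exact: T|].
apply/funext => x; rewrite /= E /partial; congr (_ +i* _).
  exact: (@derive_val _ _ _ _ _ _ _ (H _ _ dP x)).
exact: (@derive_val _ _ _ _ _ _ _ (H _ _ dQ x)).
Qed.

Lemma smooth_packet y : smooth (packet y).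
Proof.
move=> w; have [P [Q [tP tQ E]]] := partials_packet y w; rewrite E.
have C S : tame S -> continuous (fun x => dgauss x * S x).
  move=> tS x; exact: (continuousM (s := dgauss) (t := S) (@continuous_dgauss x) (tame_continuous tS (x:=x))).
split; first by split; exact: C.
move=> i x; have [P' tP' dP] := tame_derive i tP; have [Q' tQ' dQ] := tame_derive i tQ.
split.
  exact: (@ex_derive _ _ _ _ _ _ _ (is_deriveM (is_derive_dgauss x i) (dP x))).
exact: (@ex_derive _ _ _ _ _ _ _ (is_deriveM (is_derive_dgauss x i) (dQ x))).
Qed.

Lemma packet_bound y N w : exists C : R, forall x,
  (1 + enorm x) ^+ N * normc (partials w (packet y) x) <= C.
Proof.
have [P [Q [tP tQ ->]]] := partials_packet y w.
have H S : tame S -> exists C : R, forall x, (1 + enorm x) ^+ N * `|dgauss x * S x| <= C.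
  move=> /tame_growth[M [K [M0 SM]]].
  have [C C0 HC] := pow_le_exp (N + K) a0.
  exists (M * C) => x.
  have D : dgauss x = expR (- (a * enorm x ^+ 2)) by rewrite /dgauss sqr_sqrtr ?dotv_ge0.
  rewrite normrM ger0_norm ?expR_ge0//.
  apply: (@le_trans _ _ ((1 + enorm x) ^+ N * (dgauss x * (M * (1 + enorm x) ^+ K)))).
    by rewrite !ler_wpM2l ?expR_ge0 ?exprn_ge0 ?addr_ge0 ?enorm_ge0.
  have := HC _ (enorm_ge0 x); rewrite -D => HC'.
  apply: le_trans (ler_wpM2l M0 HC').
  by rewrite exprD le_eqVlt; apply/orP; left; apply/eqP; ring.
have [C1 H1] := H _ tP; have [C2 H2] := H _ tQ.
exists (C1 + C2) => x; apply: le_trans (lerD (H1 x) (H2 x)).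
rewrite -mulrDr ler_wpM2l ?exprn_ge0 ?addr_ge0 ?enorm_ge0//.
exact: normc_le_ReIm.
Qed.

Lemma schwartz_packet y : schwartz (packet y).
Proof.
split; first exact: smooth_packet.
move=> N; have /choice[C HC] := packet_bound y N.
have C0 w : 0 <= C w.
  apply: le_trans (HC w 0); rewrite mulr_ge0 ?normc_ge0// exprn_ge0//.
  by rewrite addr_ge0 ?enorm_ge0.
(* There are finitely many words of length at most [N], so the sum of their bounds dominates the
   supremum. *)
apply: (@le_lt_trans _ _ (\sum_(k < N.+1) \sum_(t : k.-tuple 'I_d) C t)%:E); last exact: ltry.
apply: ge_ereal_sup => _ [w [x [wN ->]]]; rewrite lee_fin (le_trans (HC w x))//.
have wN' : (size w < N.+1)%N by [].
rewrite (bigD1 (Ordinal wN'))//= (bigD1 (in_tuple w))//= -addrA lerDl.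
rewrite addr_ge0 ?sumr_ge0// => k _; exact: sumr_ge0.
Qed.

End wave_packets.

Section packet_transform.
Variable R : realType.
Local Notation leb1 := (@lebesgue_measure R).

Lemma cintegral_gauss_Cis (e tau : R) : 0 < e ->
  cintegrable leb1 (fun t => (expR (- (e ^+ 2 * t ^+ 2)))%:C * Cis (t * tau)) /\
  cintegral leb1 (fun t => (expR (- (e ^+ 2 * t ^+ 2)))%:C * Cis (t * tau)) =
    (e^-1 * (@ghat R 0 * expR (- ((tau / e) ^+ 2 / 4))))%:C.
Proof.
move=> e0.
have GE t : expR (- (e ^+ 2 * t ^+ 2)) = gauss_fun (e * t).
  by rewrite /gauss_fun exprMn.
have Gi := integrable_scale1 e0 (@integrableT_gauss R).
have ci : cintegrable leb1 (fun t => (expR (- (e ^+ 2 * t ^+ 2)))%:C * Cis (t * tau)).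
  apply: (cintegrable_le _ Gi).
    apply: cmeasurableM.
      apply: cmeasurable_real; under eq_fun do rewrite GE.
      apply: (measurableT_comp (@measurable_gauss_fun R)).
      exact: measurable_funM.
    by apply: cmeasurable_Cis; exact: measurable_funM.
  move=> t; rewrite ComplexField.Normc.normcM normc_Cis mulr1 normc_real GE.
  by rewrite ger0_norm ?gauss_fun_ge0.
split => //; have [i1 i2] := ci; apply: eqReIm => /=.
  rewrite -ghatE -(@Rintegral_scale1 R (fun x => gauss_fun x * cos (tau / e * x)) e e0).
    apply: eq_Rintegral => t _; rewrite mul0r subr0 GE; congr (_ * cos _).
    by field; rewrite gt_eqF.
  exact: (integrable_mul_bounded _ (@integrableT_gauss R) (@continuous_cos R) (@cos_max R)).
apply: Rintegral_odd; first exact: i2.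
by move=> t; rewrite !mul0r !addr0 sqrrN mulNr sinN mulrN.
Qed.

Variable d : nat.
Implicit Types (x y z : 'rV[R]_d).

Lemma dgauss_prod (a : R) x : dgauss a x = \prod_i expR (- (a * x ord0 i ^+ 2)).
Proof.
rewrite /dgauss /dotv mulr_sumr -sumrN expR_sum.
by apply: eq_bigr => i _; rewrite expr2.
Qed.

(** The integral factors over the coordinates. The result is a Gaussian of width [2 * e] around the
    frequency [y], so averaging at scale [c] will use [e = c / 2]. *)
Lemma fourier_packet (e : R) y x : 0 < e ->
  fourier (packet (e ^+ 2) y) x =
  ((e^-1 * @ghat R 0) ^+ d * dgauss 1 ((2 * e)^-1 *: (x - y)))%:C.
Proof.
move=> e0; rewrite /fourier.
pose g (i : 'I_d) (t : R) := (expR (- (e ^+ 2 * t ^+ 2)))%:C * Cis (t * (y ord0 i - x ord0 i)).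
rewrite (_ : (fun xi => _) = (fun xi : 'rV[R]_d => \prod_i g i (xi ord0 i))).
  have gi i := cintegral_gauss_Cis (y ord0 i - x ord0 i) e0.
  have [_ ->] := cintegral_leb_prod (fun i => (gi i).1).
  under eq_bigr do rewrite (gi _).2.
  rewrite -rmorph_prod; congr (_%:C); rewrite dgauss_prod.
  rewrite -[X in _ ^+ X](card_ord d) -prodr_const -big_split; apply: eq_bigr => i _.
  rewrite /= mulrA; congr (_ * expR (- _)); rewrite !mxE.
  by field; rewrite gt_eqF.
apply/funext => xi; rewrite /g big_split/= /packet dgauss_prod -rmorph_prod -mulrA -CisN -CisD.
congr (_ * _); rewrite -Cis_sum; congr Cis; rewrite /dotv -sumrN -big_split.
by apply: eq_bigr => i _; rewrite mulrBr.
Qed.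

Definition pgrowth (v : 'rV[R]_d -> R) := exists M N, 0 <= M /\
  forall x, `|v x| <= M * (1 + enorm x) ^+ N.

Variable v : 'rV[R]_d -> R.
Hypotheses (cv : continuous v) (gv : pgrowth v).

(** One majorant for all scales [c] in (0, 1], as dominated convergence for shrinking [c] requires:
    1 + |c z + y| is at most the product over i of (1 + |z_i|)(1 + |y_i|). *)
Let bd y : exists h : 'rV[R]_d -> R, (@leb R d).-integrable setT (EFin \o h) /\
  forall c z, 0 < c <= 1 -> `|v (c *: z + y) * dgauss 1 z| <= h z.
Proof.
have [M [N [M0 HM]]] := gv.
pose C := M * \prod_i (1 + `|y ord0 i|) ^+ N.
exists (fun z => C * \prod_i ((1 + `|z ord0 i|) ^+ N * expR (- (1 * z ord0 i ^+ 2)))).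
split.
  have [hi _] := Rintegral_leb_prod (fun i : 'I_d => @integrable_pow_gauss R N 1 ltr01).
  exact: (integrableZl measurableT C hi).
move=> c z /andP[c0 c1]; rewrite normrM (ger0_norm (expR_ge0 _)) big_split/= mulrA.
rewrite -dgauss_prod ler_wpM2r ?expR_ge0// (le_trans (HM _))// /C -mulrA ler_wpM2l//.
have P0 (w : 'rV[R]_d) : 0 <= \prod_i (1 + `|w ord0 i|).
  by apply: prodr_ge0 => i _; rewrite addr_ge0.
rewrite !prodrXl -exprMn lerXn2r ?nnegrE ?addr_ge0 ?enorm_ge0 ?mulr_ge0//.
apply: (le_trans (enorm_le_prod _)); rewrite -big_split/=.
apply: ler_prod => i _; rewrite addr_ge0//= !mxE.
apply: (@le_trans _ _ (1 + (`|z ord0 i| + `|y ord0 i|))).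
  rewrite lerD2l (le_trans (ler_normD _ _))// lerD2r normrM ger0_norm ?(ltW c0)//.
  exact: ler_piMl.
have := normr_ge0 (z ord0 i); have := normr_ge0 (y ord0 i); nra.
Qed.

Let mdg : continuous (dgauss 1 : 'rV[R]_d -> R).
Proof. exact: continuous_dgauss. Qed.

Let cvscale c y : continuous (fun z : 'rV[R]_d => c *: z + y).
Proof.
move=> z; have H : (fun z : 'rV[R]_d => c *: z) @ z --> c *: z by exact: scaler_continuous.
exact: (cvgD H (cvg_cst y)).
Qed.

Lemma gauss_average_scale c y : 0 < c <= 1 ->
  (@leb R d).-integrable setT (EFin \o (fun x => v x * dgauss 1 (c^-1 *: (x - y)))) /\
  \int[@leb R d]_x (v x * dgauss 1 (c^-1 *: (x - y))) =
    c ^+ d * \int[@leb R d]_z (v (c *: z + y) * dgauss 1 z).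
Proof.
move=> c01; have /andP[c0 c1] := c01; have [h [hi hb]] := bd y.
have gi : (@leb R d).-integrable setT (EFin \o (fun z => v (c *: z + y) * dgauss 1 z)).
  apply: (le_integrable _ _ _ hi) => //.
    apply/measurable_EFinP; apply: measurable_continuous_rV => z.
    apply: (continuousM (s := fun z => v (c *: z + y))); last exact: mdg.
    apply: (continuous_comp (@cvscale c y z)); exact: cv.
  by move=> z _ /=; rewrite lee_fin (le_trans (hb c z c01))// ler_norm.
have ci0 : 0 < c^-1 by rewrite invr_gt0.
have k0 : 0 <= c ^+ d by rewrite exprn_ge0 ?ltW.
have H A : measurable A -> leb ((fun x : 'rV[R]_d => c^-1 *: x + - (c^-1 *: y)) @^-1` A) =
    ((NngNum k0)%:num%:E * leb A)%E.
  by move=> mA; rewrite leb_affine// invrK.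
have fE : (fun x => v x * dgauss 1 (c^-1 *: (x - y))) =
    (fun z => v (c *: z + y) * dgauss 1 z) \o (fun x => c^-1 *: x + - (c^-1 *: y)).
  apply/funext => x /=.
  have -> : c *: (c^-1 *: x + - (c^-1 *: y)) + y = x.
    by rewrite scalerDr scalerN !scalerA mulfV ?gt_eqF// !scale1r subrK.
  by rewrite scalerBr.
have T1 := @integrable_transport _ _ R (@leb R d) _ _ (measurable_affine_rV _ _) H _ gi.
have T2 := @Rintegral_transport _ _ R (@leb R d) _ _ (measurable_affine_rV _ _) H _ gi.
by split; rewrite fE.
Qed.

Lemma gauss_average_cvg y :
  \int[@leb R d]_z (v ((n.+1%:R : R)^-1 *: z + y) * dgauss 1 z) @[n --> \oo] -->
  v y * \int[@leb R d]_z dgauss 1 z.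
Proof.
have [h [hi hb]] := bd y.
have Gi : (@leb R d).-integrable setT (EFin \o (dgauss 1 : 'rV[R]_d -> R)).
  have [Hi _] := Rintegral_leb_prod (fun i : 'I_d => @integrable_pow_gauss R 0 1 ltr01).
  apply: (le_integrable _ _ _ Hi) => //.
    by apply/measurable_EFinP; apply: measurable_continuous_rV; exact: mdg.
  move=> z _ /=; rewrite lee_fin dgauss_prod; under [in leRHS]eq_bigr do rewrite expr0 mul1r.
  by [].
have m1 (n : nat) : continuous (fun z => v ((n.+1%:R : R)^-1 *: z + y) * dgauss 1 z).
  move=> z; apply: (continuousM (s := fun z => v (_ *: z + y))); last exact: mdg.
  by apply: (continuous_comp (@cvscale _ y z)); exact: cv.
have [] := @dominated_convergence _ _ R (@leb R d) setT measurableT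
  (fun n => EFin \o (fun z => v ((n.+1%:R : R)^-1 *: z + y) * dgauss 1 z))
  (EFin \o (fun z => v y * dgauss 1 z)) (EFin \o h).
- by move=> n; apply/measurable_EFinP; apply: measurable_continuous_rV; exact: m1.
- apply/measurable_EFinP; apply: measurable_continuous_rV => z.
  by apply: (continuousM (s := cst (v y))); [exact: cst_continuous|exact: mdg].
- apply: aeW => z _; apply: cvg_EFin; first exact: nearW.
  rewrite (_ : fine \o _ = (fun n : nat => v ((n.+1%:R : R)^-1 *: z + y) * dgauss 1 z))//.
  apply: cvgM; last exact: cvg_cst.
  suff L : (fun n : nat => (n.+1%:R : R)^-1 *: z + y) @ \oo --> y by exact: (cvg_comp _ _ L (@cv y)).
  have L0 : (fun n : nat => (n.+1%:R : R)^-1 *: z) @ \oo --> (0 : 'rV[R]_d).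
    by rewrite -(scale0r z); apply: cvgZr_tmp; exact: cvg_harmonic.
  by rewrite -[X in _ --> X](add0r y); exact: (cvgD L0 (cvg_cst y)).
- exact: hi.
- apply: aeW => z n _ /=; rewrite lee_fin; apply: hb.
  by rewrite invr_gt0 ltr0n/= invf_le1// ler1n.
move=> _ _ Hc; rewrite -RintegralZl//.
apply: fine_cvg; rewrite fineK; last first.
  by apply: integrable_fin_num => //; exact: (integrableZl measurableT (v y) Gi).
exact: Hc.
Qed.

End packet_transform.

Section uniqueness.
Variables (R : realType) (d : nat).
Implicit Types (x y z : 'rV[R]_d) (v g : 'rV[R]_d -> R).

(** After division by [c ^+ d], the averages at scale c = 1/(n+1) converge to the value at [y] times
    the mass of the Gaussian, which is nonzero. *)
Lemma gauss_averages_inj v1 v2 : continuous v1 -> continuous v2 ->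
  pgrowth v1 -> pgrowth v2 ->
  (forall c y, 0 < c <= 1 ->
    \int[@leb R d]_x (v1 x * dgauss 1 (c^-1 *: (x - y))) =
    \int[@leb R d]_x (v2 x * dgauss 1 (c^-1 *: (x - y)))) ->
  v1 =1 v2.
Proof.
move=> c1 c2 g1 g2 E y.
have I0 : \int[@leb R d]_z dgauss 1 z != 0.
  have [_ H] := Rintegral_leb_prod (fun i : 'I_d => @integrableT_gauss R).
  rewrite (_ : dgauss 1 = (fun x : 'rV[R]_d => \prod_i gauss_fun (x ord0 i))).
    rewrite H; apply/prodf_neq0 => i _.
    by rewrite /Rintegral integralT_gauss gt_eqF// sqrtr_gt0 pi_gt0.
  by apply/funext => x; rewrite dgauss_prod; apply: eq_bigr => i _; rewrite gaussE.
apply: (mulIf I0).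
have L1 := @gauss_average_cvg R d v1 c1 g1 y; have L2 := @gauss_average_cvg R d v2 c2 g2 y.
have F : (fun n : nat => \int[@leb R d]_z (v1 ((n.+1%:R : R)^-1 *: z + y) * dgauss 1 z)) =
    (fun n : nat => \int[@leb R d]_z (v2 ((n.+1%:R : R)^-1 *: z + y) * dgauss 1 z)).
  apply/funext => n.
  have n01 : 0 < (n.+1%:R : R)^-1 <= 1 by rewrite invr_gt0 ltr0n/= invf_le1// ler1n.
  have := E _ y n01.
  rewrite (gauss_average_scale c1 g1 y n01).2 (gauss_average_scale c2 g2 y n01).2.
  by apply: mulfI; rewrite expf_neq0// gt_eqF//; case/andP: n01.
by move: L1; rewrite F => L1; exact: (cvg_unique (@Rhausdorff R) L1 L2).
Qed.

(* The Fourier transforms of the modulated Gaussians [packet] are translates of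
   Gaussian approximate identities, so testing against them recovers [g]. *)
Lemma fourier_pairing_inj (g1 g2 : 'rV[R]_d -> R[i]) :
  ccontinuous g1 -> ccontinuous g2 -> poly_growth g1 -> poly_growth g2 ->
  (forall eta, schwartz eta ->
    dist_of g1 (fourier eta) = dist_of g2 (fourier eta)) -> g1 =1 g2.
Proof.
move=> [c1r c1i] [c2r c2i] p1 p2 E.
have pg (k : R[i] -> R) (g : 'rV[R]_d -> R[i]) : (forall u : R[i], `|k u| <= normc u) ->
    poly_growth g -> pgrowth (k \o g).
  move=> kz [M [N gM]]; exists `|M|, N; split => // x.
  apply: (le_trans (kz _)); apply: (le_trans (gM x)).
  by rewrite ler_wpM2r ?ler_norm// exprn_ge0 ?addr_ge0 ?enorm_ge0.
have p1r := pg _ _ (@Re_le_normc R) p1; have p1i := pg _ _ (@Im_le_normc R) p1.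
have p2r := pg _ _ (@Re_le_normc R) p2; have p2i := pg _ _ (@Im_le_normc R) p2.
pose K (c : R) : R := ((c / 2)^-1 * @ghat R 0) ^+ d.
have K0 c : 0 < c -> K c != 0.
  by move=> c0; rewrite expf_neq0// mulf_neq0 ?invr_neq0 ?gt_eqF ?ghat0_gt0 ?divr_gt0.
have D (g : 'rV[R]_d -> R[i]) c y : 0 < c <= 1 ->
    continuous (Re \o g) -> continuous (Im \o g) ->
    pgrowth (Re \o g) -> pgrowth (Im \o g) ->
    dist_of g (fourier (packet ((c / 2) ^+ 2) y)) =
    (K c * \int[@leb R d]_x ((Re \o g) x * dgauss 1 (c^-1 *: (x - y)))) +i*
    (K c * \int[@leb R d]_x ((Im \o g) x * dgauss 1 (c^-1 *: (x - y)))).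
  move=> c01 cr ci pr p_i; have /andP[c0 _] := c01.
  have [ir _] := gauss_average_scale cr pr y c01.
  have [ii _] := gauss_average_scale ci p_i y c01.
  rewrite -!RintegralZl// /dist_of.
  have e x : fourier (packet ((c / 2) ^+ 2) y) x = (K c * dgauss 1 (c^-1 *: (x - y)))%:C.
    have c20 : 0 < c / 2 by rewrite divr_gt0.
    rewrite (fourier_packet y x c20) /K.
    by rewrite (_ : 2 * (c / 2) = c)//; field.
  apply: eqReIm; apply: eq_Rintegral => x _; rewrite e.
    by rewrite cReM /= mulr0 subr0 mulrCA.
  by rewrite cImM /= mulr0 add0r mulrCA.
have H c y : 0 < c <= 1 ->
    \int[@leb R d]_x ((Re \o g1) x * dgauss 1 (c^-1 *: (x - y))) =
    \int[@leb R d]_x ((Re \o g2) x * dgauss 1 (c^-1 *: (x - y))) /\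
    \int[@leb R d]_x ((Im \o g1) x * dgauss 1 (c^-1 *: (x - y))) =
    \int[@leb R d]_x ((Im \o g2) x * dgauss 1 (c^-1 *: (x - y))).
  move=> c01; have /andP[c0 _] := c01.
  have c20 : 0 < (c / 2) ^+ 2 by rewrite exprn_gt0 ?divr_gt0.
  have := E _ (schwartz_packet c20 y).
  by rewrite !D// => -[/(mulfI (K0 c c0)) -> /(mulfI (K0 c c0)) ->].
move=> x; apply: eqReIm.
  by apply: (gauss_averages_inj c1r c2r p1r p2r) => c y c01; have [] := H c y c01.
by apply: (gauss_averages_inj c1i c2i p1i p2i) => c y c01; have [] := H c y c01.
Qed.

End uniqueness.

Section fourier_swap.
Variables (R : realType) (d : nat).
Implicit Types (f zeta : 'rV[R]_d -> R[i]).

Lemma measurable_dotv2 :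
  measurable_fun setT (fun p : 'rV[R]_d * 'rV[R]_d => dotv p.1 p.2).
Proof.
apply: measurable_sum => i; apply: measurable_funM.
  exact: (measurableT_comp (measurable_coord i) measurable_fst).
exact: (measurableT_comp (measurable_coord i) measurable_snd).
Qed.

Lemma fourierE f xi : fourier f xi =
  cintegral (@leb R d) (fun x => f x * Cis (- dotv x xi)).
Proof. by congr (cintegral _ _); apply/funext => x; rewrite CisN. Qed.

(** Fubini for f(x) zeta(y) e^(-i x.y), whose modulus is that of an integrable tensor product. *)
Lemma fourier_swap f zeta : cintegrable (@leb R d) f -> cintegrable (@leb R d) zeta ->
  dist_of f (fourier zeta) = dist_of zeta (fourier f).
Proof.
move=> fi zi; rewrite /dist_of.
pose K (p : 'rV[R]_d * 'rV[R]_d) := f p.1 * zeta p.2 * Cis (- dotv p.1 p.2).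
have Ki : cintegrable (@leb R d \x @leb R d)%E K.
  have ti := cintegrable_tensor fi zi.
  apply: (cintegrable_le _ (cintegrable_normc ti)).
    apply: cmeasurableM; first exact: cintegrable_measurable ti.
    apply: cmeasurable_Cis; apply: measurable_funN; exact: measurable_dotv2.
  by move=> p; rewrite ComplexField.Normc.normcM normc_Cis mulr1.
have mulCis (g : 'rV[R]_d -> R[i]) y : cintegrable (@leb R d) g ->
    cintegrable (@leb R d) (fun x => g x * Cis (- dotv x y)).
  move=> gi; apply: (cintegrable_le _ (cintegrable_normc gi)).
    apply: cmeasurableM; first exact: cintegrable_measurable gi.
    apply: cmeasurable_Cis; apply: measurable_funN.
    by apply: measurable_continuous_rV; exact: continuous_dotvl.
  by move=> x; rewrite ComplexField.Normc.normcM normc_Cis mulr1.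
have E1 x : f x * fourier zeta x = cintegral (@leb R d) (fun y => K (x, y)).
  rewrite fourierE -cintegralZ; last exact: mulCis.
  by congr (cintegral _ _); apply/funext => y; rewrite mulrA (dotvC y x).
have E2 y : zeta y * fourier f y = cintegral (@leb R d) (fun x => K (x, y)).
  rewrite fourierE -cintegralZ; last exact: mulCis.
  by congr (cintegral _ _); apply/funext => x; rewrite mulrA (mulrC (zeta y)).
rewrite (funext E1) (funext E2).
exact: (cfubini Ki).
Qed.

End fourier_swap.

(** * Lacunary sums of bumps *)

Section bump.
Variables (R : realType) (d : nat).
Local Notation leb1 := (@lebesgue_measure R).
Implicit Types (x y : 'rV[R]_d).

(** The modulation is spread over the coordinates, with frequency [om] on the first and 0 on the
    others, so that the bump and its transform are both products. *)
Definition bump (w om : R) x : R[i] :=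
  \prod_i ((fej (w * x ord0 i))%:C * Cis ((val i == 0%N)%:R * om * x ord0 i)).

(** The modulus of [bump] ([normc_bump]): level sets and norms do not see the frequency. *)
Definition bumpR (w : R) x : R := \prod_i fej (w * x ord0 i).

Lemma bumpE w om x :
  bump w om x = (bumpR w x)%:C * Cis (\sum_(i < d) (val i == 0%N)%:R * om * x ord0 i).
Proof. by rewrite /bump big_split/= -rmorph_prod Cis_sum. Qed.

Lemma bumpR_ge0 w x : 0 <= bumpR w x.
Proof. by apply: prodr_ge0 => i _; exact: fej_ge0. Qed.

Lemma bumpR_le1 w x : bumpR w x <= 1.
Proof. by apply: prodr_ile1 => i _; rewrite fej_ge0 fej_le1. Qed.

Lemma normc_bump w om x : normc (bump w om x) = bumpR w x.
Proof.
by rewrite bumpE ComplexField.Normc.normcM normc_Cis mulr1 normc_real ger0_norm ?bumpR_ge0.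
Qed.

Lemma continuous_prod_fin n (F : 'I_n -> 'rV[R]_d -> R) :
  (forall i, continuous (F i)) -> continuous (fun x => \prod_i F i x).
Proof.
elim: n F => [|n IH] F cF x.
  rewrite (_ : (fun x => _) = cst 1); first exact: cst_continuous.
  by apply/funext => z; rewrite big_ord0.
rewrite (_ : (fun x => _) = (fun x => F ord0 x * \prod_(i < n) F (lift ord0 i) x)).
  exact: (cvgM (cF ord0 x) (IH _ (fun i => cF (lift ord0 i)) x)).
by apply/funext => z; rewrite big_ord_recl.
Qed.

Lemma continuous_bumpR w : continuous (bumpR w).
Proof.
apply: continuous_prod_fin => i x.
have H : {for x, continuous (fun x : 'rV[R]_d => w * x ord0 i)}.
  exact: (cvgM (cvg_cst w) (@continuous_coord R d i x)).
by apply: (continuous_comp H); exact: continuous_fej.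
Qed.

Lemma ccontinuous_bump (a : R) w om : ccontinuous (fun x => a%:C * bump w om x).
Proof.
have H : continuous (fun x => \sum_(i < d) (val i == 0%N)%:R * om * x ord0 i : R).
  apply: continuous_sum_fin => i x.
  exact: (cvgM (cvg_cst _) (@continuous_coord R d i x)).
have C (g : R -> R) : continuous g -> continuous (fun x : 'rV[R]_d =>
    a * (bumpR w x * g (\sum_(i < d) (val i == 0%N)%:R * om * x ord0 i))).
  move=> cg x; have A := continuous_comp (H x) (cg _).
  exact: (cvgM (cvg_cst a) (cvgM (@continuous_bumpR w x) A)).
split.
  rewrite (_ : _ \o _ = (fun x => a * (bumpR w x * cos (\sum_(i < d) (val i == 0%N)%:R * om * x ord0 i)))).
    exact: (C cos (@continuous_cos R)).
  by apply/funext => z; rewrite /= bumpE !cReM/=; ring.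
rewrite (_ : _ \o _ = (fun x => a * (bumpR w x * sin (\sum_(i < d) (val i == 0%N)%:R * om * x ord0 i)))).
  exact: (C sin (@continuous_sin R)).
by apply/funext => z; rewrite /= bumpE !cImM/=; ring.
Qed.

Lemma bump_integrable w om : 0 < w -> cintegrable (@leb R d) (bump w om).
Proof.
move=> w0; exact: (cintegral_leb_prod (fun i : 'I_d => cintegrable_fej_Cis _ w0)).1.
Qed.

Lemma bumpR_integral w : 0 < w ->
  (@leb R d).-integrable setT (EFin \o bumpR w) /\
  \int[@leb R d]_x bumpR w x = (w^-1 * fejC R) ^+ d.
Proof.
move=> w0.
have [H1 H2] := Rintegral_leb_prod (fun i : 'I_d => integrable_scale1 w0 (@integrable_fej R)).
split => //; rewrite H2 prodr_const card_ord.
by rewrite (Rintegral_scale1 w0 (@integrable_fej R)).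
Qed.

(** The transform is a product of one-dimensional transforms of [fej (w * t)], each of which
    vanishes at frequencies of modulus at least [2 * w]. *)
Lemma fourier_bump_supp w om y : 0 < w -> fourier (bump w om) y != 0 ->
  forall i : 'I_d, `|y ord0 i - (val i == 0%N)%:R * om| < 2 * w.
Proof.
move=> w0; rewrite fourierE.
pose g (i : 'I_d) (t : R) := (fej (w * t))%:C * Cis (((val i == 0%N)%:R * om - y ord0 i) * t).
rewrite (_ : (fun x => _) = (fun x : 'rV[R]_d => \prod_i g i (x ord0 i))).
  have [_ ->] := cintegral_leb_prod (fun i => cintegrable_fej_Cis ((val i == 0%N)%:R * om - y ord0 i) w0).
  move=> /prodf_neq0 H i; rewrite ltNge; apply/negP => wy.
  have := H i isT; rewrite (cintegral_fej_Cis w0) ?eqxx//.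
  by rewrite distrC.
apply/funext => x; rewrite bumpE /g big_split/= -rmorph_prod -mulrA; congr (_ * _).
rewrite -CisD -Cis_sum; congr Cis; rewrite /dotv -sumrN -big_split.
by apply: eq_bigr => i _; rewrite mulrBl [y _ _ * _]mulrC.
Qed.

(** The constant 32 d gives the margin: the first coordinate deviates from [om] by at most om/16,
    and the squares of the others add at most d (2 w)^2 <= om^2/256 to the squared norm. *)
Lemma fourier_bump_annulus w om y : 0 < w -> 32 * d%:R * w <= om ->
  (0 < d)%N -> fourier (bump w om) y != 0 ->
  7 / 8 * om <= enorm y <= 9 / 8 * om.
Proof.
move=> w0 wom d0 /(fourier_bump_supp w0) H.
have d1 : 1 <= d%:R :> R by rewrite ler1n.
have om0 : 0 < om by apply: lt_le_trans wom; rewrite !mulr_gt0// ltr0n.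
pose i0 := Ordinal d0; have := H i0; rewrite /= mul1r => H0.
have w1 : 2 * w <= om / 16 by nra.
apply/andP; split.
  apply: le_trans (coord_le_enorm y i0); apply: le_trans (ler_norm _).
  have := ltW H0; rewrite ler_norml => /andP[] ? _; lra.
rewrite -ler_sqr ?nnegrE ?enorm_ge0 ?mulr_ge0 ?(ltW om0)// enorm_sqr (bigD1 i0)//=.
have A : y ord0 i0 ^+ 2 <= (om + 2 * w) ^+ 2.
  rewrite -(@real_normK _ (y ord0 i0)) ?num_real// lerXn2r ?nnegrE//; first by lra.
  by have := ler_normD (y ord0 i0 - om) om; rewrite subrK (gtr0_norm om0); lra.
have B : \sum_(i < d | i != i0) y ord0 i ^+ 2 <= d%:R * (4 * w ^+ 2).
  apply: (@le_trans _ _ (\sum_(i < d) (4 * w ^+ 2))); last first.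
    by rewrite sumr_const card_ord [leRHS]mulr_natl.
  apply: (@le_trans _ _ (\sum_(i < d | i != i0) (4 * w ^+ 2))); last first.
    by rewrite [leRHS](bigD1 i0)//= lerDr mulr_ge0 ?sqr_ge0.
  apply: ler_sum => i ii0; have := H i.
  have -> : (val i == 0%N) = false by apply/negbTE; apply: contra ii0 => /eqP E; apply/eqP/val_inj.
  rewrite mul0r subr0 => /ltW Hi.
  rewrite -(@real_normK _ (y ord0 i)) ?num_real// (_ : 4 * w ^+ 2 = (2 * w) ^+ 2); last by ring.
  by rewrite lerXn2r ?nnegrE//; lra.
apply: (le_trans (lerD A B)).
set D := d%:R in wom d1 *; clearbody D.
have : D * w <= om / 32 by lra.
have : w <= om / 32 by nra.
move=> ? ?; have : D * w * w <= om / 32 * (om / 32) by apply: ler_pM => //; nra.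
have : om * w <= om * (om / 32) by nra.
have : w * w <= (om / 32) * (om / 32) by nra.
nra.
Qed.

End bump.

(** * The lacunary functional and its Littlewood-Paley pieces *)

Section lacunary.
Variables (R : realType) (d : nat).
Hypothesis d0 : (0 < d)%N.
Variables (a w : nat -> R).
Hypothesis a_ge0 : forall n, 0 <= a n.
Hypothesis a_le : forall n, a n <= (1 / 2) ^+ n.
Hypothesis w_gt0 : forall n, 0 < w n.
Hypothesis w_le : forall n, 32 * d%:R * w n <= 1.
Implicit Types h : 'rV[R]_d -> R[i].

Definition lpiece (k : int) : 'rV[R]_d -> R[i] :=
  match k with
  | Posz n => fun x => (a n)%:C * bump (w n) (2 ^+ n) x
  | Negz _ => fun=> 0
  end.

Let b (n : nat) : 'rV[R]_d -> R[i] := lpiece n%:Z.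

Definition lterm (n : nat) h : R[i] := dist_of (b n) h.

(** The pairings are summed, not the functions, so only numerical series have to converge; real and
    imaginary parts are separated because the limits are taken in [R]. *)
Definition lacunary h : R[i] :=
  limn (series (fun n => Re (lterm n h))) +i* limn (series (fun n => Im (lterm n h))).

Let bi n : cintegrable (@leb R d) (b n).
Proof. by apply: cintegrableZ; exact: bump_integrable. Qed.

Let b_mul_le n h x : normc (b n x * h x) <= a n * normc (h x).
Proof.
rewrite ComplexField.Normc.normcM ler_wpM2r ?normc_ge0//.
rewrite ComplexField.Normc.normcM normc_bump normc_real ger0_norm// ler_piMr//.
exact: bumpR_le1.
Qed.

Let b_mul_integrable n h : schwartz h ->
  cintegrable (@leb R d) (fun x => b n x * h x).
Proof.
move=> sh; have [hi _] := schwartz_integrable sh.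
apply: (cintegrable_le (h := fun x => a n * normc (h x))) => //.
  exact: (cmeasurableM (cintegrable_measurable (bi n)) (cintegrable_measurable hi)).
exact: (integrableZl measurableT (a n) (cintegrable_normc hi)).
Qed.

Lemma normc_lterm n h : schwartz h ->
  normc (lterm n h) <= 2 * (\int[@leb R d]_x normc (h x)) * (1 / 2) ^+ n.
Proof.
move=> sh; have [hi _] := schwartz_integrable sh.
have h0 : 0 <= \int[@leb R d]_x normc (h x).
  by apply: Rintegral_ge0 => x _; exact: normc_ge0.
apply: (le_trans (normc_cintegral (b_mul_integrable n sh))).
rewrite -mulrA ler_wpM2l//.
apply: (@le_trans _ _ (\int[@leb R d]_x (a n * normc (h x)))).
  apply: le_Rintegral => //; first exact: (cintegrable_normc (b_mul_integrable n sh)).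
  exact: (integrableZl measurableT (a n) (cintegrable_normc hi)).
rewrite RintegralZl//; last exact: cintegrable_normc.
by rewrite mulrC ler_wpM2l.
Qed.

Let geo (C : R) (s : nat -> R) : 0 <= C -> (forall n, `|s n| <= C * (1 / 2) ^+ n) ->
  cvgn (series s) /\ `|limn (series s)| <= C * 2.
Proof.
move=> C0 sC.
have h1 : `|1 / 2 : R| < 1 by rewrite ger0_norm; lra.
have gc : series (geometric C (1 / 2)) @ \oo --> C * (1 - 1 / 2)^-1.
  exact: cvg_geometric_series.
have nc : cvgn [normed series s].
  have gn n : 0 <= geometric C (1 / 2) n by rewrite /geometric/= mulr_ge0// exprn_ge0//; lra.
  have gcv : cvgn (series (geometric C (1 / 2))) by apply/cvg_ex; eexists; exact: gc.
  exact: (series_le_cvg (fun n => normr_ge0 (s n)) gn sC gcv).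
have sc := normed_cvg nc.
split => //; apply: (le_trans (lim_series_norm nc)).
apply: (@le_trans _ _ (limn (series (geometric C (1 / 2))))).
  apply: lim_series_le => //; last by apply/cvg_ex; eexists; exact: gc.
rewrite (cvg_lim (@Rhausdorff R) gc) ler_wpM2l//.
by rewrite le_eqVlt; apply/orP; left; apply/eqP; field.
Qed.

Lemma lterm_linear n (c : R[i]) h1 h2 : schwartz h1 -> schwartz h2 ->
  lterm n (fun x => c * h1 x + h2 x) = c * lterm n h1 + lterm n h2.
Proof.
move=> s1 s2; have i1 := b_mul_integrable n s1; have i2 := b_mul_integrable n s2.
rewrite /lterm /dist_of.
rewrite (_ : (fun x => _) = (fun x => c * (b n x * h1 x) + b n x * h2 x)); last first.
  by apply/funext => x; ring.
rewrite cintegralD//; last exact: cintegrableZ.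
by rewrite cintegralZ.
Qed.

(** The geometric decay of the amplitudes bounds the functional by the L^1 norm, hence by one
    Schwartz seminorm of order 2 d. *)
Lemma lacunary_dual : schwartz_inf_dual lacunary.
Proof.
(* In the constant 8, one factor 2 comes from [normc_cintegral], one from the geometric series and
   one from adding real and imaginary parts. *)
have cv h : schwartz h ->
    [/\ cvgn (series (fun n => Re (lterm n h))), cvgn (series (fun n => Im (lterm n h))) &
     normc (lacunary h) <= 8 * \int[@leb R d]_x normc (h x)].
  move=> sh; have C0 : 0 <= 2 * (\int[@leb R d]_x normc (h x)).
    by rewrite mulr_ge0// Rintegral_ge0// => x _; exact: normc_ge0.
  have [c1 b1] := geo C0 (fun n => le_trans (Re_le_normc _) (normc_lterm n sh)).
  have [c2 b2] := geo C0 (fun n => le_trans (Im_le_normc _) (normc_lterm n sh)).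
  split => //; apply: (le_trans (normc_le_ReIm _)) => /=; lra.
split.
  move=> c h1 h2 [s1 _] [s2 _].
  have [r1 i1 _] := cv _ s1; have [r2 i2 _] := cv _ s2.
  have sM (f g k : nat -> R) (p q : R) : cvgn (series f) -> cvgn (series g) -> cvgn (series k) ->
      limn (series (fun n => p * f n + q * g n + k n)) =
      p * limn (series f) + q * limn (series g) + limn (series k).
    move=> cf cg ck; apply: (cvg_lim (@Rhausdorff R)).
    rewrite (_ : series _ = (fun n => p * series f n + q * series g n + series k n)).
      exact: (cvgD (cvgD (cvgM (cvg_cst p) cf) (cvgM (cvg_cst q) cg)) ck).
    apply/funext => n; rewrite /series/= !mulr_sumr -!big_split.
    by apply: eq_bigr.
  have Er : (fun n => Re (lterm n (fun x => c * h1 x + h2 x))) =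
      (fun n => Re c * Re (lterm n h1) + (- Im c) * Im (lterm n h1) + Re (lterm n h2)).
    by apply/funext => n; rewrite lterm_linear// cReD cReM mulNr.
  have Ei : (fun n => Im (lterm n (fun x => c * h1 x + h2 x))) =
      (fun n => Re c * Im (lterm n h1) + Im c * Re (lterm n h1) + Im (lterm n h2)).
    by apply/funext => n; rewrite lterm_linear// cImD cImM.
  rewrite /lacunary Er Ei sM// sM//.
  by apply: eqReIm; rewrite ?cReD ?cImD ?cReM ?cImM/= ?mulNr.
exists (8 * \int[@leb R d]_x oneV x), d.*2; split.
  rewrite mulr_ge0// Rintegral_ge0// => x _.
  by apply: prodr_ge0 => i _; rewrite invr_ge0 addr_ge0// sqr_ge0.
move=> h [sh _]; have [_ _ H] := cv _ sh; have [_ H2] := schwartz_integrable sh.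
apply: (@le_trans _ _ ((8 * \int[@leb R d]_x normc (h x))%R%:E)); first by rewrite lee_fin.
by rewrite !EFinM -muleA lee_wpmul2l.
Qed.

(** The partial sums are eventually constant. This evaluates the functional at [fourier zeta] in
    [lacunary_LP], a function that has not been shown to be Schwartz. *)
Lemma lacunary_single k h : (forall n, n != k -> lterm n h = 0) ->
  lacunary h = lterm k h.
Proof.
move=> H.
have S (s : nat -> R) : (forall n, n != k -> s n = 0) -> limn (series s) = s k.
  move=> s0; apply: (cvg_lim (@Rhausdorff R)); apply: cvg_near_cst.
  near=> n; have kn : (k < n)%N by near: n; exact: nbhs_infty_gt.
  rewrite /series/= big_mkord (bigD1 (Ordinal kn))//= big1 ?addr0// => i ik.
  by apply: s0; apply: contra ik => /eqP E; apply/eqP/val_inj.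
apply: eqReIm.
  by apply: (S (fun n => Re (lterm n h))) => n nk; rewrite H.
by apply: (S (fun n => Im (lterm n h))) => n nk; rewrite H.
Unshelve. all: by end_near. Qed.

Lemma ccontinuous_lpiece k : ccontinuous (lpiece k).
Proof.
case: k => n; first exact: ccontinuous_bump.
by split => x; exact: cst_continuous.
Qed.

Lemma poly_growth_lpiece k : poly_growth (lpiece k).
Proof.
exists 1, 0%N => x; rewrite expr0 mulr1; case: k => n /=; last by rewrite expr0n/= addr0 sqrtr0.
rewrite ComplexField.Normc.normcM normc_bump normc_real ger0_norm// mulr_ile1 ?bumpR_ge0 ?bumpR_le1//.
by apply: le_trans (a_le n) _; rewrite exprn_ile1//; lra.
Qed.

Variable phi : 'rV[R]_d -> R[i].
Hypothesis phiP : LP_cutoff phi.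

Let phi_bounded : exists B, forall x, normc (phi x) <= B.
Proof.
have [[sm cpt] _ _ _ _] := phiP; have [[cr ci] _] := sm [::].
have bnd (g : 'rV[R]_d -> R) : continuous g -> exists B, forall x, csupp phi x -> `|g x| <= B.
  move=> cg; have := @continuous_compact _ _ g (csupp phi) (continuous_subspaceT cg) cpt.
  move=> /compact_bounded[M [_ HM]]; exists (M + 1) => x px.
  by apply: (HM (M + 1)); [rewrite ltrDl|exists x].
have [B1 H1] := bnd _ cr; have [B2 H2] := bnd _ ci.
exists (Num.max 0 (B1 + B2)) => x; rewrite le_max.
have [px|npx] := pselect (csupp phi x).
  by apply/orP; right; apply: (le_trans (normc_le_ReIm _)); rewrite lerD ?H1 ?H2.
apply/orP; left; have -> : phi x = 0.
  apply/eqP/negP => /negP px; apply: npx; exact: subset_closure.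
by rewrite /= expr0n/= addr0 sqrtr0.
Qed.

Let zeta_integrable k eta : schwartz eta ->
  cintegrable (@leb R d) (fun xi => phi ((2 : R) ^ (- k) *: xi) * eta xi).
Proof.
move=> se; have [ei _] := schwartz_integrable se; have [B HB] := phi_bounded.
have [[sm _] _ _ _ _] := phiP; have [cphi _] := sm [::].
apply: (cintegrable_le (h := fun xi => B * normc (eta xi))).
- apply: cmeasurableM; last exact: (cintegrable_measurable ei).
  apply: (cmeasurable_comp (ccontinuous_measurable cphi)).
  apply: measurable_fun_rV => i.
  rewrite (_ : (fun x => _) = (fun x : 'rV[R]_d => (2 : R) ^ (- k) * x ord0 i)); last first.
    by apply/funext => x; rewrite mxE.
  by apply: measurable_funM => //; exact: measurable_coord.
- exact: (integrableZl measurableT B (cintegrable_normc ei)).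
- by move=> x; rewrite ComplexField.Normc.normcM ler_wpM2r ?normc_ge0.
Qed.

Lemma enormZ (c : R) (x : 'rV[R]_d) : 0 <= c -> enorm (c *: x) = c * enorm x.
Proof.
move=> c0; apply/eqP; rewrite -(@eqrXn2 _ 2%N) ?enorm_ge0 ?mulr_ge0 ?enorm_ge0//.
rewrite enorm_sqr exprMn enorm_sqr mulr_sumr.
by apply/eqP; apply: eq_bigr => i _; rewrite mxE exprMn.
Qed.

(** Where the transform lives, |y| is between 7/8 and 9/8 of 2^n. For k < n the rescaled norm is at
    least 2 (7/8) = 7/4, the excluded endpoint of the support of [phi]; for k > n it is at most
    (9/8) / 2 < 3/4. *)
Let phi_on (n : nat) y : fourier (b n) y != 0 ->
  phi ((2 : R) ^ (- n%:Z) *: y) = 1 /\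
  forall k : int, k != n%:Z -> phi ((2 : R) ^ (- k) *: y) = 0.
Proof.
have -> : fourier (b n) y = (a n)%:C * fourier (bump (w n) (2 ^+ n)) y.
  rewrite !fourierE -cintegralZ.
    by congr (cintegral _ _); apply/funext => x; rewrite /b /= mulrA.
  have gi := @bump_integrable R d (w n) (2 ^+ n) (w_gt0 n).
  apply: (cintegrable_le _ (cintegrable_normc gi)).
    apply: cmeasurableM; first exact: cintegrable_measurable gi.
    apply: cmeasurable_Cis; apply: measurable_funN.
    by apply: measurable_continuous_rV; exact: continuous_dotvl.
  by move=> x; rewrite ComplexField.Normc.normcM normc_Cis mulr1.
rewrite mulf_eq0 negb_or => /andP[_ Fy].
have n1 : 1 <= (2 : R) ^+ n by rewrite exprn_ege1// ler1n.
have wn : 32 * d%:R * w n <= 2 ^+ n by exact: le_trans (w_le n) n1.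
have /andP[y1 y2] := fourier_bump_annulus (w_gt0 n) wn d0 Fy.
have [_ _ supp one _] := phiP.
have p0 (k : int) : 0 < (2 : R) ^ k by rewrite exprz_gt0.
split.
  apply: one; rewrite enormZ ?(ltW (p0 _))//.
  have -> : (2 : R) ^ (- n%:Z) = (2 ^+ n)^-1 by rewrite -exprnN.
  by rewrite [_^-1 * enorm y]mulrC ler_pdivlMr ?exprn_gt0// ler_pdivrMr ?exprn_gt0// y1.
move=> k kn; apply/eqP; apply/negP => /negP pk.
have := supp _ (@subset_closure _ [set xi | phi xi != 0] _ pk).
rewrite /= enormZ ?(ltW (p0 _))// => /andP[k1 k2].
have E : (2 : R) ^ (- k) * 2 ^+ n = (2 : R) ^ (n%:Z - k).
  by rewrite -[2 ^+ n]/((2 : R) ^ n%:Z) -expfzDr// addrC.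
have [nk|nk|/eqP] := ltgtP (n%:Z - k) 0.
- have : (2 : R) ^ (n%:Z - k) <= 2 ^ (-1 : int) by rewrite ler_eXz2l ?ltr1n//; lia.
  rewrite -E -[2 ^ (-1)]/(2^-1 : R) => h; have := p0 (- k); nra.
- have : 2 ^ (1 : int) <= (2 : R) ^ (n%:Z - k) by rewrite ler_eXz2l ?ltr1n//; lia.
  rewrite -E -[2 ^ 1]/(2 : R) => h; have := p0 (- k); nra.
- by rewrite subr_eq0 eq_sym (negbTE kn).
Qed.

(** [fourier_swap] moves each pairing to the frequency side, where by [phi_on] the k-th cutoff acts
    on the transform of the n-th bump as 1 if k = n and as 0 otherwise. At most one term of the
    series survives. *)
Lemma lacunary_LP : is_LP phi lacunary lpiece.
Proof.
move=> k; split; [exact: ccontinuous_lpiece|exact: poly_growth_lpiece|].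
move=> eta se; have [ei _] := schwartz_integrable se; have zi := zeta_integrable k se.
set zeta := (fun xi => _) in zi *; rewrite /fourier_dist.
have T n : lterm n (fourier zeta) = if k == n%:Z then dist_of (b n) (fourier eta) else 0.
  rewrite /lterm (fourier_swap (bi n) zi) (fourier_swap (bi n) ei) /dist_of.
  case: eqP => [kn|/eqP kn].
    congr (cintegral _ _); apply/funext => y; rewrite /zeta kn.
    have [->|Fy] := eqVneq (fourier (b n) y) 0; first by rewrite !mulr0.
    by rewrite (phi_on Fy).1 mul1r.
  rewrite (_ : (fun x => _) = (fun x => (0 : R)%:C)).
    by rewrite cintegral_real /Rintegral integral0.
  apply/funext => y; rewrite /zeta.
  have [->|Fy] := eqVneq (fourier (b n) y) 0; first by rewrite mulr0.
  by rewrite ((phi_on Fy).2 k kn) !mul0r.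
case kE : k => [n|n].
  rewrite (lacunary_single (k := n)).
    by rewrite T kE eqxx.
  by move=> m mn; rewrite T kE eqz_nat eq_sym (negbTE mn).
rewrite (lacunary_single (k := 0%N)) => [|m _]; rewrite T kE//=.
rewrite /dist_of (_ : (fun x => _) = (fun x => (0 : R)%:C)).
  by rewrite cintegral_real /Rintegral integral0.
by apply/funext => y; rewrite mul0r.
Qed.

End lacunary.

(** * The weighted measure and the level sets of a bump *)

Lemma measurable_fun_fiberwise {d1 d2} {T : measurableType d1} {U : measurableType d2}
    (F : int -> T -> U) : (forall k, measurable_fun setT (F k)) ->
  measurable_fun setT (fun z : T * int => F z.2 z.1).
Proof.
move=> mF _ Y mY; rewrite setTI.
have -> : (fun z : T * int => F z.2 z.1) @^-1` Y =
    \bigcup_(k : int) ((F k @^-1` Y) `*` [set k]).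
  apply/seteqP; split => -[x k] /=; first by move=> H; exists k.
  by move=> [k' _ [/= H ->]].
apply: countable_bigcupT_measurable => [|k]; first exact: countableP.
apply: measurableX; last by [].
by rewrite -[X in measurable X]setTI; exact: mF.
Qed.

Section weighted.
Variables (R : realType) (d : nat).
Local Open Scope ereal_scope.

Lemma mu_gamma_ysection (gamma : R) (E : set ('rV[R]_d * int)) : measurable E ->
  mu_gamma gamma E = \esum_(k in [set: int])
    (2 `^ (- (k%:~R * gamma)))%:E * leb (ysection E k).
Proof.
move=> mE; apply: eq_esum => k _; congr (_ * _).
rewrite (_ : (fun x => (\1_E (x, k))%:E) = EFin \o \1_(ysection E k)).
  by rewrite integral_indic ?setIT//; exact: measurable_ysection.
by apply/funext => x /=; rewrite !indicE mem_ysection.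
Qed.

Lemma esum_int_nat (f : int -> \bar R) : (forall k, 0 <= f k) ->
  (forall n : nat, f (Negz n) = 0) ->
  \esum_(k in [set: int]) f k = \sum_(n <oo) f n%:Z.
Proof.
move=> f0 fN; rewrite nneseries_esumT//.
have bij : set_bij [set: nat] (range Posz) Posz.
  split; [by move=> n _; exists n|by move=> m n _ _ []|by move=> k [n _ <-]; exists n].
rewrite -(@reindex_esum R nat int setT (range Posz) Posz f bij).
rewrite [RHS]esum_mkcond; apply: eq_esum => -[n|n] _.
  by rewrite mem_set//; exists n.
by rewrite memNset// => -[].
Qed.

Lemma leb_le_Rintegral (E : set 'rV[R]_d) (g : 'rV[R]_d -> R) : measurable E ->
  (@leb R d).-integrable setT (EFin \o g) ->
  (forall x, (\1_E x <= g x)%R) -> leb E <= (\int[@leb R d]_x g x)%R%:E.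
Proof.
move=> mE gi Eg; rewrite /Rintegral fineK; last exact: integrable_fin_num.
rewrite -(setIT E) -integral_indic//; apply: ge0_le_integral => //.
- exact/measurable_EFinP.
- by have /integrableP[] := gi.
- by move=> x _; rewrite lee_fin.
Qed.

Lemma Rintegral_le_leb (E : set 'rV[R]_d) (g : 'rV[R]_d -> R) : measurable E ->
  (@leb R d).-integrable setT (EFin \o g) -> (forall x, (0 <= g x)%R) ->
  (forall x, (g x <= \1_E x)%R) -> (\int[@leb R d]_x g x)%R%:E <= leb E.
Proof.
move=> mE gi g0 Eg; rewrite /Rintegral fineK; last exact: integrable_fin_num.
rewrite -[X in _ <= leb X](setIT E) -integral_indic//; apply: ge0_le_integral => //.
- by move=> x _; rewrite lee_fin.
- by have /integrableP[] := gi.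
- exact/measurable_EFinP.
- by move=> x _; rewrite lee_fin.
Qed.

End weighted.

Section level_sets.
Variables (R : realType) (d : nat).
Local Notation leb1 := (@lebesgue_measure R).
Implicit Types (w h l : R).

Let level w h l : set 'rV[R]_d := [set x | l < h * bumpR w x].

Lemma measurable_level w h l : measurable (level w h l).
Proof.
have m : measurable_fun setT (fun x : 'rV[R]_d => h * bumpR w x).
  apply: measurable_funM => //; apply: measurable_continuous_rV.
  exact: continuous_bumpR.
have := m measurableT _ (measurable_itv `]l, +oo[); rewrite setTI.
rewrite (_ : _ @^-1` _ = level w h l)//.
by apply/seteqP; split => x; rewrite /level/= in_itv/= andbT.
Qed.

Lemma level_empty w h l : 0 <= h -> h <= l -> level w h l = set0.
Proof.
move=> h0 hl; apply/seteqP; split => // x /=; rewrite /level/= => H.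
have : h * bumpR w x <= h by rewrite ler_piMr ?bumpR_le1.
by move=> /(lt_le_trans H) /(le_lt_trans hl); rewrite ltxx.
Qed.

(** Markov's inequality: on the level set the function [h / l * bumpR w x] is at least 1. *)
Lemma level_le w h l : 0 < w -> 0 <= h -> 0 < l ->
  (leb (level w h l) <= (h / l * (w^-1 * fejC R) ^+ d)%:E)%E.
Proof.
move=> w0 h0 l0; have [bi <-] := bumpR_integral d w0.
have gi : (@leb R d).-integrable setT (EFin \o (fun x => h / l * bumpR w x)).
  exact: (integrableZl measurableT (h / l) bi).
rewrite -RintegralZl//; apply: leb_le_Rintegral => //; first exact: measurable_level.
move=> x; rewrite indicE; case: (boolP (x \in _)) => [|_] /=; last first.
  by rewrite mulr_ge0 ?bumpR_ge0// divr_ge0// ltW.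
by move/set_mem; rewrite /level/= => H; rewrite mulrAC ler_pdivlMr// mul1r ltW.
Qed.

(** By continuity [fej] is at least 1/2 on some |y| < t. Hence [bumpR w] is at least 2^-d on a cube
    of side t/w, and [c = t ^+ d] depends neither on the width nor on the height. *)
Lemma level_ge : exists2 c : R, 0 < c & forall w h l, 0 < w -> 0 <= h ->
  l < h * (1 / 2) ^+ d -> ((c * w^-1 ^+ d)%:E <= leb (level w h l))%E.
Proof.
have := @continuous_fej R 0; rewrite /continuous_at fej0.
move=> /cvgrPdist_lt/(_ (1 / 2)); have h12 : 0 < 1 / 2 :> R by lra.
move=> /(_ h12)/nbhs_ballP[t /= t0 Ht].
have fe y : `|y| < t -> 1 / 2 <= fej y.
  move=> yt; have : ball 0 t y by rewrite /ball/= sub0r normrN.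
  by move=> /Ht/=; rewrite ltr_norml => /andP[] _; lra.
exists (t ^+ d); first exact: exprn_gt0.
move=> w h l w0 h0 lh.
pose I : set R := `](- (t / w / 2)), (t / w / 2)[%classic.
have mI : measurable I by exact: measurable_itv.
have tw : 0 < t / w by rewrite divr_gt0.
have LI : leb1 I = (t / w)%:E.
  rewrite lebesgue_measure_itv/= lte_fin ifT; last by lra.
  by rewrite -EFinB; congr EFin; field; rewrite gt_eqF.
have Ii : leb1.-integrable setT (EFin \o (\1_I : R -> R)).
  apply/integrableP; split; first exact/measurable_EFinP.
  under eq_integral do rewrite /= ger0_norm//.
  by rewrite integral_indic// setIT -[X in (X < _)%E]/(leb1 I) LI ltry.
have IE : \int[leb1]_x (\1_I x : R) = t / w.
  by rewrite /Rintegral integral_indic// setIT -[X in fine X]/(leb1 I) LI.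
have [gi gE] := Rintegral_leb_prod (fun i : 'I_d => Ii).
have -> : t ^+ d * w^-1 ^+ d = \int[@leb R d]_x (\prod_i (\1_I (x ord0 i) : R)).
  by rewrite gE prodr_const card_ord IE exprMn.
have g0 (x : 'rV[R]_d) : 0 <= \prod_i (\1_I (x ord0 i) : R) by exact: prodr_ge0.
apply: Rintegral_le_leb => //; first exact: measurable_level.
move=> x; rewrite [leRHS]indicE; case: (boolP (x \in level w h l)) => xl /=.
  by apply: prodr_ile1 => i _; rewrite indicE; case: (_ \in _); rewrite /= ?lexx ler01.
have [xI|] := pselect (forall i, x ord0 i \in I).
  exfalso; move/negP: xl; apply; apply/mem_set; rewrite /level/=.
  apply: (lt_le_trans lh); rewrite ler_wpM2l//.
  rewrite -[X in _ ^+ X](card_ord d) -prodr_const; apply: ler_prod => i _.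
  apply/andP; split; first by lra.
  apply: fe; rewrite normrM (gtr0_norm w0) mulrC -ltr_pdivlMr//.
  have := set_mem (xI i); rewrite /I/= in_itv/= => /andP[]; rewrite ltr_norml; lra.
move=> /existsNP[i /negP xi]; rewrite (bigD1 i)//= [X in X * _]indicE (negbTE xi).
by rewrite mul0r.
Qed.

End level_sets.

(** * Choice of the parameters *)

Section dyadic_blocks.
Variable R : realType.
Implicit Types (x c : nat -> R).

Definition blk (n : nat) : nat := trunc_log 2 n.+1.

(** Block [j] consists of the indices [(2 ^ j + i).-1] with i < 2^j; the shift by one puts n = 0
    into block 0. *)
Lemma blkE j i : (i < 2 ^ j)%N -> blk (2 ^ j + i).-1 = j.
Proof.
move=> ij; have p0 : (0 < 2 ^ j)%N by rewrite expn_gt0.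
rewrite /blk prednK ?addn_gt0 ?p0//; apply: trunc_log_eq => //.
by rewrite leq_addr/= expnS mul2n -addnn ltn_add2l.
Qed.

Lemma blk_lt n : (n.+1 < 2 ^ (blk n).+1)%N.
Proof. by have /andP[] := trunc_log_bounds (isT : (1 < 2)%N) (ltn0Sn n). Qed.

Lemma sum_blocks x J : \sum_(n < (2 ^ J).-1) x n =
  \sum_(j < J) \sum_(i < 2 ^ j) x (2 ^ j + i).-1.
Proof.
elim: J => [|J IH]; first by rewrite !big_ord0.
have p0 : (0 < 2 ^ J)%N by rewrite expn_gt0.
have E : (2 ^ J.+1).-1 = ((2 ^ J).-1 + 2 ^ J)%N.
  by rewrite expnS mul2n -addnn -{1}(prednK p0) addSn.
rewrite E big_split_ord/= IH big_ord_recr/=; congr (_ + _).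
apply: eq_bigr => i _; congr (x _); move: (nat_of_ord i) => m.
by move: (2 ^ J)%N p0 => P P0; lia.
Qed.

(** Since N <= 2^N - 1, the first N indices are covered by the first N blocks. *)
Lemma block_sum_le x c : (forall n, 0 <= x n) ->
  (forall j, \sum_(i < 2 ^ j) x (2 ^ j + i).-1 <= c j) ->
  forall N, \sum_(n < N) x n <= \sum_(j < N) c j.
Proof.
move=> x0 xc N.
apply: (@le_trans _ _ (\sum_(n < (2 ^ N).-1) x n)); last first.
  by rewrite sum_blocks; apply: ler_sum.
have NN : (N <= (2 ^ N).-1)%N by rewrite -ltnS prednK ?expn_gt0// ltn_expl.
rewrite -(subnKC NN) big_split_ord/= lerDl; exact: sumr_ge0.
Qed.

Lemma geometric_sum_le (q : R) N : 0 <= q < 1 -> \sum_(j < N) q ^+ j <= (1 - q)^-1.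
Proof.
move=> /andP[q0 q1]; have q1' : 0 < 1 - q by rewrite subr_gt0.
rewrite -[leRHS]mul1r ler_pdivlMr// mulrC -opprB mulNr -subrX1 opprB.
by rewrite lerBlDr lerDl exprn_ge0.
Qed.

(** Used with t a power of l / height: the value 0 for t >= 1 records that a bump is invisible at
    levels above its height. *)
Definition cut (t : R) : R := if t < 1 then t else 0.

Lemma cut_ge0 t : 0 <= t -> 0 <= cut t. Proof. by rewrite /cut; case: ifP. Qed.

Let lacunary_sum1 (q c : R) N : 0 < q < 1 -> 0 <= c ->
  \sum_(n < N) cut (c * q ^+ n) <= (1 - q)^-1.
Proof.
move=> /andP[q0 q1]; have q1' : 0 < 1 - q by rewrite subr_gt0.
elim: N c => [|N IH] c c0; first by rewrite big_ord0 invr_ge0 ltW.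
have [c1|c1] := ltP c 1.
  apply: (@le_trans _ _ (\sum_(n < N.+1) q ^+ n)); last by apply: geometric_sum_le; rewrite ltW.
  apply: ler_sum => i _; rewrite /cut.
  have Q : 0 <= q ^+ i by rewrite exprn_ge0 ?ltW.
  by case: ifP => // _; rewrite (ler_piMl Q (ltW c1)).
rewrite big_ord_recl expr0 mulr1 /cut ltNge c1 add0r.
apply: le_trans (IH (c * q) (mulr_ge0 c0 (ltW q0))).
by apply: ler_sum => i _; rewrite /= exprS mulrA.
Qed.

(** The terms that survive [cut] are a stretch of a geometric progression below 1, dominated by the
    geometric series started at 1. This is why the bound is uniform in [c]. For q > 1 the sum is
    read backwards, with ratio 1/q. *)
Lemma lacunary_sum (q : R) : 0 < q -> q != 1 -> exists2 C : R, 0 < C &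
  forall (c : R) N, 0 <= c -> \sum_(n < N) cut (c * q ^+ n) <= C.
Proof.
move=> q0 q1; have [q1'|q1'|/eqP] := ltgtP q 1; last by rewrite (negbTE q1).
  exists (1 - q)^-1; first by rewrite invr_gt0 subr_gt0.
  by move=> c N c0; apply: lacunary_sum1 => //; rewrite q0.
exists (1 - q^-1)^-1; first by rewrite invr_gt0 subr_gt0 invf_lt1.
move=> c N c0; case: N => [|N]; first by rewrite big_ord0 invr_ge0 subr_ge0 invf_le1// ltW.
rewrite (reindex_inj rev_ord_inj)/=.
have qi : 0 < q^-1 < 1 by rewrite invr_gt0 q0 invf_lt1.
have c0' : 0 <= c * q ^+ N by rewrite mulr_ge0// exprn_ge0// ltW.
apply: le_trans (@lacunary_sum1 q^-1 (c * q ^+ N) N.+1 qi c0').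
apply: ler_sum => i _; rewrite subSS -mulrA exprVn.
by rewrite -[X in q ^+ X * _](@subnK i N) ?exprD ?mulfK ?expf_neq0 ?gt_eqF// -ltnS.
Qed.

End dyadic_blocks.

Section pow2.
Variable R : realType.
Implicit Types x y : R.

Lemma pw_gt0 x : 0 < 2 `^ x.
Proof. by rewrite powR_gt0. Qed.

Lemma pwD x y : 2 `^ (x + y) = 2 `^ x * 2 `^ y.
Proof. by rewrite powRD// pnatr_eq0 implybT. Qed.

Lemma pwN x : 2 `^ (- x) = (2 `^ x)^-1.
Proof. exact: powRN. Qed.

Lemma pwM x y : (2 `^ x) `^ y = 2 `^ (x * y).
Proof. by rewrite powRrM. Qed.

Lemma pw_le x y : x <= y -> 2 `^ x <= 2 `^ y.
Proof. by move=> xy; rewrite ler_powR// ler1n. Qed.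

Lemma pw_eq1 x : (2 `^ x == 1) = (x == 0).
Proof. by rewrite powR_eq1 -[X in X == 1]/(2%:R) (eqr_nat R 2 1) ltrn0. Qed.

Lemma pw_lt1 x : x < 0 -> 2 `^ x < 1.
Proof.
move=> x0; rewrite lt_neqAle pw_eq1 lt_eqF//=.
by have := pw_le (ltW x0); rewrite powRr0.
Qed.

Lemma pwX x n : (2 `^ x) ^+ n = 2 `^ (x * n%:R).
Proof. by rewrite -pwM powR_mulrn// ltW// pw_gt0. Qed.

End pow2.

Section ereal_tools.
Context {d0 : measure_display} {T : measurableType d0} {R : realType}.
Local Open Scope ereal_scope.

(** The integral of a nonnegative function is the supremum over the simple functions below it, hence
    monotone whether or not the integrand is measurable. Distribution functions of the level enter
    integrals through this lemma. *)
Lemma ge0_le_integral_sup (mu : {measure set T -> \bar R}) (D : set T)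
    (f g : T -> \bar R) : (forall x, D x -> 0 <= f x) ->
  (forall x, D x -> f x <= g x) ->
  \int[mu]_(x in D) f x <= \int[mu]_(x in D) g x.
Proof.
move=> f0 fg; have g0 x : D x -> 0 <= g x by move=> Dx; exact: le_trans (f0 x Dx) (fg x Dx).
rewrite !ge0_integralE//; apply: ereal_sup_le => _ [h hf <-].
exists h => // x; apply: (le_trans (hf x)); rewrite !patchE.
by case: ifP => // /set_mem; exact: fg.
Qed.

Lemma nneseries_le_ub (f : nat -> \bar R) (B : \bar R) : (forall n, 0 <= f n) ->
  (forall N, \sum_(n < N) f n <= B) -> \sum_(n <oo) f n <= B.
Proof.
move=> f0 fB; apply: lime_le; first exact: is_cvg_nneseries.
by apply: nearW => N; rewrite big_mkord; exact: fB.
Qed.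

Lemma le_poweR (r : R) (x y : \bar R) : (0 <= r)%R -> 0 <= x -> x <= y ->
  x `^ r <= y `^ r.
Proof.
move=> r0 x0 xy; apply: gt0_ler_poweR => //; rewrite in_itv/= leey andbT//.
exact: le_trans xy.
Qed.

End ereal_tools.

Section parameters.
Variables (R : realType) (d : nat) (s p gamma kappa : R).
Hypotheses (d0 : (0 < d)%N) (p1 : 1 < p) (kappa0 : 0 < kappa).

Let p0 : 0 < p. Proof. exact: lt_trans p1. Qed.
Let pn0 : p != 0. Proof. by rewrite gt_eqF. Qed.
Let dn0 : d%:R != 0 :> R. Proof. by rewrite pnatr_eq0 -lt0n. Qed.

(* On the block [j = blk n] the amplitude [2^(n(s + gamma/p)) * amp n] of the
   n-th bump, as seen by [P^(s + gamma/p)], and the mass of its support under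
   [mu_gamma] only depend on [j]. The constant [bigM] makes the bumps so wide,
   hence so low, that the sum of their amplitudes converges. *)
Definition bigM : R := `|gamma| + p * (`|s| + 1) + (d * (d + 5))%:R.

(** The binary logarithm of [width^-d] ([widthV]). The first term compensates the weight 2^(-n
    gamma); the second is constant on a block, yet at least [bigM * (n + 1)]. *)
Definition vol (n : nat) : R := n%:R * gamma + bigM * (2 ^ (blk n).+1)%:R.

Definition width (n : nat) : R := 2 `^ (- (vol n / d%:R)).

Definition amp (n : nat) : R :=
  2 `^ (- (n%:R * s + (blk n)%:R * kappa / p + vol n / p)).

Lemma width_gt0 n : 0 < width n. Proof. exact: pw_gt0. Qed.

Lemma amp_ge0 n : 0 <= amp n. Proof. exact/ltW/pw_gt0. Qed.

Lemma widthV n : (width n)^-1 ^+ d = 2 `^ vol n.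
Proof. by rewrite /width pwN invrK pwX; congr (_ `^ _); rewrite divfK. Qed.

Let blk_ge n : n%:R + 1 <= (2 ^ (blk n).+1)%:R :> R.
Proof. by rewrite natr1 ler_nat ltnW// blk_lt. Qed.

Let bigM_ge0 : 0 <= bigM.
Proof. by rewrite !addr_ge0// mulr_ge0 ?addr_ge0// ltW. Qed.

(** Each summand of [bigM] has its task: |gamma| absorbs [n * gamma] of either sign, p (|s| + 1)
    makes the amplitudes decay geometrically ([amp_le]), and d (d + 5) gives 1/width >= 2^(d + 5) >=
    32 d ([width_le]). *)
Let vol_ge n : (d * (d + 5))%:R + p * (`|s| + 1) * (n%:R + 1) <= vol n.
Proof.
have H : bigM * (n%:R + 1) <= bigM * (2 ^ (blk n).+1)%:R by rewrite ler_wpM2l.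
have n0 : 0 <= n%:R :> R by [].
have g : - `|gamma| <= gamma by rewrite lerNl -normrN ler_norm.
have D0 : 0 <= (d * (d + 5))%:R :> R by [].
have g0 := normr_ge0 gamma.
apply: le_trans (lerD (lexx (n%:R * gamma)) H).
rewrite /bigM; set D := (d * (d + 5))%:R in D0 *; clearbody D.
set S := p * _; clearbody S; nra.
Qed.

Lemma amp_le n : amp n <= (1 / 2) ^+ n.
Proof.
have -> : (1 / 2 : R) ^+ n = 2 `^ (- n%:R) by rewrite pwN powR_mulrn// div1r exprVn.
rewrite pw_le// lerN2.
have V : p * (`|s| + 1) * (n%:R + 1) <= vol n.
  by apply: le_trans (vol_ge n); rewrite lerDr.
have V' : (`|s| + 1) * (n%:R + 1) <= vol n / p by rewrite ler_pdivlMr// mulrC mulrA.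
have sn : - (`|s| * n%:R) <= n%:R * s.
  by rewrite mulrC -mulrN ler_wpM2l// lerNl -normrN ler_norm.
have j0 : 0 <= (blk n)%:R * kappa / p by rewrite divr_ge0 ?(ltW p0)// mulr_ge0// ltW.
have := normr_ge0 s; have : 0 <= n%:R :> R by []; nra.
Qed.

Lemma width_le n : 32 * d%:R * width n <= 1.
Proof.
rewrite /width pwN ler_pdivrMr ?pw_gt0// mul1r.
have V : (d * (d + 5))%:R <= vol n.
  apply: le_trans (vol_ge n); rewrite lerDl !mulr_ge0 ?addr_ge0//.
  exact: ltW.
have V' : (d + 5)%:R <= vol n / d%:R.
  by rewrite ler_pdivlMr ?ltr0n// -natrM mulnC.
apply: le_trans (pw_le V'); rewrite powR_mulrn ?ler0n// addnC exprD.
rewrite -[X in X * _ <= _]/(32%:R) (_ : 2 ^+ 5 = 32 :> R); last by rewrite -natrX.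
by rewrite ler_wpM2l// -natrX ler_nat ltnW// ltn_expl.
Qed.

Variable beta : R.

Let b := s + beta / p.

Definition height (n : nat) : R := 2 `^ (n%:R * b) * amp n.

Lemma height_gt0 n : 0 < height n.
Proof. by rewrite mulr_gt0 ?pw_gt0. Qed.

Lemma heightE n : height n =
  2 `^ ((n%:R * (beta - gamma) - (blk n)%:R * kappa - bigM * (2 ^ (blk n).+1)%:R) / p).
Proof.
rewrite /height /amp -pwD /b /vol; congr (_ `^ _).
set D := (2 ^ _)%:R; clearbody D; field.
exact: pn0.
Qed.

(** The power 2^(n beta) in [height n] to the [p] cancels the weight of [mu_gamma beta]. Changing
    [beta] thus moves the heights of the bumps but not their L^p masses. *)
Lemma height_mass n :
  2 `^ (- (n%:R * beta)) * height n `^ p * 2 `^ vol n = 2 `^ (- ((blk n)%:R * kappa)).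
Proof.
rewrite heightE pwM -!pwD divfK// /vol; congr (_ `^ _); ring.
Qed.

Let sigma : R := (p - 1) / 2.
Let sigma0 : 0 < sigma.
Proof. by rewrite divr_gt0// subr_gt0. Qed.

(** Below the height its square is (l/h)^(p-1), the advantage of Markov's bound over (h/l)^p. Taking
    half of the exponent leaves one factor to sum over the bumps and one to integrate in [l]. *)
Definition gain (n : nat) (l : R) : R := cut ((l / height n) `^ sigma).

Lemma gain_ge0 n l : 0 <= gain n l.
Proof. by apply: cut_ge0; exact: powR_ge0. Qed.

Lemma gain_le1 n l : gain n l <= 1.
Proof. by rewrite /gain /cut; case: ifP => // /ltW. Qed.

Lemma gainE n l : 0 < l -> gain n l = if l < height n then (l / height n) `^ sigma else 0.
Proof.
move=> l0; rewrite /gain /cut; congr (if _ then _ else _).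
have lh : 0 < l / height n by rewrite divr_gt0 ?height_gt0.
have -> : (l < height n) = (l / height n < 1) by rewrite ltr_pdivrMr ?height_gt0// mul1r.
have one : (1 : R) `^ sigma = 1 by rewrite powR1.
have [L|L] := ltP (l / height n) 1.
  by rewrite -[ltRHS]one; apply: gt0_ltr_powR => //; rewrite nnegrE// ltW.
apply/negbTE; rewrite -leNgt -[leLHS]one.
by apply: ge0_ler_powR; rewrite ?nnegrE// ltW.
Qed.

Let uu := lpiece (d := d) amp width.

Lemma lorentz_level_ysection n l : 0 < l ->
  ysection [set z | l < normc (Pop b uu z)] n%:Z =
  [set x | l < height n * bumpR (width n) x].
Proof.
move=> l0; apply/seteqP; split => x; rewrite /ysection/= inE/=;
  rewrite /Pop/= !ComplexField.Normc.normcM normc_bump !normc_real !ger0_norm ?powR_ge0 ?amp_ge0//;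
  by rewrite mulrA.
Qed.

Lemma lorentz_level_ysectionN n l : 0 < l ->
  ysection [set z | l < normc (Pop b uu z)] (Negz n) = set0.
Proof.
move=> l0; apply/seteqP; split => // x; rewrite /ysection/= inE => H.
have : l < normc ((2 `^ ((Negz n)%:~R * b))%:C * 0) by exact: H.
by rewrite mulr0 ComplexField.Normc.normc0 => /(lt_trans l0); rewrite ltxx.
Qed.

Lemma cmeasurable_Pop : cmeasurable (Pop b uu).
Proof.
have m k : cmeasurable (fun x => (2 `^ (k%:~R * b))%:C * uu k x).
  apply: cmeasurableM; first exact: cmeasurable_cst.
  apply: ccontinuous_measurable; exact: ccontinuous_lpiece.
split.
  exact: (measurable_fun_fiberwise (fun k => (m k).1)).
exact: (measurable_fun_fiberwise (fun k => (m k).2)).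
Qed.

Lemma measurable_lorentz_level l : measurable [set z | l < normc (Pop b uu z)].
Proof.
have := measurable_normc cmeasurable_Pop measurableT (measurable_itv `]l, +oo[).
rewrite setTI (_ : _ @^-1` _ = [set z | l < normc (Pop b uu z)])//.
by apply/seteqP; split => x /=; rewrite in_itv/= andbT.
Qed.

Lemma lorentz_distribution l : 0 < l ->
  mu_gamma beta [set z | l < normc (Pop b uu z)] =
  (\sum_(n <oo) (2 `^ (- (n%:R * beta)))%:E *
     leb [set x : 'rV[R]_d | (l < height n * bumpR (width n) x)%R])%E.
Proof.
move=> l0; rewrite mu_gamma_ysection; last exact: measurable_lorentz_level.
rewrite esum_int_nat.
- by apply: eq_eseriesr => n _; rewrite lorentz_level_ysection.
- by move=> k; rewrite mule_ge0 ?lee_fin ?powR_ge0.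
- by move=> n; rewrite lorentz_level_ysectionN// measure0 mule0.
Qed.

(** For l < h, Markov's bound (h/l) 2^vol equals l^-p (h^p 2^vol) (l/h)^(p-1), and [height_mass]
    evaluates the middle factor together with the weight. For l >= h the level set is empty and
    [gain] is 0. *)
Lemma lorentz_distribution_le l : 0 < l ->
  (mu_gamma beta [set z | (l < normc (Pop b uu z))%R] <=
   \sum_(n <oo) (fejC R ^+ d * l `^ (- p) *
     (2 `^ (- ((blk n)%:R * kappa)) * gain n l ^+ 2))%:E)%E.
Proof.
move=> l0; rewrite lorentz_distribution//; apply: lee_nneseries => [n _|n _].
  by rewrite mule_ge0 ?lee_fin ?powR_ge0.
have [hl|lh] := leP (height n) l.
  rewrite level_empty ?(ltW (height_gt0 n))// measure0 mule0 lee_fin.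
  have K0 : 0 <= fejC R ^+ d.
    by apply: exprn_ge0; apply: Rintegral_ge0 => t _; exact: fej_ge0.
  by apply: mulr_ge0; [exact: mulr_ge0 (powR_ge0 _ _)|exact: mulr_ge0 (powR_ge0 _ _) (sqr_ge0 _)].
apply: (@le_trans _ _ ((2 `^ (- (n%:R * beta)))%:E *
    (height n / l * ((width n)^-1 * fejC R) ^+ d)%:E)%E).
  rewrite lee_wpmul2l ?lee_fin ?powR_ge0//.
  by apply: level_le; rewrite ?width_gt0 ?(ltW (height_gt0 n)).
rewrite -EFinM lee_fin gainE// lh.
rewrite le_eqVlt; apply/orP; left; apply/eqP.
have -> : ((l / height n) `^ sigma) ^+ 2 = (l / height n) `^ (p - 1).
  rewrite -powR_mulrn ?powR_ge0// -powRrM; congr (_ `^ _).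
  by rewrite /sigma; field.
rewrite exprMn widthV.
have h0 := height_gt0 n.
rewrite -height_mass.
have -> : (l / height n) `^ (p - 1) = l `^ p * l^-1 * ((height n `^ p)^-1 * height n).
  have E (x : R) : 0 < x -> x `^ (p - 1) = x `^ p * x^-1.
    by move=> x0; rewrite powRD ?(gt_eqF x0) ?implybT// powR_inv1// ltW.
  have hV : 0 < (height n)^-1 by rewrite invr_gt0.
  rewrite powRM ?ltW// E// E// invrK; congr (_ * (_ * _)).
  by rewrite -(powR_inv1 (ltW h0)) -!powRrM mulN1r powRN.
rewrite (powRN l).
have lp : l `^ p != 0 by rewrite gt_eqF ?powR_gt0.
have hp : height n `^ p != 0 by rewrite gt_eqF ?powR_gt0.
by field; rewrite lp hp gt_eqF.
Qed.

End parameters.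

(** * Lorentz and Besov norms *)

Section power_integral.
Variable R : realType.
Local Notation leb1 := (@lebesgue_measure R).

Lemma integral_powR_le (h tau : R) : 0 < h -> 0 < tau ->
  (\int[leb1]_(l in `]0%R, +oo[)
     ((if (l < h)%R then (l / h) `^ tau else 0) * l^-1)%:E <= (tau^-1)%:E)%E.
Proof.
move=> h0 t0.
pose F (l : R) := h `^ (- tau) * l `^ (tau - 1).
have FE l : 0 < l -> F l = (l / h) `^ tau * l^-1.
  move=> l0; rewrite /F powRM ?invr_ge0 ?ltW// -(powR_inv1 (ltW h0)) -powRrM mulN1r.
  by rewrite powRD ?(gt_eqF l0) ?implybT// powR_inv1 ?ltW//; ring.
have F0 l : 0 <= F l by rewrite mulr_ge0 ?powR_ge0.
(* The integrand may be singular at 0, so the fundamental theorem is applied on [h/(n+2), h], a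
   proper interval for every n, followed by monotone convergence. *)
pose J (n : nat) : set R := `[h / n.+2%:R, h]%classic.
have an n : 0 < h / n.+2%:R by rewrite divr_gt0.
have anh n : h / n.+2%:R < h by rewrite ltr_pdivrMr// ltr_pMr// ltr1n.
have mF : measurable_fun setT F.
  by apply: measurable_funM => //; exact: measurable_powR.
have UJ : \bigcup_n J n = `]0, h]%classic.
  apply/seteqP; split => x /=.
    by move=> [n _]; rewrite /J/= !in_itv/= => /andP[x1 ->]; rewrite (lt_le_trans (an n) x1).
  rewrite in_itv/= => /andP[x0 xh]; exists (Num.truncn (h / x)) => //.
  rewrite /J/= in_itv/= xh andbT ler_pdivrMr// mulrC -ler_pdivrMr//.
  by apply: ltW; apply: lt_trans (truncnS_gt _) _; rewrite ltr_nat.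
have JE n : (\int[leb1]_(l in J n) (F l)%:E <= (tau^-1)%:E)%E.
  pose Phi (l : R) := h `^ (- tau) / tau * l `^ tau.
  have dPhi (x : R) : 0 < x -> is_derive x 1 Phi (F x).
    move=> x0; have D := is_derive1_powR tau x0.
    apply: (is_derive_eq (is_deriveZ (h `^ (- tau) / tau) D)).
    by rewrite /GRing.scale/= /F; field; rewrite gt_eqF.
  have cPhi (x : R) : 0 < x -> {for x, continuous Phi}.
    move=> x0; apply/differentiable_continuous/derivable1_diffP.
    exact: (@ex_derive _ _ _ _ _ _ _ (dPhi x x0)).
  rewrite (@continuous_FTC2 R F Phi _ _ (anh n)).
  - rewrite -EFinB lee_fin.
    have -> : Phi h = tau^-1.
      by rewrite /Phi powRN; field; rewrite !gt_eqF ?powR_gt0.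
    by rewrite lerBlDr lerDl /Phi !mulr_ge0 ?powR_ge0// invr_ge0 ltW.
  - apply: continuous_in_subspaceT => x; rewrite inE/= in_itv/= => /andP[ax _].
    have x0 := lt_le_trans (an n) ax.
    have D := is_derive1_powR (tau - 1) x0.
    have H : {for x, continuous (fun l : R => l `^ (tau - 1))}.
      apply/differentiable_continuous/derivable1_diffP.
      exact: (@ex_derive _ _ _ _ _ _ _ D).
    exact: (cvgM (cvg_cst (h `^ (- tau))) H).
  - split.
    + move=> x; rewrite in_itv/= => /andP[ax _].
      exact: (@ex_derive _ _ _ _ _ _ _ (dPhi x (lt_trans (an n) ax))).
    + by apply: cvg_at_right_filter; exact: (cPhi _ (an n)).
    + by apply: cvg_at_left_filter; exact: (cPhi _ h0).
  - move=> x; rewrite in_itv/= => /andP[ax _]; rewrite derive1E.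
    exact: (@derive_val _ _ _ _ _ _ _ (dPhi x (lt_trans (an n) ax))).
apply: (@le_trans _ _ (\int[leb1]_(l in `]0%R, h]) (F l)%:E)%E).
  rewrite integral_mkcond [leRHS]integral_mkcond; apply: ge0_le_integral_sup => x _.
    rewrite patchE; case: ifP => // /set_mem/=; rewrite in_itv/= andbT => x0.
    rewrite lee_fin mulr_ge0 ?invr_ge0 ?(ltW x0)//; case: ifP => // _.
    exact: powR_ge0.
  rewrite !patchE; case: ifP => [/set_mem/=|_]; last by case: ifP => // _; rewrite lee_fin.
  rewrite in_itv/= andbT => x0; case: (ltP x h) => xh.
    by rewrite mem_set ?FE//= in_itv/= x0 ltW.
  by rewrite mul0r; case: ifP => // _; rewrite lee_fin.
rewrite -UJ.
have H : (\int[leb1]_(x in J i) (EFin \o F) x)%E @[i --> \oo] --> (\int[leb1]_(x in \bigcup_i J i) (EFin \o F) x)%E.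
  apply: ge0_nondecreasing_set_cvg_integral.
  - move=> m n mn; apply/subsetPset => x; rewrite /J/= !in_itv/= => /andP[x1 ->]; rewrite andbT.
    apply: le_trans x1; rewrite ler_pM2l// lef_pV2 ?posrE ?ltr0n// ler_nat.
    by rewrite !ltnS.
  - by move=> i; exact: measurable_itv.
  - by move=> i; apply/measurable_EFinP; exact: measurable_funTS.
  - by move=> i x _; rewrite lee_fin.
rewrite -(cvg_lim (@ereal_hausdorff R) H); apply: lime_le.
  by apply/cvg_ex; eexists; exact: H.
by apply: nearW => n; exact: JE.
Qed.

End power_integral.

Section block_weights.
Variable R : realType.

Lemma pw_geometric (t : R) : 0 < t -> exists2 C : R, 0 < C &
  forall N, \sum_(j < N) 2 `^ (- (j%:R * t)) <= C.
Proof.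
move=> t0; exists (1 - 2 `^ (- t))^-1.
  by rewrite invr_gt0 subr_gt0 pw_lt1// oppr_lt0.
move=> N; under eq_bigr do rewrite mulrC -mulNr -pwX.
apply: geometric_sum_le; rewrite ltW ?pw_gt0//=; apply: pw_lt1.
by rewrite oppr_lt0.
Qed.

(** Block j contributes 2^j equal terms 2^(-j c), in total 2^(-j (c - 1)). *)
Lemma blk_weight_sum (c : R) : 1 < c -> exists2 C : R, 0 < C &
  forall N, \sum_(n < N) 2 `^ (- ((blk n)%:R * c)) <= C.
Proof.
move=> c1; have [|C C0 HC] := @pw_geometric (c - 1); first by rewrite subr_gt0.
exists C => // N; apply: le_trans (HC N).
apply: (@block_sum_le R (fun n => 2 `^ (- ((blk n)%:R * c)))
  (fun j => 2 `^ (- (j%:R * (c - 1))))) => [n|j]; first exact: powR_ge0.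
under eq_bigr => i _ do rewrite blkE//.
rewrite sumr_const card_ord -[leLHS]mulr_natl natrX -powR_mulrn// -pwD.
by apply: pw_le; rewrite mulrBr mulr1 opprB addrC lexx.
Qed.

End block_weights.

Section membership.
Variables (R : realType) (d : nat) (s p gamma kappa : R).
Hypotheses (d0 : (0 < d)%N) (p1 : 1 < p) (kappa0 : 0 < kappa).
Local Notation leb1 := (@lebesgue_measure R).

Let p0 : 0 < p. Proof. exact: lt_trans p1. Qed.
Let u := lpiece (d := d) (amp d s p gamma kappa) (width d s p gamma).
Let K : R := fejC R ^+ d.

Let K0 : 0 <= K.
Proof. by apply: exprn_ge0; apply: Rintegral_ge0 => t _; exact: fej_ge0. Qed.

Section lorentz.
Variable beta : R.
Hypothesis bg : beta != gamma.
Let sigma : R := (p - 1) / 2.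
Let sigma0 : 0 < sigma.
Proof. by rewrite divr_gt0// subr_gt0. Qed.
Let g n l := gain d s p gamma kappa beta n l.
Let g0 n l : 0 <= g n l. Proof. exact: gain_ge0. Qed.

(** Within a block the heights form a geometric progression of ratio 2^((beta - gamma) / p),
    different from 1 exactly because [beta != gamma]. All that depends on [j] and [l] goes into the
    prefactor [c], in which [lacunary_sum] is uniform. *)
Let gain_block : exists2 C : R, 0 < C & forall l, 0 < l -> forall j,
  \sum_(i < 2 ^ j) g (2 ^ j + i).-1 l <= C.
Proof.
pose q : R := 2 `^ (sigma * ((gamma - beta) / p)).
have q1 : q != 1.
  by rewrite /q pw_eq1 mulf_neq0 ?(gt_eqF sigma0)// mulf_neq0 ?invr_neq0 ?(gt_eqF p0)// subr_eq0 eq_sym.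
have [C C0 HC] := lacunary_sum (pw_gt0 _) q1.
exists C => // l l0 j.
pose c : R := l `^ sigma * 2 `^ (- (sigma * (((2 ^ j)%:R - 1) * (beta - gamma) -
   j%:R * kappa - bigM d s p gamma * (2 ^ j.+1)%:R) / p)).
have c0 : 0 <= c by rewrite mulr_ge0 ?powR_ge0.
apply: le_trans (HC c (2 ^ j)%N c0); apply: ler_sum => i _.
rewrite /g /gain le_eqVlt; apply/orP; left; apply/eqP; congr cut.
rewrite powRM ?invr_ge0 ?(ltW l0) ?(ltW (height_gt0 _ _ _ _ _ _ _))//.
rewrite /c -mulrA; congr (_ * _).
rewrite heightE// blkE// -pwN pwM pwX -pwD; congr (_ `^ _).
have -> : (2 ^ j + i).-1%:R = (2 ^ j)%:R - 1 + i%:R :> R.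
  have H : (2 ^ j + i).-1%:R + 1 = (2 ^ j)%:R + i%:R :> R.
    by rewrite natr1 prednK ?addn_gt0 ?expn_gt0// natrD.
  by rewrite -[LHS](addrK 1) H; ring.
set A := (2 ^ j)%:R; set B := (2 ^ j.+1)%:R; set I := i%:R; set J := j%:R.
clearbody A B I J.
by rewrite /sigma; field; rewrite gt_eqF.
Qed.

Let gain_weight_sum theta : 0 < theta -> exists2 C : R, 0 < C &
  forall l, 0 < l -> forall N, \sum_(n < N) 2 `^ (- ((blk n)%:R * theta)) * g n l <= C.
Proof.
move=> t0; have [C C0 HC] := gain_block; have [C' C0' HC'] := pw_geometric t0.
exists (C' * C) => [|l l0 N]; first exact: mulr_gt0.
apply: le_trans (ler_wpM2r (ltW C0) (HC' N)); rewrite mulr_suml.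
apply: (@block_sum_le R (fun n => 2 `^ (- ((blk n)%:R * theta)) * g n l)
  (fun j => 2 `^ (- (j%:R * theta)) * C)) => [n|j]; first by rewrite mulr_ge0 ?powR_ge0.
under eq_bigr => i _ do rewrite blkE//.
by rewrite -mulr_sumr ler_wpM2l ?powR_ge0// HC.
Qed.

Let D l := (mu_gamma beta [set z | (l < normc (Pop (s + beta / p) u z))%R]).

Let D_le l : 0 < l -> (D l <= \sum_(n <oo) (K * l `^ (- p) *
  (2 `^ (- ((blk n)%:R * kappa)) * g n l ^+ 2))%:E)%E.
Proof. exact: lorentz_distribution_le. Qed.

(** One factor [gain] is bounded by 1; the other, summed with the weights 2^(-j kappa), leaves a
    constant multiple of l^-p for the distribution function. *)
Lemma lorentz_infty_mem :
  lorentz (@mu_gamma R d beta) p +oo%E (Pop (s + beta / p) u).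
Proof.
split; first exact: cmeasurable_Pop.
have [C C0 HC] := gain_weight_sum kappa0.
apply: (@le_lt_trans _ _ ((K * C) `^ p^-1)%:E); last exact: ltry.
apply: ge_ereal_sup => _ [l /= l0 <-].
have H : (D l <= (K * l `^ (- p) * C)%:E)%E.
  apply: (le_trans (D_le l0)); apply: nneseries_le_ub => [n|N].
    by rewrite lee_fin !mulr_ge0 ?powR_ge0 ?sqr_ge0.
  rewrite sumEFin lee_fin -mulr_sumr ler_wpM2l ?mulr_ge0 ?powR_ge0//.
  apply: le_trans (HC l l0 N); apply: ler_sum => n _.
  by rewrite ler_wpM2l ?powR_ge0// expr2 ler_piMr// gain_le1.
apply: (@le_trans _ _ (l%:E * ((K * l `^ (- p) * C)%:E `^ p^-1))%E).
  by rewrite lee_wpmul2l ?lee_fin ?(ltW l0)// le_poweR ?invr_ge0 ?(ltW p0).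
rewrite poweR_EFin -EFinM lee_fin.
have -> : K * l `^ (- p) * C = (K * C) * l `^ (- p) by ring.
rewrite powRM ?mulr_ge0 ?powR_ge0 ?(ltW C0)// -powRrM mulNr mulfV ?gt_eqF//.
by rewrite powR_inv1 ?(ltW l0)// mulrCA mulfV ?gt_eqF// mulr1.
Qed.

(** [theta] splits the weight 2^(-j kappa). The part 2^(-j theta) makes the sum of one factor [gain]
    converge over the blocks; the rest, raised to the power r / p, is summable over all bumps
    because the exponent exceeds 1. *)
Lemma lorentz_fin_mem (r theta : R) : p < r -> 0 < theta ->
  1 < (kappa - theta) * (r / p) ->
  lorentz (@mu_gamma R d beta) p r%:E (Pop (s + beta / p) u).
Proof.
move=> pr t0 kt1; split; first exact: cmeasurable_Pop.
have r0 : 0 < r by exact: lt_trans pr.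
pose rho := r / p; have rho0 : 0 < rho by exact: divr_gt0.
have [C C0 HC] := gain_weight_sum t0.
have [C' C0' HC'] := blk_weight_sum kt1.
pose sn n l := 2 `^ (- ((blk n)%:R * (kappa - theta))) * g n l.
have sn0 n l : 0 <= sn n l by rewrite mulr_ge0 ?powR_ge0.
pose S l : \bar R := (\sum_(n <oo) (sn n l `^ rho)%:E)%E.
have S0 l : (0 <= S l)%E by apply: nneseries_ge0 => n _ _; rewrite lee_fin powR_ge0.
(* Holder at fixed [l], in l^1-l^oo form: one factor [sn n l] is bounded by
   [S l `^ rho^-1], whose rho-th power can be integrated in [l] term by term, and
   the remaining factors are summed by [gain_weight_sum]. *)
have snS n l : ((sn n l)%:E <= S l `^ rho^-1)%E.
  apply: (@le_trans _ _ (((sn n l `^ rho)%:E) `^ rho^-1)%E).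
    by rewrite poweR_EFin -powRrM mulfV ?gt_eqF// powRr1.
  apply: le_poweR; rewrite ?invr_ge0 ?(ltW rho0)// ?lee_fin ?powR_ge0//.
  apply: (@le_trans _ _ (\sum_(0 <= i < n.+1) (sn i l `^ rho)%:E)%E); last first.
    by apply: nneseries_lim_ge => i _ _; rewrite lee_fin powR_ge0.
  by rewrite big_nat_recr//= leeDr// sume_ge0// => i _; rewrite lee_fin powR_ge0.
have B l : 0 < l -> (D l <= (K * l `^ (- p) * C)%:E * S l `^ rho^-1)%E.
  move=> l0; apply: (le_trans (D_le l0)); apply: nneseries_le_ub => [n|N].
    by rewrite lee_fin !mulr_ge0 ?powR_ge0 ?sqr_ge0.
  have KL : 0 <= K * l `^ (- p) by rewrite mulr_ge0 ?powR_ge0.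
  apply: (@le_trans _ _ (\sum_(n < N) ((K * l `^ (- p) * (2 `^ (- ((blk n)%:R * theta)) * g n l))%:E * S l `^ rho^-1))%E).
    apply: lee_sum => n _.
    have -> : 2 `^ (- ((blk n)%:R * kappa)) * g n l ^+ 2 =
        (2 `^ (- ((blk n)%:R * theta)) * g n l) * sn n l.
      rewrite /sn (_ : - ((blk n)%:R * kappa) = - ((blk n)%:R * theta) + - ((blk n)%:R * (kappa - theta))); last by ring.
      by rewrite pwD; ring.
    rewrite mulrA EFinM lee_wpmul2l// lee_fin mulr_ge0// mulr_ge0 ?powR_ge0//.
  rewrite -ge0_sume_distrl; last first.
    by move=> n _; rewrite lee_fin mulr_ge0// mulr_ge0 ?powR_ge0.
  rewrite lee_wpmul2r ?poweR_ge0// sumEFin lee_fin -mulr_sumr ler_wpM2l//.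
  exact: HC.
have KC0 : 0 <= (K * C) `^ rho by exact: powR_ge0.
rewrite /lorentz_qnorm.
suff I : (\int[leb1]_(l in `]0%R, +oo[) ((l `^ r)%:E *
    mu_gamma beta [set x | (l < normc (Pop (s + beta / p) u x))%R] `^ (r / p) * (l^-1)%:E)
    <= ((K * C) `^ rho * (sigma * rho)^-1 * C')%:E)%E.
  apply: (@le_lt_trans _ _ (((r * ((K * C) `^ rho * (sigma * rho)^-1 * C'))%:E) `^ r^-1)%E).
    apply: le_poweR; rewrite ?invr_ge0 ?(ltW r0)//.
      rewrite mule_ge0 ?lee_fin ?(ltW r0)// integral_ge0// => l.
      rewrite /= in_itv/= andbT => l0.
      by rewrite !mule_ge0 ?poweR_ge0 ?lee_fin ?powR_ge0// invr_ge0 ltW.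
    by rewrite EFinM lee_wpmul2l// lee_fin ltW.
  by rewrite poweR_EFin ltry.
(* The part of the integrand that depends on [l]. By scale invariance of dl/l its integral is
   bounded by [(sigma * rho)^-1], whatever the height. *)
pose G n l : R := (if l < height d s p gamma kappa beta n then
  (l / height d s p gamma kappa beta n) `^ (sigma * rho) else 0) * l^-1.
have G0 n l : 0 < l -> 0 <= G n l.
  move=> l0; rewrite mulr_ge0 ?invr_ge0 ?(ltW l0)//; case: ifP => // _.
  exact: powR_ge0.
have snG n l : 0 < l -> sn n l `^ rho * l^-1 =
    2 `^ (- ((blk n)%:R * ((kappa - theta) * rho))) * G n l.
  move=> l0; rewrite /sn powRM ?powR_ge0// -powRrM mulNr -mulrA -mulrA.
  congr (_ * (_ * _)); rewrite /g gainE//; case: ifP => _.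
    by rewrite -powRrM.
  by rewrite powR0// gt_eqF.
have mG (n : nat) : measurable_fun (`]0, +oo[%classic : set R) (G n).
  apply: (eq_measurable_fun (fun l : R => (if l < height d s p gamma kappa beta n then
    (l / height d s p gamma kappa beta n) `^ (sigma * rho) else 0) * l `^ (- 1))).
    move=> l; rewrite inE/= in_itv/= andbT => l0.
    by rewrite /G powR_inv1 ?ltW.
  apply: measurable_funTS; apply: measurable_funM; last exact: measurable_powR.
  apply: measurable_fun_ifT => //; first exact: measurable_fun_ltr.
  apply: (measurableT_comp (measurable_powR (sigma * rho))).
  exact: measurable_funM.
have M0 (n : nat) : measurable_fun (`]0, +oo[%classic : set R) (fun l : R => (sn n l `^ rho * l^-1)%:E).
  apply/measurable_EFinP; apply: (eq_measurable_fun
    (fun l => 2 `^ (- ((blk n)%:R * ((kappa - theta) * rho))) * G n l)).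
    by move=> l; rewrite inE/= in_itv/= andbT => l0; rewrite snG.
  by apply: measurable_funM => //; exact: mG.
have L0 (n : nat) (l : R) : `]0, +oo[%classic l -> (0 <= (sn n l `^ rho * l^-1)%:E)%E.
  rewrite /= in_itv/= andbT => l0.
  by rewrite lee_fin mulr_ge0 ?powR_ge0// invr_ge0 ltW.
apply: (@le_trans _ _ (\int[leb1]_(l in `]0%R, +oo[) (((K * C) `^ rho)%:E *
   \sum_(n <oo) (sn n l `^ rho * l^-1)%:E))%E).
  apply: ge0_le_integral_sup => l /=; rewrite in_itv/= andbT => l0.
    by rewrite !mule_ge0 ?poweR_ge0 ?lee_fin ?powR_ge0// invr_ge0 ltW.
  have Bl : (D l `^ rho <= ((K * l `^ (- p) * C) `^ rho)%:E * S l)%E.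
    apply: (@le_trans _ _ (((K * l `^ (- p) * C)%:E * S l `^ rho^-1) `^ rho)%E).
      exact: (le_poweR (ltW rho0) (measure_ge0 _ _) (B l l0)).
    rewrite poweRM ?poweR_ge0// ?lee_fin ?mulr_ge0 ?powR_ge0 ?(ltW C0)//.
    by rewrite poweR_EFin -poweRrM mulVf ?gt_eqF// poweRe1.
  apply: (@le_trans _ _ ((l `^ r)%:E * (((K * l `^ (- p) * C) `^ rho)%:E * S l) * (l^-1)%:E)%E).
    rewrite lee_wpmul2r ?lee_fin ?invr_ge0 ?(ltW l0)// lee_wpmul2l// lee_fin.
    exact: powR_ge0.
  have -> : (\sum_(n <oo) (sn n l `^ rho * l^-1)%:E = S l * (l^-1)%:E)%E.
    rewrite muleC /S -nneseriesZl => [|n _]; last by rewrite lee_fin powR_ge0.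
    by apply: eq_eseriesr => n _; rewrite -EFinM mulrC.
  rewrite !muleA -EFinM.
  have -> : l `^ r * (K * l `^ (- p) * C) `^ rho = (K * C) `^ rho.
    have -> : K * l `^ (- p) * C = (K * C) * l `^ (- p) by ring.
    rewrite powRM ?mulr_ge0 ?powR_ge0 ?(ltW C0)// -powRrM.
    have -> : - p * rho = - r by rewrite /rho; field; rewrite gt_eqF.
    by rewrite mulrCA -powRD ?subrr ?powRr0 ?mulr1// (gt_eqF l0) implybT.
  by [].
rewrite ge0_integralZl//=; first last.
- by move=> l l0; apply: nneseries_ge0 => n _ _; exact: L0.
- exact: (ge0_emeasurable_sum (fun n l l0 _ => L0 n l l0) (fun n _ => M0 n)).
rewrite integral_nneseries//.
apply: (@le_trans _ _ (((K * C) `^ rho)%:E * \sum_(n <oo) (2 `^ (- ((blk n)%:R * ((kappa - theta) * rho))) * (sigma * rho)^-1)%:E)%E).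
  rewrite lee_wpmul2l ?lee_fin//; apply: lee_nneseries => [n _ _|n _].
    by apply: integral_ge0 => l /L0.
  rewrite (_ : (\int[leb1]_(l in _) _)%E = (\int[leb1]_(l in `]0%R, +oo[)
      ((2 `^ (- ((blk n)%:R * ((kappa - theta) * rho))))%:E * (G n l)%:E))%E); last first.
    apply: eq_integral => l; rewrite inE/= in_itv/= andbT => l0.
    by rewrite snG// EFinM.
  rewrite ge0_integralZl_EFin//; first last.
  - by apply/measurable_EFinP; exact: mG.
  - by move=> l; rewrite /= in_itv/= andbT => l0; rewrite lee_fin G0.
  rewrite EFinM lee_wpmul2l ?lee_fin ?powR_ge0//.
  by apply: integral_powR_le; [exact: height_gt0|exact: mulr_gt0].
rewrite -mulrA EFinM lee_wpmul2l// ?lee_fin//.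
apply: nneseries_le_ub => [n|N].
  by rewrite lee_fin mulr_ge0 ?powR_ge0// invr_ge0 ltW// mulr_gt0.
rewrite sumEFin lee_fin -mulr_suml mulrC ler_wpM2l ?invr_ge0 ?(ltW (mulr_gt0 _ _))//.
Qed.

End lorentz.
End membership.

Section besov_membership.
Variables (R : realType) (d : nat) (s p gamma kappa : R).
Hypotheses (d0 : (0 < d)%N) (p1 : 1 < p) (kappa0 : 0 < kappa).

Let p0 : 0 < p. Proof. exact: lt_trans p1. Qed.
Let a := amp d s p gamma kappa.
Let w := width d s p gamma.
Let u := lpiece (d := d) a w.
Let K : R := fejC R ^+ d.

Let K0 : 0 <= K.
Proof. by apply: exprn_ge0; apply: Rintegral_ge0 => t _; exact: fej_ge0. Qed.

Let N k := 'N[@leb R d]_p%:E[EFin \o (fun x => normc (u k x))]%E.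

Let N_ge0 k : (0 <= N k)%E. Proof. exact: Lnorm_ge0. Qed.

Let N_neg n : N (Negz n) = 0%E.
Proof.
rewrite /N (_ : EFin \o _ = cst 0%E) ?Lnorm0 ?gt_eqF//.
by apply/funext => x /=; rewrite expr0n/= addr0 sqrtr0.
Qed.

(** Since 0 <= [bumpR] <= 1 and p > 1, the p-th power of the bump is below the bump itself, whose
    integral is explicit. The exponents in [amp] cancel both 2^(n s) and the volume. *)
Lemma Lnorm_lpiece_le n : ((2 `^ (n%:R * s))%:E * N n%:Z <=
  (K `^ p^-1 * 2 `^ (- ((blk n)%:R * (kappa / p))))%:E)%E.
Proof.
have a0 : 0 <= a n by exact: amp_ge0.
have w0 : 0 < w n by exact: width_gt0.
have [bi bE] := bumpR_integral d w0.
have I : (\int[@leb R d]_x `|(EFin \o (fun x => normc (u n%:Z x))) x| `^ p <=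
    (a n `^ p * (2 `^ vol d s p gamma n * K))%:E)%E.
  apply: (@le_trans _ _ (\int[@leb R d]_x (a n `^ p * bumpR (w n) x)%:E)%E).
    apply: ge0_le_integral_sup => x _; first exact: poweR_ge0.
    rewrite /= ger0_norm ?normc_ge0// lee_fin /u /lpiece.
    rewrite ComplexField.Normc.normcM normc_bump normc_real ger0_norm//.
    rewrite powRM ?bumpR_ge0// ler_wpM2l ?powR_ge0//.
    have := bumpR_ge0 (w n) x; rewrite le_eqVlt => /orP[/eqP <-|b0].
      by rewrite powR0// gt_eqF.
    by apply: ge1r_powR; [rewrite b0 bumpR_le1|exact: ltW].
  rewrite (_ : (\int[_]_x _)%E = (\int[@leb R d]_x (a n `^ p * bumpR (w n) x))%:E).
    by rewrite RintegralZl// bE exprMn widthV// lee_fin.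
  rewrite /Rintegral fineK//; apply: integrable_fin_num => //.
  rewrite (_ : (fun _ => _) = (fun x => (a n `^ p)%:E * (bumpR (w n) x)%:E)%E).
    exact: integrableZl.
  by apply/funext => x; rewrite EFinM.
have NE : N n%:Z = ((\int[@leb R d]_x `|(EFin \o (fun x => normc (u n%:Z x))) x| `^ p) `^ p^-1)%E.
  by rewrite /N unlock.
rewrite NE; apply: (@le_trans _ _ ((2 `^ (n%:R * s))%:E *
  ((a n `^ p * (2 `^ vol d s p gamma n * K))%:E `^ p^-1))%E).
  rewrite lee_wpmul2l ?lee_fin ?powR_ge0// le_poweR ?invr_ge0 ?(ltW p0)//.
  by apply: integral_ge0 => x _; exact: poweR_ge0.
rewrite poweR_EFin -EFinM lee_fin le_eqVlt; apply/orP; left; apply/eqP.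
rewrite !powRM ?mulr_ge0 ?powR_ge0// -powRrM mulfV ?gt_eqF// powRr1// pwM.
rewrite !mulrA [in RHS]mulrC; congr (_ * _); rewrite /a /amp -!pwD; congr (_ `^ _).
by field; rewrite gt_eqF.
Qed.

Lemma besov_infty_mem : (besov_norm s p +oo%E u < +oo)%E.
Proof.
apply: (@le_lt_trans _ _ (K `^ p^-1)%:E); last exact: ltry.
apply: ge_ereal_sup => _ [[n|n] _ <-]; last first.
  by rewrite -/(N _) N_neg mule0 lee_fin powR_ge0.
apply: le_trans (Lnorm_lpiece_le n) _; rewrite lee_fin ler_piMr ?powR_ge0//.
rewrite -[leRHS](@powRr0 R 2); apply: pw_le; rewrite oppr_le0 mulr_ge0//.
by rewrite divr_ge0// ltW.
Qed.

Lemma besov_fin_mem (r : R) : 0 < r -> 1 < kappa * (r / p) ->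
  (besov_norm s p r%:E u < +oo)%E.
Proof.
move=> r0 kr; have [C C0 HC] := blk_weight_sum kr.
rewrite /besov_norm esum_int_nat; first last.
- by move=> n; rewrite -/(N _) N_neg poweR0r ?gt_eqF// mule0.
- by move=> k; rewrite mule_ge0 ?lee_fin ?powR_ge0 ?poweR_ge0.
apply: (@le_lt_trans _ _ (((K `^ p^-1) `^ r * C)%:E `^ r^-1)%E); last first.
  by rewrite poweR_EFin ltry.
apply: le_poweR; first by rewrite invr_ge0 ltW.
  by apply: nneseries_ge0 => n _ _; rewrite mule_ge0 ?lee_fin ?powR_ge0 ?poweR_ge0.
apply: nneseries_le_ub => [n|M].
  by rewrite mule_ge0 ?lee_fin ?powR_ge0 ?poweR_ge0.
apply: (@le_trans _ _ (\sum_(n < M)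
    ((K `^ p^-1) `^ r * 2 `^ (- ((blk n)%:R * (kappa * (r / p)))))%:E)%E); last first.
  by rewrite sumEFin lee_fin -mulr_sumr ler_wpM2l ?powR_ge0.
apply: lee_sum => n _.
apply: (@le_trans _ _ (((2 `^ (n%:R * s))%:E * N n%:Z) `^ r)%E).
  by rewrite poweRM ?lee_fin ?powR_ge0// poweR_EFin -powRrM.
apply: le_trans (le_poweR (ltW r0) _ (Lnorm_lpiece_le n)) _.
  by rewrite mule_ge0 ?lee_fin ?powR_ge0.
rewrite poweR_EFin lee_fin powRM ?powR_ge0// pwM.
by rewrite mulNr -!mulrA [r / p]mulrC.
Qed.

End besov_membership.

Lemma pw_unbounded (R : realType) (tau B : R) : 0 < tau ->
  exists j : nat, B < 2 `^ (j%:R * tau).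
Proof.
move=> t0; pose m := (Num.truncn B).+1; pose j := (Num.truncn (m%:R / tau)).+1.
exists j; apply: lt_trans (truncnS_gt B) _.
apply: (@lt_le_trans _ _ (2 `^ m%:R)).
  by rewrite powR_mulrn// -natrX ltr_nat ltn_expl.
by apply: pw_le; rewrite -ler_pdivrMr// ltW// truncnS_gt.
Qed.

(** * Divergence of the weak Lorentz norm *)

Section nonmembership.
Variables (R : realType) (d : nat) (s p gamma kappa : R).
Hypotheses (d0 : (0 < d)%N) (p1 : 1 < p) (kappa0 : 0 < kappa) (kappa1 : kappa < 1).

Let p0 : 0 < p. Proof. exact: lt_trans p1. Qed.
Let u := lpiece (d := d) (amp d s p gamma kappa) (width d s p gamma).

Let h j : R := 2 `^ ((- (j%:R * kappa) - bigM d s p gamma * (2 ^ j.+1)%:R) / p).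

Let height_block j n : blk n = j -> height d s p gamma kappa gamma n = h j.
Proof.
by move=> nj; rewrite (@heightE R d s p gamma kappa p1) nj subrr mulr0 sub0r.
Qed.

(** The bumps of block [j] share the height [h j] and sit over different integers [k], so the
    measures of their level sets add up to 2^j times one of them. Halving the level provides the
    strict inequality asked for by [level_ge]. *)
Let distribution_ge : exists2 c : R, 0 < c & forall j,
  ((c * 2 `^ (j%:R + bigM d s p gamma * (2 ^ j.+1)%:R))%:E <=
   mu_gamma gamma [set z | (h j * (1 / 2) ^+ d / 2 <
     normc (Pop (s + gamma / p) u z))%R])%E.
Proof.
have [c c0 Hc] := level_ge R d; exists c => // j.
have h0 : 0 < h j by exact: pw_gt0.
have D0 : 0 < (1 / 2 : R) ^+ d by rewrite exprn_gt0.
have hD : 0 < h j * (1 / 2) ^+ d by exact: mulr_gt0.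
have l0 : 0 < h j * (1 / 2) ^+ d / 2 by rewrite divr_gt0.
rewrite lorentz_distribution//.
pose x n : R := if blk n == j then c * 2 `^ (bigM d s p gamma * (2 ^ j.+1)%:R) else 0.
have x0 n : 0 <= x n by rewrite /x; case: ifP => // _; rewrite mulr_ge0 ?powR_ge0 ?ltW.
(* The indices below 2^(j+1) - 1 fill the blocks 0 to j, and [x] keeps only the last one. *)
apply: (@le_trans _ _ (\sum_(0 <= n < (2 ^ j.+1).-1) (x n)%:E)%E).
  rewrite big_mkord sumEFin lee_fin sum_blocks big_ord_recr/=.
  rewrite -[leLHS]add0r lerD//; first by do 2 (apply: sumr_ge0 => ? _).
  rewrite (eq_bigr (fun=> c * 2 `^ (bigM d s p gamma * (2 ^ j.+1)%:R))); last first.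
    by move=> i _; rewrite /x blkE// eqxx.
  rewrite sumr_const card_ord -[leRHS]mulr_natl (natrX R 2 j) -powR_mulrn// pwD.
  by rewrite mulrCA.
apply: (@le_trans _ _ (\sum_(0 <= n < (2 ^ j.+1).-1)
    ((2 `^ (- (n%:R * gamma)))%:E * leb [set z : 'rV[R]_d |
      (h j * (1 / 2) ^+ d / 2 < height d s p gamma kappa gamma n *
        bumpR (width d s p gamma n) z)%R]))%E); last first.
  by apply: nneseries_lim_ge => n _ _; rewrite mule_ge0 ?lee_fin ?powR_ge0.
apply: lee_sum => n _; rewrite /x; case: eqP => [nj|_]; last first.
  by rewrite mule_ge0 ?lee_fin ?powR_ge0.
rewrite (height_block nj).
have L : h j * (1 / 2) ^+ d / 2 < h j * (1 / 2) ^+ d.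
  by rewrite ltr_pdivrMr// ltr_pMr// ltr1n.
have H := Hc _ _ _ (width_gt0 d s p gamma n) (ltW h0) L.
apply: le_trans (lee_wpmul2l _ H); last by rewrite lee_fin powR_ge0.
rewrite -EFinM lee_fin widthV// mulrCA -pwD /vol nj le_eqVlt.
by apply/orP; left; apply/eqP; congr (_ * _ `^ _); ring.
Qed.

Lemma lorentz_infty_notmem :
  ~ (lorentz_qnorm (@mu_gamma R d gamma) p +oo%E (Pop (s + gamma / p) u) < +oo)%E.
Proof.
have [c c0 Hc] := distribution_ge.
set A := lorentz_qnorm _ _ _ _ => Afin.
pose E : R := (1 / 2) ^+ d / 2 * c `^ p^-1.
have E0 : 0 < E by rewrite mulr_gt0 ?powR_gt0// divr_gt0 ?exprn_gt0.
have HA j : ((E * 2 `^ (j%:R * ((1 - kappa) / p)))%:E <= A)%E.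
  have l0 : 0 < h j * (1 / 2) ^+ d / 2.
    by rewrite divr_gt0// mulr_gt0 ?exprn_gt0// pw_gt0.
  apply: (@le_trans _ _ ((h j * (1 / 2) ^+ d / 2)%:E *
    mu_gamma gamma [set z | (h j * (1 / 2) ^+ d / 2 <
     normc (Pop (s + gamma / p) u z))%R] `^ p^-1)%E); last first.
    by apply: ereal_sup_ubound; exists (h j * (1 / 2) ^+ d / 2).
  apply: (@le_trans _ _ ((h j * (1 / 2) ^+ d / 2)%:E *
      (c * 2 `^ (j%:R + bigM d s p gamma * (2 ^ j.+1)%:R))%:E `^ p^-1)%E).
    rewrite poweR_EFin -EFinM lee_fin powRM ?powR_ge0 ?(ltW c0)// pwM.
    (* The large exponent [bigM * 2 ^ j.+1] cancels between the height and the measure. *)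
    have -> : j%:R * ((1 - kappa) / p) =
      (- (j%:R * kappa) - bigM d s p gamma * (2 ^ j.+1)%:R) / p +
      (j%:R + bigM d s p gamma * (2 ^ j.+1)%:R) / p by ring.
    by rewrite pwD -/(h j) /E le_eqVlt; apply/orP; left; apply/eqP; ring.
  rewrite lee_wpmul2l ?lee_fin ?(ltW l0)// le_poweR ?invr_ge0 ?(ltW p0)//.
  by rewrite lee_fin mulr_ge0 ?powR_ge0// ltW.
have A0 : (0 <= A)%E.
  by apply: le_trans (HA 0%N); rewrite lee_fin mulr_ge0 ?powR_ge0// ltW.
have tau0 : 0 < (1 - kappa) / p by rewrite divr_gt0// subr_gt0.
have [j] := pw_unbounded (fine A / E) tau0.
rewrite ltr_pdivrMr// mulrC ltNge -lee_fin fineK ?HA//.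
by rewrite ge0_fin_numE.
Qed.

End nonmembership.

(** * Uniqueness of the pieces and conclusion *)

(** Two families have pieces with equal pairings against all transforms of Schwartz functions. This
    lets a single computed family refute an existential membership. *)
Lemma LP_unique (R : realType) (d : nat) (phi : 'rV[R]_d -> R[i]) f u1 u2 :
  is_LP phi f u1 -> is_LP phi f u2 -> u1 = u2.
Proof.
move=> H1 H2; apply/funext => k; apply/funext.
have [c1 g1 E1] := H1 k; have [c2 g2 E2] := H2 k.
apply: fourier_pairing_inj => // eta se.
by have := E1 eta se; rewrite -(E2 eta se).
Qed.

(** Here q is p / r, or 0 when r is infinite: kappa < 1 drives the divergence of the weak norm, and
    the gap above q the finiteness of the other norms. *)
Lemma exponent_choice (R : realType) (q : R) : 0 <= q < 1 ->
  exists kappa theta : R, [/\ 0 < kappa < 1, 0 < theta & q < kappa - theta].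
Proof. by move=> /andP[q0 q1]; exists ((1 + q) / 2), ((1 - q) / 4); split; lra. Qed.

Theorem theorem1p5 (R : realType) (d : nat) (phi : 'rV[R]_d -> R[i])
    (s p : R) (r : \bar R) :
  (0 < d)%N -> LP_cutoff phi -> 1 < p -> (p%:E < r)%E ->
  (forall gamma : R,
     besov phi s p r `\` lorentz_besov phi s p gamma +oo%E !=set0) /\
  (forall beta gamma : R, beta != gamma ->
     lorentz_besov phi s p beta r `\` lorentz_besov phi s p gamma +oo%E
       !=set0).
Proof.
move=> d0 Hphi p1 pr; have p0 : 0 < p by exact: lt_trans p1.
have [kappa [theta [/andP[k0 k1] t0 HB HL]]] : exists kappa theta : R,
    [/\ 0 < kappa < 1, 0 < theta,
      forall gamma, (besov_norm s p r (lpiece (d := d)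
        (amp d s p gamma kappa) (width d s p gamma)) < +oo)%E &
      forall beta gamma, beta != gamma ->
        lorentz (@mu_gamma R d beta) p r (Pop (s + beta / p)
          (lpiece (amp d s p gamma kappa) (width d s p gamma)))].
  case: r pr => [r| |//] pr.
    rewrite lte_fin in pr; have r0 : 0 < r by exact: lt_trans pr.
    have [|kappa [theta [/andP[k0 k1] t0 kt]]] := @exponent_choice R (p / r).
      by rewrite divr_ge0 ?(ltW p0) ?(ltW r0)//= ltr_pdivrMr// mul1r.
    have E (x : R) : p / r < x -> 1 < x * (r / p).
      by rewrite mulrA ltr_pdivlMr// mul1r ltr_pdivrMr.
    exists kappa, theta; split; rewrite ?k0//.
      move=> gamma; apply: besov_fin_mem => //; apply: E.
      by apply: lt_trans kt _; rewrite ltrBlDr ltrDl.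
    move=> beta gamma bg; exact: (lorentz_fin_mem s d0 p1 bg pr t0 (E _ kt)).
  have [|kappa [theta [/andP[k0 k1] t0 kt]]] := @exponent_choice R 0.
    by rewrite lexx ltr01.
  exists kappa, theta; split; rewrite ?k0//.
    by move=> gamma; exact: besov_infty_mem.
  by move=> beta gamma bg; exact: lorentz_infty_mem.
(* Built from the excluded parameter [gamma] alone; [beta] only enters the norm in which [f gamma]
   is measured. *)
pose f gamma := lacunary (d := d) (amp d s p gamma kappa) (width d s p gamma).
have dual gamma : schwartz_inf_dual (f gamma).
  apply: lacunary_dual; [exact: amp_ge0|exact: amp_le|exact: width_gt0].
have LP gamma : is_LP phi (f gamma)
    (lpiece (amp d s p gamma kappa) (width d s p gamma)).
  by apply: lacunary_LP => //; [exact: amp_ge0|exact: amp_le|exact: width_gt0|exact: width_le].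
have notin gamma : ~ lorentz_besov phi s p gamma +oo%E (f gamma).
  move=> [_ [u [uLP [_]]]]; rewrite (LP_unique uLP (LP gamma)).
  exact: lorentz_infty_notmem.
split=> [gamma|beta gamma bg]; exists (f gamma); split => //.
  by split=> //; eexists; split; [exact: LP|exact: HB].
by split=> //; eexists; split; [exact: LP|exact: HL].
Qed.
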